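(* Suppose the extended bi-degree sequences $(\mathbf{N}_n,\mathbf{D}_n,\mathbf{C}_n,\mathbf{Q}_n)$, $n\ge 1$, satisfy both Assumption A and Assumption B (stated in the context). Let $R_1^{(n,\infty)}$ be the rank of a uniformly chosen node in the directed configuration model generated by $(\mathbf{N}_n,\mathbf{D}_n,\mathbf{C}_n,\mathbf{Q}_n)$. Then $$R_1^{(n,\infty)} \Rightarrow \mathcal{R}^* \qquad \text{as } n\to\infty,$$ where $\Rightarrow$ denotes weak convergence (convergence in distribution) and $$\mathcal{R}^* := \sum_{i=1}^{\mathcal{N}_0} \mathcal{C}_i \mathcal{R}_i + \mathcal{Q}_0 .$$ Here the $\{\mathcal{R}_i\}$ are i.i.d. copies of the endogenous solution $\mathcal{R}$ (defined in the context) of $$\mathcal{R} \stackrel{\mathcal{D}}{=} \sum_{j=1}^{\mathcal{N}} \mathcal{C}_j \mathcal{R}_j + \mathcal{Q},$$ independent of $(\mathcal{N}_0,\mathcal{Q}_0,\{\mathcal{C}_i\})$. In the definition of $\mathcal{R}^*$ the weights $\{\mathcal{C}_i\}$ are i.i.d. copies of $\mathcal{C}$ independent of $(\mathcal{N}_0,\mathcal{Q}_0)$; in the fixed-point equation they are i.i.d. copies of $\mathcal{C}$ independent of $(\mathcal{N},\mathcal{Q})$.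
   Context: **Extended bi-degree sequence.** For each $n$, $(\mathbf{N}_n,\mathbf{D}_n,\mathbf{C}_n,\mathbf{Q}_n)=\{(N_i,D_i,C_i,Q_i):1\le i\le n\}$ is a (random) sequence with $N_i,D_i\in\mathbb{N}=\{0,1,2,\dots\}$, $C_i,Q_i\in\mathbb{R}$, and $L_n:=\sum_{i=1}^n N_i=\sum_{i=1}^n D_i$. ($N_i$: in-degree, $D_i$: out-degree, $C_i$: weight, $Q_i$: personalization value.) **Directed configuration model (DCM).** Node $i\in V_n=\{1,\dots,n\}$ gets $N_i$ inbound and $D_i$ outbound half-edges (stubs). Given the extended bi-degree sequence, the inbound stubs are paired with the outbound stubs by a uniformly random bijection (one of $L_n!$). Each pairing of an outbound stub of $i$ with an inbound stub of $j$ is a directed edge from $i$ to $j$. The result is a directed multigraph (self-loops and multiple edges allowed). **Rank.** Let $M=M(n)\in\mathbb{R}^{n\times n}$ with $M_{i,j}=s_{ij}C_i$, where $s_{ij}$ is the number of edges from $i$ to $j$. The rank (row) vector is $\mathbf{R}^{(n,\infty)}=\sum_{i=0}^\infty \mathbf{Q}M^i$ with $\mathbf{Q}=(Q_1,\dots,Q_n)$; it solves $\mathbf{R}=\mathbf{R}M+\mathbf{Q}$. Under Assumption A the series converges with probability tending to one; its value when it fails to converge is immaterial. $R_1^{(n,\infty)}$ denotes the coordinate of this vector corresponding to a node chosen uniformly at random from the $n$ nodes (and called node 1), the choice being independent of the pairing given the extended bi-degree sequence. **Assumption A.** There exist constants $H,\nu_1,\dots,\nu_5>0$ with $\mu:=\nu_2/\nu_1$,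 $\lambda:=\nu_3/\nu_1$ and $\rho:=\nu_5\mu/\nu_1<1$, and constants $0<\kappa\le 1$ and $0<c,\gamma,\epsilon<1$, such that the events - $\Omega_{n,1}=\{|\sum_{r=1}^n D_r-n\nu_1|\le n^{1-\gamma}\}$, - $\Omega_{n,2}=\{|\sum_{r=1}^n D_rN_r-n\nu_2|\le n^{1-\gamma}\}$, - $\Omega_{n,3}=\{|\sum_{r=1}^n D_r^2-n\nu_3|\le n^{1-\gamma}\}$, - $\Omega_{n,4}=\{|\sum_{r=1}^n D_r^{2+\kappa}-n\nu_4|\le n^{1-\gamma}\}$, - $\Omega_{n,5}=\{|\sum_{r=1}^n |C_r|D_r-n\nu_5|\le n^{1-\gamma},\ \max_{1\le r\le n}|C_r|D_r\le c\}$, - $\Omega_{n,6}=\{\sum_{r=1}^n|Q_r|\le Hn\}$ satisfy, with $\Omega_n=\bigcap_{i=1}^6\Omega_{n,i}$, $P(\Omega_n^c)=O(n^{-\epsilon})$ as $n\to\infty$. **Assumption B.** Define the random distribution functions $$F_n^*(m,q)=\frac1n\sum_{k=1}^n 1(N_k\le m,Q_k\le q),\qquad F_n(m,q,x)=\sum_{k=1}^n 1(N_k\le m,Q_k\le q,C_k\le x)\frac{D_k}{L_n}.$$ There exist random vectors $(\mathcal{N}_0,\mathcal{Q}_0)$ and $(\mathcal{N},\mathcal{Q})$ and a random variable $\mathcal{C}$ such that $d_1(F_n^*,F^* )\to0$ and $d_1(F_n,F)\to0$ in probability as $n\to\infty$, where $F^*(m,q)=P(\mathcal{N}_0\le m,\mathcal{Q}_0\le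 q)$ and $F(m,q,x)=P(\mathcal{N}\le m,\mathcal{Q}\le q)P(\mathcal{C}\le x)$. **Distance.** $d_1$ is the Kantorovich–Rubinstein (Wasserstein-1) distance on $\mathbb{R}^d$ with the $\ell_1$ norm: $d_1(\mu,\nu)=\inf_\pi\int\|\mathbf{x}-\mathbf{y}\|_1\,d\pi(\mathbf{x},\mathbf{y})$ over couplings $\pi$ of $\mu,\nu$; for distribution functions it means the distance between the corresponding measures. **Endogenous solution.** Let $(\mathcal{N},\mathcal{Q},\mathcal{C}_1,\mathcal{C}_2,\dots)$ be a vector with $(\mathcal{N},\mathcal{Q})$ as in Assumption B, $P(|\mathcal{Q}|>0)>0$, and $\{\mathcal{C}_i\}$ i.i.d. copies of $\mathcal{C}$ independent of $(\mathcal{N},\mathcal{Q})$. Let $\mathcal{U}=\bigcup_{k\ge0}(\mathbb{N}_+)^k$ be the set of finite sequences of positive integers (with $\mathbb{N}_+^0=\{\emptyset\}$), and let $\{(\mathcal{N}_{\mathbf{i}},\mathcal{Q}_{\mathbf{i}},\mathcal{C}_{(\mathbf{i},1)},\mathcal{C}_{(\mathbf{i},2)},\dots)\}_{\mathbf{i}\in\mathcal{U}}$ be i.i.d. copies of this vector. Build a tree with $\mathcal{A}_0=\{\emptyset\}$ and $\mathcal{A}_{k+1}=\{(\mathbf{i},j):\mathbf{i}\in\mathcal{A}_k,1\le j\le\mathcal{N}_{\mathbf{i}}\}$, and weights $\Pi_\emptyset=1$, $\Pi_{(\mathbf{i},j)}=\Pi_{\mathbf{i}}\mathcal{C}_{(\mathbf{i},j)}$.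 The endogenous solution is $\mathcal{R}:=\sum_{k=0}^\infty\sum_{\mathbf{i}\in\mathcal{A}_k}\Pi_{\mathbf{i}}\mathcal{Q}_{\mathbf{i}}$, which is well defined under these assumptions. *)

(* Defs.v *)
From HB Require Import structures.
From mathcomp Require Import all_boot all_order all_algebra.
From mathcomp Require Import all_classical all_reals all_analysis.

Set Implicit Arguments.
Unset Strict Implicit.
Unset Printing Implicit Defensive.

Import Order.TTheory GRing.Theory Num.Theory.
Import numFieldNormedType.Exports.

Local Open Scope classical_set_scope.
Local Open Scope ring_scope.

Section independence.
Context d (T : measurableType d) (R : realType) (P : probability T R).

Definition sigma_of d' (T' : measurableType d') (X : T -> T') : set (set T) :=
  preimage_set_system setT X measurable.

Definition sigma_join (I : Type) (F : I -> set (set T)) : set (set T) :=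
  <<s \bigcup_i F i >>.

Definition sigma_family d' (T' : measurableType d') (I : Type)
    (X : I -> {RV P >-> T'}) : set (set T) := sigma_join (fun i => sigma_of (X i)).

Definition independent2 (F G : set (set T)) : Prop :=
  forall A B, F A -> G B -> P (A `&` B) = (P A * P B)%E.

Definition mutually_independent (I : eqType) (F : I -> set (set T)) : Prop :=
  forall (s : seq I) (A : I -> set T), uniq s ->
    (forall i, i \in s -> F i (A i)) ->
    P (\big[setI/setT]_(i <- s) A i) = (\prod_(i <- s) P (A i))%E.

Definition same_law d' (T' : measurableType d') (X Y : T -> T') : Prop :=
  forall A, measurable A -> P (X @^-1` A) = P (Y @^-1` A).

Definition iid_copies d' (T' : measurableType d') (I : eqType)
    (X : I -> {RV P >-> T'}) (Y : T -> T') : Prop :=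
  (forall i, same_law (X i) Y) /\
  mutually_independent (fun i => sigma_of (X i)).

End independence.

Definition pair_rv (T A B : Type) (X : T -> A) (Y : T -> B) (w : T) : A * B :=
  (X w, Y w).

Definition cvg_in_law (R : realType)
    (d : nat -> measure_display) (T : forall k, measurableType (d k))
    (P : forall k, probability (T k) R) (X : forall k, T k -> R)
    d' (T' : measurableType d') (P' : probability T' R) (Y : T' -> R) : Prop :=
  forall f : R -> R, continuous f -> bounded_fun f ->
    ('E_(P k)[f \o X k] @[k --> \oo] --> 'E_P'[f \o Y])%E.

(* The outer measure [mu_ext] agrees with P k on measurable sets; it makes the
   definition meaningful without a measurability proof for X. *)
Definition cvg0_in_probability (R : realType)
    (d : nat -> measure_display) (T : forall k, measurableType (d k))
    (P : forall k, probability (T k) R) (X : forall k, T k -> \bar R) : Prop :=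
  forall e : R, 0 < e ->
    mu_ext (P k) [set w | (e%:E < X k w)%E] @[k --> \oo] --> 0%E.

Section wasserstein.
Context (R : realType) (m : nat).
Local Notation Rm := (m.-tuple R).

Definition lower_orthant (a : Rm) : set Rm :=
  [set x | forall i, tnth x i <= tnth a i].

(* Couplings of the measures whose distribution functions are F and G. *)
Definition couplings (F G : Rm -> \bar R) : set (probability (Rm * Rm)%type R) :=
  [set pi | (forall a, pi (fst @^-1` lower_orthant a) = F a) /\
            (forall a, pi (snd @^-1` lower_orthant a) = G a)].

Definition l1_dist (x y : Rm) : R := \sum_(i < m) `|tnth x i - tnth y i|.

(* Equal to +oo when there is no coupling, in particular when F or G is not a
   distribution function. *)
Definition d1 (F G : Rm -> \bar R) : \bar R :=
  ereal_inf [set (\int[pi]_z (l1_dist z.1 z.2)%:E)%E | pi in couplings F G].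

End wasserstein.

Record ext_bidegree d (T : measurableType d) (R : realType)
    (P : probability T R) (n : nat) := ExtBidegree {
  indeg : 'I_n -> {RV P >-> nat} ;
  outdeg : 'I_n -> {RV P >-> nat} ;
  weight : 'I_n -> {RV P >-> R} ;
  perso : 'I_n -> {RV P >-> R} ;
  sum_degE : forall w, (\sum_i indeg i w = \sum_i outdeg i w)%N
}.

Section sequence.
Context d (T : measurableType d) (R : realType) (P : probability T R) (n : nat).
Variable S : ext_bidegree P n.

Definition ext_sigma : set (set T) :=
  sigma_join (fun i : 'I_n =>
    (sigma_of (indeg S i) `|` sigma_of (outdeg S i)) `|`
    (sigma_of (weight S i) `|` sigma_of (perso S i))).

Definition nb_stubs (w : T) : nat := (\sum_i outdeg S i w)%N.

Definition degree_event (nn dd : 'I_n -> nat) : set T :=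
  [set w | (forall i, indeg S i w = nn i) /\ (forall i, outdeg S i w = dd i)].

Definition emp_df (w : T) (v : 2.-tuple R) : \bar R :=
  (n%:R^-1 * \sum_k (((indeg S k w)%:R <= v`_0) && (perso S k w <= v`_1))%:R)%:E.

Definition biased_df (w : T) (v : 3.-tuple R) : \bar R :=
  (\sum_k [&& (indeg S k w)%:R <= v`_0, perso S k w <= v`_1
            & weight S k w <= v`_2]%:R
          * ((outdeg S k w)%:R / (nb_stubs w)%:R))%:E.

Definition good_event (H nu1 nu2 nu3 nu4 nu5 kappa c gamma : R) : set T :=
  let D r w : R := (outdeg S r w)%:R in
  let N r w : R := (indeg S r w)%:R in
  let tol : R := n%:R `^ (1 - gamma) in
  [set w | `|\sum_r D r w - n%:R * nu1| <= tol] `&`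
  [set w | `|\sum_r D r w * N r w - n%:R * nu2| <= tol] `&`
  [set w | `|\sum_r D r w ^+ 2 - n%:R * nu3| <= tol] `&`
  [set w | `|\sum_r D r w `^ (2 + kappa) - n%:R * nu4| <= tol] `&`
  [set w | `|\sum_r `|weight S r w| * D r w - n%:R * nu5| <= tol /\
           forall r, `|weight S r w| * D r w <= c] `&`
  [set w | \sum_r `|perso S r w| <= H * n%:R].

(* The l-th half-edge (l < a i) of node i is the pair (i, l). *)
Definition stubs (a : 'I_n -> nat) : set ('I_n * nat) :=
  [set p | (p.2 < a p.1)%N].

(* [pairing w] maps outbound stubs to inbound stubs; its values elsewhere are
   irrelevant. Conditionally on the extended bi-degree sequence, the pair
   (pairing, node) is uniform among the L! * n possible values. *)
Record dcm := Dcm {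
  pairing : T -> 'I_n * nat -> 'I_n * nat ;
  node : T -> 'I_n ;
  pairing_bij : forall w,
    set_bij (stubs (fun i => outdeg S i w)) (stubs (fun i => indeg S i w))
      (pairing w) ;
  pairing_node_uniform :
    forall (nn dd : 'I_n -> nat) (s : 'I_n * nat -> 'I_n * nat) (v : 'I_n)
      (A : set T),
    set_bij (stubs dd) (stubs nn) s -> ext_sigma A ->
    let A' := A `&` degree_event nn dd in
    let B := A' `&` [set w | forall p, stubs dd p -> pairing w p = s p]
                `&` [set w | node w = v] in
    measurable B /\
    P B = (P A' * (((\sum_i dd i)`!)%:R^-1 * n%:R^-1)%:E)%E
}.

Definition edge_mult (G : dcm) (w : T) (i j : 'I_n) : nat :=
  (\sum_(l < outdeg S i w) ((pairing G w (i, val l)).1 == j))%N.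

End sequence.

Section rank.
Context d (T : measurableType d) (R : realType) (P : probability T R) (n : nat).
Variables (S : ext_bidegree P n.+1) (G : dcm S).

Definition rank_matrix (w : T) : 'M[R]_n.+1 :=
  \matrix_(i, j) ((edge_mult G w i j)%:R * weight S i w).

Definition perso_row (w : T) : 'rV[R]_n.+1 := \row_i perso S i w.

(* [limn] has an arbitrary default value when the series diverges. *)
Definition rank_vector (w : T) : 'rV[R]_n.+1 :=
  limn (series (fun l => perso_row w *m rank_matrix w ^+ l)).

Definition node_rank (w : T) : R := rank_vector w ord0 (node G w).

End rank.

Section assumptions.
Context (R : realType) (d : nat -> measure_display)
  (T : forall k, measurableType (d k)) (P : forall k, probability (T k) R).
(* The k-th graph has n = k.+1 nodes. *)
Variable S : forall k, ext_bidegree (P k) k.+1.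

Definition assumptionA : Prop :=
  exists H nu1 nu2 nu3 nu4 nu5 : R,
    [/\ 0 < H, 0 < nu1, 0 < nu2, 0 < nu3 & 0 < nu4] /\ 0 < nu5 /\
    nu5 * (nu2 / nu1) / nu1 < 1 /\
  exists kappa c gamma eps : R,
    [/\ 0 < kappa <= 1, 0 < c < 1, 0 < gamma < 1 & 0 < eps < 1] /\
    (fun k => fine (P k (~` good_event (S k) H nu1 nu2 nu3 nu4 nu5
                                       kappa c gamma)))
      =O_\oo (fun k => k.+1%:R `^ (- eps)).

Definition assumptionB d' (T' : measurableType d') (P' : probability T' R)
    (N0 : {RV P' >-> nat}) (Q0 : {RV P' >-> R})
    (N : {RV P' >-> nat}) (Q C : {RV P' >-> R}) : Prop :=
  let Fstar (v : 2.-tuple R) : \bar R :=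
    P' [set w | (N0 w)%:R <= v`_0 /\ Q0 w <= v`_1] in
  let F (v : 3.-tuple R) : \bar R :=
    (P' [set w | (N w)%:R <= v`_0 /\ Q w <= v`_1]%R
     * P' [set w | C w <= v`_2]%R)%E in
  cvg0_in_probability P (fun k w => d1 (emp_df (S k) w) Fstar) /\
  cvg0_in_probability P (fun k w => d1 (biased_df (S k) w) F).

End assumptions.

Section endogenous.
Context d (T : measurableType d) (R : realType) (P : probability T R).

(* {Cs} i.i.d. copies of C, independent of (N, Q). *)
Definition branching_vector (N : {RV P >-> nat}) (Q : {RV P >-> R})
    (Cs : nat -> {RV P >-> R}) (C : {RV P >-> R}) : Prop :=
  iid_copies Cs C /\
  independent2 P (sigma_of (pair_rv N Q)) (sigma_family Cs).

Definition branching_sigma (N : {RV P >-> nat}) (Q : {RV P >-> R})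
    (Cs : nat -> {RV P >-> R}) : set (set T) :=
  <<s sigma_of (pair_rv N Q) `|` \bigcup_j sigma_of (Cs j) >>.

(* Children are numbered from 0, and the j-th child (i, j) of node i is the
   list j :: i, so that a node is the reversed list of its labels. *)
Variables (Nt : seq nat -> {RV P >-> nat}) (Qt : seq nat -> {RV P >-> R})
  (Ct : seq nat -> nat -> {RV P >-> R}).

Definition branching_family (N : {RV P >-> nat}) (Q C : {RV P >-> R}) : Prop :=
  [/\ forall i, same_law P (pair_rv (Nt i) (Qt i)) (pair_rv N Q),
      forall i, branching_vector (Nt i) (Qt i) (Ct i) C
    & mutually_independent P
        (fun i => branching_sigma (Nt i) (Qt i) (Ct i))].

Fixpoint generation (w : T) (k : nat) : seq (seq nat) :=
  if k is k'.+1 then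
    [seq j :: i | i <- generation w k', j <- iota 0 (Nt i w)]
  else [:: [::]].

Fixpoint path_weight (w : T) (i : seq nat) : R :=
  if i is j :: i' then path_weight w i' * Ct i' j w else 1.

Definition endogenous (w : T) : R :=
  limn (series (fun k => \sum_(i <- generation w k) path_weight w i * Qt i w)).

Definition limit_rank (N0 : {RV P >-> nat}) (Q0 : {RV P >-> R})
    (Cs Rs : nat -> {RV P >-> R}) (w : T) : R :=
  \sum_(i < N0 w) Cs i w * Rs i w + Q0 w.

End endogenous.

(* Main.v *)
(* On the good event |C_r| D_r <= c < 1, so the rank matrix contracts the l1 norm
   and, averaged over the nodes, the rank is within O(c^k) of the depth-k rank
   [tree_rank], uniformly over the pairings. Exploring the depth-k in-neighbourhood
   of a node under the uniform pairing yields independent size-biased stubs as long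
   as no node is visited twice, and visiting a node twice is unlikely because
   D_r = o(n). Aborting such explorations only loses mass, so for h >= 0 the pairing
   average of h(rank) is bounded below by the functional [Xi] of a branching tree
   built on the empirical laws. Optimal d1-couplings compare [Xi], generation by
   generation and for Lipschitz h, with the limiting tree, whose depth-k truncation
   is within O(rho^k) of the endogenous solution in L1.

   One-sided bounds suffice: applied to h and to B - h they give convergence of the
   means, and since the library integral of a nonnegative function is a supremum
   over simple minorants, hence superadditive, the measurability of [node_rank] is
   never needed. Lipschitz test functions are enough because a bounded continuous
   function is an increasing limit of its inf-convolutions with m|x - y|. *)

Require Import Defs.
From HB Require Import structures.
From mathcomp Require Import all_boot all_order all_algebra all_fingroup.
From mathcomp Require Import all_classical all_reals all_analysis.
From mathcomp Require Import measurable_realfun ring lra.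

Set Implicit Arguments.
Unset Strict Implicit.
Unset Printing Implicit Defensive.

Import Order.TTheory GRing.Theory Num.Theory.
Import numFieldNormedType.Exports.

Local Open Scope classical_set_scope.
Local Open Scope ring_scope.

(** * Exploration under the uniform pairing *)

(** [d1] controls Lipschitz functions only, while one generation of the recursion multiplies a
    weight by an unbounded sum. The comparison therefore uses [|C| <= 1] on the empirical side,
    where [|C_r| D_r <= c < 1] gives it for every owner of an outbound stub, and cuts the unbounded
    factor on the limit side at a level [K], the excess vanishing by dominated convergence. First
    moments of the limit laws are extracted from a single regular sample through a coupling, with
    the product of the bounds for [N] and [C] still below 1. The size-biased mean in-degree may
    exceed 1, so comparison errors grow with the depth: the depth is fixed first, by the geometric
    tails, then the truncation level and the coupling distance, then the number of queries, the
    bound on [D_r / L] and the exceptional probability, and finally the size of the graph. [Xi] is a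
    functional and not a law: an expectation over independent children is an iterated average, so
    the empirical tree needs no probability space. Since lower bounds suffice, the exploration draws
    every stub uniformly among all [L], as if with replacement, which undervalues the pairing. *)

Section PermExtension.
Variable T : finType.
Implicit Types tau : seq (T * T).

Definition extends tau (s : {perm T}) := all (fun a => s a.1 == a.2) tau.

Lemma exists_extends tau : uniq (map fst tau) -> uniq (map snd tau) ->
  exists s, extends tau s.
Proof.
elim: tau => [|[x y] tau IH] /=; first by exists 1%g.
move=> /andP[xn ux] /andP[yn uy]; have [s es] := IH ux uy.
(* Swapping [s x] with [y] corrects the image of [x] and moves no other prescribed image, because
   [x] and [y] are both new. *)
exists (s * tperm (s x) y)%g; rewrite /= permM tpermL eqxx /=.
apply/allP => -[x' y'] a_in; have /eqP /= sx' := allP es _ a_in.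
rewrite /= permM sx' tpermD //.
  apply: contraNneq xn => sxy; apply/mapP; exists (x', y') => //=.
  by apply: (@perm_inj _ s); rewrite sx'.
by apply: contraNneq yn => ->; apply/mapP; exists (x', y').
Qed.

(** There are [(#|T| - k)!] extensions of [k] prescribed pairs, and the falling factorial is at most
    [#|T| ^ k]. The inequality says that revealing images at rate [1 / #|T|] each never
    overestimates the uniform permutation. *)
Lemma card_extends tau : uniq (map fst tau) -> uniq (map snd tau) ->
  ((#|T|)`! <= #|T| ^ size tau * #|[pred s | extends tau s]|)%N.
Proof.
move=> ux uy; have [s0 es0] := exists_extends ux uy.
set A := [set x | x \notin map fst tau]%SET.
have cA : #|A| = (#|T| - size tau)%N.
  have := cardsC [set x in map fst tau]%SET.
  rewrite cardsE (card_uniqP ux) size_map => <-; rewrite addKn.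
  by apply: eq_card => x; rewrite !inE.
have le : ((#|A|)`! <= #|[pred s | extends tau s]|)%N.
  (* Permutations supported off the domain of [tau], composed with one extension [s0], are again
     extensions. *)
  rewrite -(card_perm A) -(fintype.card_image (@mulIg _ s0)).
  apply/subset_leq_card/fintype.subsetP => s /fintype.imageP[s1 /= s1A ->]; rewrite inE.
  apply/allP => a a_in; rewrite permM (out_perm s1A) ?(allP es0) //.
  by rewrite inE negbK map_f.
have st : (size tau <= #|T|)%N.
  by rewrite -(size_map fst) -(card_uniqP ux) max_card.
rewrite -(ffact_fact st) -cA leq_mul //.
elim: (size tau) => // m IH; rewrite ffactnSr expnSr leq_mul //.
exact: leq_subr.
Qed.

End PermExtension.

Section Exploration.
Variables (R : realFieldType) (n L : nat).
Variables (own : 'I_L -> 'I_n) (NN : 'I_n -> nat) (CC QQ : 'I_n -> R).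
Variable st : 'I_n -> nat -> 'I_L.

(** Here [s] sends an inbound stub to its outbound partner. The value is coordinate [v] of the sum
    of [Q M^t] over [t < j] (see [mx_rankE]), unfolded along backward walks; it makes sense whether
    or not the walks form a tree. *)
Fixpoint tree_rank (s : 'S_L) j v : R :=
  if j is j'.+1 then
    QQ v + \sum_(l < NN v) CC (own (s (st v l)))
                          * tree_rank s j' (own (s (st v l)))
  else 0.

Definition avg (f : 'I_L -> R) : R := L%:R^-1 * \sum_y f y.

(** If [X f] is the mean of [f] under some law, this is the mean of [h] at a sum of [m] independent
    draws from it. *)
Fixpoint conv_iter (X : (R -> R) -> R) m (h : R -> R) : R :=
  if m is m'.+1 then X (fun r => conv_iter X m' (fun s => h (r + s))) else h 0.

(** The mean of [f (C * R_j)], where [R_j] is the [j]-generation rank of a branching tree whose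
    nodes are owners of uniform outbound stubs and [C] is the weight of its root. Zero generations
    give the value 0. *)
Fixpoint Xi j (f : R -> R) : R :=
  if j is j'.+1 then
    avg (fun y => conv_iter (Xi j') (NN (own y))
                    (fun s => f (CC (own y) * (QQ (own y) + s))))
  else f 0.

(** A pending query: an inbound stub, the number of generations to follow beyond the node it leads
    to, and the product of the weights from the root down to the stub's owner. *)
Definition item := ('I_L * nat * R)%type.

Definition push j u (w : R) : seq item :=
  if j is j'.+1 then [seq (st u l, j', w) | l <- iota 0 (NN u)] else [::].

Definition item_rank (s : 'S_L) (a : item) : R :=
  let p := own (s a.1.1) in a.2 * (CC p * tree_rank s a.1.2.+1 p).

Lemma push_rank s j u w :
  \sum_(a <- push j u w) item_rank s a = w * (tree_rank s j.+1 u - QQ u).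
Proof.
rewrite /= addrC addKr; case: j => [|j].
  by rewrite big_nil big1 ?mulr0 // => i _; rewrite /= mulr0.
rewrite big_map mulr_sumr -[X in iota _ X]subn0 -/(index_iota _ _) big_mkord.
by apply: eq_bigr.
Qed.

Section Average.
Hypothesis L0 : (0 < L)%N.

Lemma avg_le (f g : 'I_L -> R) : (forall y, f y <= g y) -> avg f <= avg g.
Proof. by move=> fg; rewrite ler_wpM2l ?invr_ge0 // ler_sum. Qed.

Lemma avg_const c : avg (fun=> c) = c.
Proof.
rewrite /avg sumr_const card_ord -[c *+ L]mulr_natl mulrA mulVf ?mul1r //.
by rewrite pnatr_eq0 -lt0n.
Qed.

Lemma avgD f g : avg (fun y => f y + g y) = avg f + avg g.
Proof. by rewrite /avg big_split mulrDr. Qed.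

Lemma avgZ c f : avg (fun y => c * f y) = c * avg f.
Proof. by rewrite /avg -mulr_sumr mulrCA. Qed.

(** Monotonicity and behaviour under additive constants are carried together by the slack [e]; this
    is the only property of an average that the comparison with the limit uses. *)
Lemma conv_iter_le (X Y : (R -> R) -> R) m h g e :
  (forall f f' e, (forall x, f x <= f' x + e) -> X f <= X f' + e) ->
  (forall x, h x <= g x + e) -> conv_iter X m h <= conv_iter X m g + e.
Proof.
move=> XX; elim: m h g => [|m IH] h g hg /=; first exact: hg.
by apply: (XX _ _) => r; apply: IH => s; apply: hg.
Qed.

Lemma Xi_le j f g e : (forall x, f x <= g x + e) -> Xi j f <= Xi j g + e.
Proof.
elim: j f g e => [|j IH] f g e fg /=; first exact: fg.
rewrite -[X in _ + X]avg_const -avgD; apply: avg_le => y.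
exact: conv_iter_le.
Qed.

Lemma conv_iter_ext (X : (R -> R) -> R) m h g :
  (forall f f', f =1 f' -> X f = X f') -> h =1 g -> conv_iter X m h = conv_iter X m g.
Proof.
move=> eX; elim: m h g => [|m IH] h g hg /=; first exact: hg.
by apply: eX => r; apply: IH => s; apply: hg.
Qed.

Lemma Xi_ext j f g : f =1 g -> Xi j f = Xi j g.
Proof.
have H u v : u =1 v -> Xi j u <= Xi j v.
  by move=> uv; rewrite -[leRHS]addr0; apply: Xi_le => x; rewrite addr0 uv.
by move=> fg; apply/eqP; rewrite eq_le !H // => x; rewrite fg.
Qed.

End Average.

Section Run.
Variable h : R -> R.

(* A query to an already visited node, or running out of fuel, aborts with
   value 0; for h >= 0 this only lowers the expectation. *)
Fixpoint explore fuel (wl : seq item) acc (V : seq 'I_n) : R :=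
  match wl with
  | [::] => h acc
  | a :: wl' =>
    if fuel is fuel'.+1 then
      avg (fun y => let u := own y in let w := a.2 * CC u in
        if u \in V then 0
        else explore fuel' (push a.1.2 u w ++ wl') (acc + w * QQ u) (u :: V))
    else 0
  end.

(** The value of a worklist when its items are resolved by independent trees: the collision-free
    counterpart of [explore]. *)
Fixpoint tree_mean (wl : seq item) acc : R :=
  if wl is a :: wl' then Xi a.1.2.+1 (fun r => tree_mean wl' (acc + a.2 * r))
  else h acc.

Hypothesis L0 : (0 < L)%N.

Definition belongs (V : seq 'I_n) x :=
  exists u l, [/\ u \in V, (l < NN u)%N & x = st u l].

Hypothesis st_inj : forall u u' l l', (l < NN u)%N -> (l' < NN u')%N ->
  st u l = st u' l' -> u = u' /\ l = l'.
Hypothesis h_ge0 : forall x, 0 <= h x.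

(** [tau] holds the pairs revealed so far. Splitting the permutations by the image [y] of the
    queried stub matches the average in [explore] with the extensions of [(a.1.1, y) :: tau]. When
    the owner of [y] is unvisited, [y] is not yet used and the inbound stubs of that owner are all
    new, so the freshness conditions persist; the other branches contribute 0 on the left and
    something nonnegative on the right. *)
Lemma explore_le_perm fuel wl acc V tau :
  uniq (map fst tau) -> uniq (map snd tau) ->
  uniq (map (fun a : item => a.1.1) wl) ->
  (forall x, x \in map (fun a : item => a.1.1) wl -> x \notin map fst tau) ->
  (forall x, x \in map (fun a : item => a.1.1) wl -> belongs V x) ->
  (forall x, x \in map fst tau -> belongs V x) ->
  (forall y, y \in map snd tau -> own y \in V) ->
  explore fuel wl acc V <= L%:R ^+ size tau / (L`!)%:R *
     \sum_(s : 'S_L | extends tau s) h (acc + \sum_(a <- wl) item_rank s a).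
Proof.
elim: fuel wl acc V tau => [|fuel IH] [|a wl] acc V tau ux uy uw dis bw bt ot.
(* With an empty worklist the summand is constant, and by [card_extends] the prefactor times the
   number of extensions is at least 1. *)
1,3: rewrite /= [X in _ <= _ * X](eq_bigr (fun=> h acc));
  [|by move=> s _; rewrite big_nil addr0];
  rewrite sumr_const -[h acc *+ _]mulr_natr mulrCA ler_peMr //;
  rewrite -mulrA mulrCA ler_pdivlMl ?ltr0n ?fact_gt0 // mulr1 -natrX -natrM;
  by rewrite ler_nat; have := card_extends ux uy; rewrite card_ord.
  by rewrite /= mulr_ge0 // ?divr_ge0 // ?exprn_ge0 // sumr_ge0.
rewrite /= /avg.
rewrite (partition_big (fun s : 'S_L => s a.1.1) xpredT) //= !mulr_sumr.
apply: ler_sum => y _; case: ifPn => [_|yV].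
  by rewrite mulr0 mulr_ge0 // ?divr_ge0 // ?exprn_ge0 // sumr_ge0.
set u := own y in yV *; set w := a.2 * CC u.
rewrite ler_pdivrMl ?ltr0n // !mulrA -exprS.
have := uw; rewrite /= => /andP[aw uw'].
have newP x : x \in map (fun a : item => a.1.1) (push a.1.2 u w) ->
    exists2 l, (l < NN u)%N & x = st u l.
  case: (a.1.2) => [|j] //=; rewrite -map_comp => /mapP[l].
  by rewrite mem_iota /= add0n => lu ->; exists l.
have newN x l : belongs V x -> (l < NN u)%N -> x != st u l.
  move=> [u' [l' [u'V l'u ->]]] lu; apply/negP => /eqP /st_inj[] // e _.
  by move: yV; rewrite -e u'V.
have aN : a.1.1 \notin map fst tau by apply: dis; rewrite inE eqxx.
apply: le_trans (IH _ _ (u :: V) ((a.1.1, y) :: tau) _ _ _ _ _ _ _) _.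
- by rewrite /= aN.
- by rewrite /= uy andbT; apply: contra yV => /ot.
- rewrite map_cat cat_uniq uw' andbT; apply/andP; split.
    case: (a.1.2) => [|j] //=; rewrite -map_comp map_inj_in_uniq ?iota_uniq //.
    by move=> l l'; rewrite !mem_iota /= !add0n => lu lu' /st_inj[].
  apply/hasPn => x xw; apply/negP => /newP[l lu].
  by move/eqP; apply/negP/newN => //; apply: bw; rewrite /= inE xw orbT.
- move=> x; rewrite map_cat mem_cat /= inE negb_or => /orP[/newP[l lu ->]|xw].
    rewrite eq_sym newN /=; last by []; last by apply: bw; rewrite inE eqxx.
    by apply/negP => /bt bx; have := newN _ _ bx lu; rewrite eqxx.
  rewrite dis ?andbT; last by rewrite /= inE xw orbT.
  by apply: contraNneq aw => <-.
- move=> x; rewrite map_cat mem_cat => /orP[/newP[l lu ->]|xw].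
    by exists u, l; rewrite inE eqxx.
  have [|u' [l [u'V lu ->]]] := bw x; first by rewrite /= inE xw orbT.
  by exists u', l; rewrite inE u'V orbT.
- move=> x; rewrite /= inE => /orP[/eqP ->|/bt].
    have [|u' [l [u'V lu ->]]] := bw a.1.1; first by rewrite /= inE eqxx.
    by exists u', l; rewrite inE u'V orbT.
  by move=> [u' [l [u'V lu ->]]]; exists u', l; rewrite inE u'V orbT.
- move=> z; rewrite /= inE => /orP[/eqP ->|/ot zV]; first by rewrite inE eqxx.
  by rewrite inE zV orbT.
rewrite le_eqVlt; apply/orP; left; apply/eqP; congr (_ * _).
apply: eq_big => [s|s /=]; first by rewrite /= andbC.
move=> /andP[/eqP sy _]; congr h; rewrite -addrA; congr (_ + _).
rewrite big_cat big_cons /= push_rank addrA; congr (_ + _).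
rewrite [item_rank s a]/item_rank sy -/u /w /=; ring.
Qed.

Variable B : R.
Hypothesis h_leB : forall x, h x <= B.

Lemma Xi_const j c : Xi j (fun=> c) = c.
Proof.
elim: j => //= j IHj; rewrite -[RHS]avg_const //; congr avg.
apply: funext => y; elim: (NN _) => //= m IHm.
by rewrite -[RHS]IHj; apply: Xi_ext.
Qed.

Lemma tree_mean_leB wl acc : tree_mean wl acc <= B.
Proof.
elim: wl acc => [|a wl IH] acc; first exact: h_leB.
rewrite -(Xi_const a.1.2.+1 B) -[leRHS]addr0.
by apply: Xi_le => // x; rewrite addr0 IH.
Qed.

Lemma tree_mean_push j u w wl acc :
  tree_mean (push j u w ++ wl) acc =
  conv_iter (Xi j) (NN u) (fun s => tree_mean wl (acc + w * s)).
Proof.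
case: j => [|j].
  (* At depth 0 nothing is pushed; on the right each child contributes 0, since [Xi 0 f = f 0]. *)
  rewrite /=; elim: (NN u) => [|m IH] /=; rewrite ?mulr0 ?addr0 //.
  by rewrite IH; apply: conv_iter_ext => // s; rewrite add0r.
rewrite -[in RHS](size_iota 0 (NN u)) /push.
elim: (iota 0 _) acc => [|l r IH] acc; first by rewrite /= mulr0 addr0.
change (Xi j.+1 (fun x => tree_mean ([seq (st u l, j, w) | l <- r] ++ wl)
                                    (acc + w * x)) =
  Xi j.+1 (fun x => conv_iter (Xi j.+1) (size r)
                      (fun s => tree_mean wl (acc + w * (x + s))))).
apply: Xi_ext => // x; rewrite IH.
apply: conv_iter_ext; first by move=> f f'; exact: Xi_ext.
by move=> s; congr tree_mean; rewrite -addrA mulrDr.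
Qed.

(** This is the recursion of [explore] without its abort clause, so the two can be compared by
    induction on the fuel. *)
Lemma tree_mean_cons a wl acc : tree_mean (a :: wl) acc =
  avg (fun y => let u := own y in let w := a.2 * CC u in
    tree_mean (push a.1.2 u w ++ wl) (acc + w * QQ u)).
Proof.
rewrite /=; congr avg; apply: funext => y; rewrite tree_mean_push.
apply: conv_iter_ext => [f f'|s]; first exact: Xi_ext.
congr tree_mean; ring.
Qed.

Definition mean_indeg := avg (fun y => (NN (own y))%:R).

(* The expected number of stubs queried from a stub followed for j more generations,
   itself included. *)
Fixpoint tree_cost j : R := if j is j'.+1 then 1 + mean_indeg * tree_cost j' else 1.

Definition cost (wl : seq item) : R := \sum_(a <- wl) tree_cost a.1.2.

Lemma tree_cost_ge0 j : 0 <= tree_cost j.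
Proof.
elim: j => //= j IH; rewrite addr_ge0 // mulr_ge0 // /mean_indeg /avg.
by rewrite mulr_ge0 ?invr_ge0 // sumr_ge0.
Qed.

Lemma cost_ge0 wl : 0 <= cost wl.
Proof. by apply: sumr_ge0 => a _; apply: tree_cost_ge0. Qed.

Lemma cost_push j u w : cost (push j u w) =
  if j is j'.+1 then (NN u)%:R * tree_cost j' else 0.
Proof.
rewrite /cost; case: j => [|j] /=; first by rewrite big_nil.
by rewrite big_map /= big_const_seq count_predT size_iota iter_addr_0 mulr_natl.
Qed.

(** [cost] is a potential for the exploration: replacing an item by its children lowers it by
    exactly one on average, which pays for the query. *)
Lemma avg_cost_push j w :
  avg (fun y => cost (push j (own y) (w y))) = tree_cost j - 1.
Proof.
case: j => [|j]; rewrite [tree_cost _]/=.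
  rewrite subrr -[RHS]avg_const //; congr avg; apply: funext => y.
  exact: cost_push.
rewrite addrC addrA addNr add0r mulrC /mean_indeg -avgZ.
congr avg; apply: funext => y.
by rewrite cost_push mulrC.
Qed.

(* Markov's inequality for the number of queries, plus one collision
   probability [eta] per query. *)
Lemma explore_ge (K : nat) (eta : R) fuel wl acc V :
  (0 < K)%N -> 0 <= eta ->
  (forall V', (size V' <= K.+1)%N -> avg (fun y => (own y \in V')%:R) <= eta) ->
  (fuel <= K)%N -> (size V + fuel <= K.+1)%N ->
  tree_mean wl acc
    - B * (fuel%:R * eta + (K%:R - fuel%:R + cost wl) / K%:R)
  <= explore fuel wl acc V.
Proof.
move=> K0 eta0 Heta.
have B0 : 0 <= B by exact: le_trans (h_ge0 0) (h_leB 0).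
have K0' : 0 < K%:R :> R by rewrite ltr0n.
have errge0 f wl' : (f <= K)%N ->
    0 <= B * (f%:R * eta + (K%:R - f%:R + cost wl') / K%:R).
  move=> fK; apply: mulr_ge0 => //; apply: addr_ge0; first exact: mulr_ge0.
  by rewrite divr_ge0 // addr_ge0 ?cost_ge0 // subr_ge0 ler_nat.
elim: fuel wl acc V => [|fuel IH] [|a wl] acc V fK VK.
1,3: by rewrite /= gerBl errge0.
  (* Out of fuel, the error is at least [B * (K / K) = B], which already exceeds [tree_mean]. *)
  rewrite [explore _ _ _ _]/= mul0r add0r subr0 mulrDl divff ?gt_eqF //.
  rewrite subr_le0 mulrDr mulr1; apply: le_trans (tree_mean_leB _ _) _.
  by rewrite lerDl mulr_ge0 // divr_ge0 // cost_ge0.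
rewrite tree_mean_cons /=.
set T := fun y : 'I_L => tree_mean _ _.
set W := fun y : 'I_L => a.2 * CC (own y).
(* The error is affine in [cost], so it can be distributed over the answers [y]: a query raises
   [K - fuel] by one and lowers the mean cost by one, and one [eta] is set aside for its
   collision. *)
have -> : avg T - B * (fuel.+1%:R * eta +
    (K%:R - fuel.+1%:R + cost (a :: wl)) / K%:R) =
  avg (fun y => T y
     + - B * (fuel%:R * eta + (K%:R - fuel%:R + cost wl) / K%:R)
     + (- (B / K%:R) * cost (push a.1.2 (own y) (W y))) + - (B * eta)).
  rewrite !avgD !avg_const // avgZ avg_cost_push /cost big_cons.
  rewrite -[fuel.+1%:R]natr1; field; rewrite gt_eqF //.
apply: le_trans (_ : avg (fun y => T y
     + - B * (fuel%:R * eta + (K%:R - fuel%:R + cost wl) / K%:R)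
     + (- (B / K%:R) * cost (push a.1.2 (own y) (W y)))
     + - B * (own y \in V)%:R) <= _).
  rewrite !avgD lerD2l avg_const // avgZ mulNr lerN2 ler_wpM2l // Heta //.
  by apply: leq_trans VK; rewrite leq_addr.
apply: avg_le => y; have fK' := ltnW fK.
have E : - B * (fuel%:R * eta + (K%:R - fuel%:R + cost wl) / K%:R) +
   (- (B / K%:R) * cost (push a.1.2 (own y) (W y))) =
   - (B * (fuel%:R * eta + (K%:R - fuel%:R
        + cost (push a.1.2 (own y) (W y) ++ wl)) / K%:R)).
  by rewrite /cost big_cat /=; field; rewrite gt_eqF.
rewrite -(addrA (T y)) E; case: ifPn => [yV|yV].
  (* On a collision [explore] is 0, and the term [- B] outweighs [T y <= B]. *)
  have := errge0 fuel (push a.1.2 (own y) (W y) ++ wl) fK'.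
  have := tree_mean_leB (push a.1.2 (own y) (W y) ++ wl) (acc + W y * QQ (own y)).
  by rewrite -/(T y) mulr1; lra.
rewrite mulr0 addr0; apply: IH => //=.
by rewrite addSnnS.
Qed.

(** The exploration starts with nothing revealed and only [v] visited, so it is compared with the
    sum over all permutations. The full fuel [K] leaves just the initial cost in the Markov term. *)
Lemma tree_rank_mean_ge (K : nat) (eta : R) k v :
  (0 < K)%N -> 0 <= eta ->
  (forall V', (size V' <= K.+1)%N -> avg (fun y => (own y \in V')%:R) <= eta) ->
  conv_iter (Xi k) (NN v) (fun s => h (QQ v + s))
    - B * (K%:R * eta + (NN v)%:R * tree_cost k.-1 / K%:R)
  <= (L`!)%:R^-1 * \sum_(s : 'S_L) h (tree_rank s k.+1 v).
Proof.
move=> K0 eta0 Heta.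
have B0 : 0 <= B by exact: le_trans (h_ge0 0) (h_leB 0).
have := explore_ge (push k v 1) (QQ v) K0 eta0 Heta (leqnn K) (V := [:: v]) _.
rewrite add1n => /(_ (leqnn _)) H1.
have H2 : explore K (push k v 1) (QQ v) [:: v] <=
   L%:R ^+ 0 / (L`!)%:R * \sum_(s : 'S_L | extends [::] s)
       h (QQ v + \sum_(a <- push k v 1) item_rank s a).
  have inP x : x \in [seq a.1.1 | a <- push k v 1] ->
      exists2 l, (l < NN v)%N & x = st v l.
    case: (k) => [|j] //=; rewrite -map_comp => /mapP[l].
    by rewrite mem_iota /= add0n => lu ->; exists l.
  apply: (@explore_le_perm K _ _ _ [::]) => //.
    case: (k) => [|j] //=; rewrite -map_comp map_inj_in_uniq ?iota_uniq //.
    by move=> l l'; rewrite !mem_iota /= !add0n => lu lu' /st_inj[].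
  by move=> x /inP[l lv ->]; exists v, l; rewrite inE.
move: (le_trans H1 H2); rewrite expr0 mul1r subrr add0r => H.
have eS (s : 'S_L) : QQ v + \sum_(a <- push k v 1) item_rank s a =
    tree_rank s k.+1 v.
  by rewrite push_rank mul1r addrC subrK.
move: H; rewrite -{1}[push k v 1]cats0 tree_mean_push /=.
under eq_bigr do rewrite eS.
move=> H; apply: le_trans H; rewrite -[X in _ <= X - _](_ : conv_iter (Xi k) (NN v)
   (fun s => h (QQ v + s)) = _); last first.
  by apply: conv_iter_ext => [f f'|s]; [exact: Xi_ext|rewrite mul1r].
rewrite lerD2l lerN2 ler_wpM2l // lerD2l ler_wpM2r ?invr_ge0 //.
rewrite cost_push; case: (k) => // .
by rewrite mulr_ge0 // tree_cost_ge0.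
Qed.
End Run.
End Exploration.

(** * Independence of grouped sigma-algebras *)

Section BigGroup.
Variables (R : Type) (idx : R) (op : Monoid.com_law idx).

Lemma big_group (I J : eqType) (s : seq (I * J)) (F : I * J -> R) :
  \big[op/idx]_(a <- s) F a =
  \big[op/idx]_(i <- undup (map fst s))
     \big[op/idx]_(j <- [seq a.2 | a <- s & a.1 == i]) F (i, j).
Proof.
transitivity (\big[op/idx]_(i <- undup (map fst s))
   \big[op/idx]_(a <- s | a.1 == i) F a).
  under [RHS]eq_bigr do rewrite big_mkcond.
  rewrite exchange_big /= big_seq [RHS]big_seq; apply: eq_bigr => a a_s.
  rewrite -big_mkcond /= (big_rem a.1) /=; last by rewrite mem_undup map_f.
  rewrite eqxx big_seq_cond big1 ?Monoid.mulm1 // => i.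
  rewrite rem_filter ?undup_uniq // mem_filter /= => /andP[/andP[/negbTE ia _]].
  by rewrite eq_sym ia.
apply: eq_bigr => i _; rewrite big_map big_filter; apply: eq_bigr.
by move=> [x y] /= /eqP ->.
Qed.

Lemma big_option (J : eqType) (s : seq (option J)) (F : option J -> R) :
  uniq s ->
  \big[op/idx]_(a <- s) F a =
  op (if None \in s then F None else idx)
     (\big[op/idx]_(j <- pmap id s) F (Some j)).
Proof.
elim: s => [|[j|] s IH] /=; first by rewrite !big_nil Monoid.mul1m.
  move=> /andP[js us]; rewrite !big_cons IH // inE /=.
  by rewrite Monoid.mulmCA.
move=> /andP[/negbTE Ns us]; rewrite big_cons IH // Ns.
by rewrite Monoid.mul1m.
Qed.

End BigGroup.

Section Independence.
Context d (T : measurableType d) (R : realType) (P : probability T R).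

Lemma independent2_sub (F F' G G' : set (set T)) :
  F `<=` F' -> G `<=` G' -> independent2 P F' G' -> independent2 P F G.
Proof. by move=> FF GG H A B /FF ? /GG; exact: H. Qed.

Lemma mutually_independent_sub (I : eqType) (F G : I -> set (set T)) :
  (forall i, F i `<=` G i) -> mutually_independent P G -> mutually_independent P F.
Proof. by move=> FG H s A us FA; apply: H => // i /FA /FG. Qed.

Lemma independent2C (F G : set (set T)) :
  independent2 P F G -> independent2 P G F.
Proof. by move=> H A B GA FB; rewrite setIC H // muleC. Qed.

(** For fixed [B], the probability of the intersection with [B] and the multiple of [P] by [P B] are
    finite measures that agree on the pi-system [F], hence on the sigma-algebra it generates. *)
Lemma independent2_gen1 (F G : set (set T)) :
  F `<=` measurable -> G `<=` measurable -> setI_closed F -> F setT ->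
  independent2 P F G -> independent2 P <<s F >> G.
Proof.
move=> Fm Gm FI FT FG A B sA GB.
have mB := Gm _ GB.
have PB : 0 <= fine (P B) by apply: fine_ge0.
pose m1 : {measure set T -> \bar R} := mrestr P mB.
pose m2 : {measure set T -> \bar R} := mscale (NngNum PB) P.
have E : m1 A = m2 A.
  apply: (@g_sigma_algebra_measure_unique _ _ _ F Fm (fun=> setT)) => //.
  - by rewrite bigcup_const //; exists 0%N.
  - by move=> C FC; rewrite /= /mrestr /m2 /mscale /= fineK ?fin_num_measure // muleC FG.
  - by move=> k /=; rewrite /mrestr setTI ltey_eq fin_num_measure.
by move: E; rewrite /= /mrestr /m2 /mscale /= fineK ?fin_num_measure // muleC.
Qed.

Lemma independent2_gen (F G : set (set T)) :
  F `<=` measurable -> G `<=` measurable -> setI_closed F -> setI_closed G ->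
  F setT -> G setT ->
  independent2 P F G -> independent2 P <<s F >> <<s G >>.
Proof.
move=> Fm Gm FI GI FT GT FG; apply: independent2_gen1 => //.
  by apply: smallest_sub => //; exact: sigma_algebra_measurable.
apply: independent2C; apply: independent2_gen1 => //.
exact: independent2C.
Qed.

Section grouping.
Variables (I : eqType) (F : I -> set (set T)).
Hypotheses (Fm : forall i, F i `<=` measurable) (FI : forall i, setI_closed (F i))
  (FT : forall i, F i setT).

(** Finite intersections over indices in [p], padded with [setT] at all other indices. The padding
    lets two cylinders be intersected index by index, so they form a pi-system containing every
    [F i] with [i] in [p]. *)
Definition cylinder (p : set I) : set (set T) := [set A | exists s (A_ : I -> set T),
  [/\ uniq s, forall i, i \in s -> p i, forall i, F i (A_ i),
   forall i, i \notin s -> A_ i = setT & A = \bigcap_i A_ i]].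

Lemma in_bigsetI s (A_ : I -> set T) x :
  (\big[setI/setT]_(i <- s) A_ i) x <-> (forall i, i \in s -> A_ i x).
Proof.
elim: s => [|i s IH]; first by rewrite big_nil.
rewrite big_cons; split=> [[Ai /IH As] j|As].
  by rewrite inE => /orP[/eqP ->|/As].
split; first by apply: As; rewrite inE eqxx.
by apply/IH => j js; apply: As; rewrite inE js orbT.
Qed.

Lemma bigcap_big s (A_ : I -> set T) : (forall i, i \notin s -> A_ i = setT) ->
  \bigcap_i A_ i = \big[setI/setT]_(i <- s) A_ i.
Proof.
move=> sA; apply/seteqP; split=> [x H|x /in_bigsetI H i _].
  by apply/in_bigsetI => i _; apply: H.
by have [/H //|/sA ->] := boolP (i \in s).
Qed.

Lemma cylinder_measurable p : cylinder p `<=` measurable.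
Proof.
move=> _ [s [A_ [us sp FA AT ->]]]; rewrite (bigcap_big AT).
by apply: big_ind => //; [exact: measurableI | move=> i _; exact: (Fm (FA i))].
Qed.

Lemma cylinder_setI p : setI_closed (cylinder p).
Proof.
move=> _ _ [s [A [us sp FA AT ->]]] [s' [A' [us' sp' FA' AT' ->]]].
exists (undup (s ++ s')), (fun i => A i `&` A' i); split.
- exact: undup_uniq.
- by move=> i; rewrite mem_undup mem_cat => /orP[/sp|/sp'].
- by move=> i; apply: FI.
- move=> i; rewrite mem_undup mem_cat negb_or => /andP[/AT -> /AT' ->].
  by rewrite setIT.
- by rewrite bigcapI.
Qed.

Lemma cylinder_setT p : cylinder p setT.
Proof. by exists [::], (fun=> setT); split => //; apply/seteqP; split. Qed.

Lemma sub_cylinder (p : set I) i : p i -> F i `<=` cylinder p.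
Proof.
move=> pi A FA; exists [:: i], (fun j => if j == i then A else setT); split => //.
- by move=> j; rewrite inE => /eqP ->.
- by move=> j; case: eqP => // ->.
- by move=> j; rewrite inE => /negbTE ->.
- apply/seteqP; split=> [x Ax j _|x]; first by case: eqP.
  by move=> /(_ i Logic.I); rewrite eqxx.
Qed.

(** Cylinders over disjoint index sets use disjoint lists of indices, so mutual independence over
    the concatenated list factors. The pi-system argument then passes to the generated
    sigma-algebras. *)
Lemma independent2_groups (p q : set I) : p `&` q `<=` set0 ->
  mutually_independent P F ->
  independent2 P <<s \bigcup_(i in p) F i >> <<s \bigcup_(i in q) F i >>.
Proof.
move=> pq mF.
have sub r : <<s \bigcup_(i in r) F i >> `<=` <<s cylinder r >>.
  apply: sub_smallest2r; first exact: smallest_sigma_algebra.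
  by move=> A [i ri FA]; exact: (sub_cylinder ri).
apply: (independent2_sub (sub p) (sub q)).
apply: independent2_gen; try exact: cylinder_measurable;
  try exact: cylinder_setI; try exact: cylinder_setT.
move=> _ _ [s [A [us sp FA AT ->]]] [s' [A' [us' sp' FA' AT' ->]]].
have dis : ~~ has (mem s) s'.
  apply/hasPn => i /sp' qi; apply/negP => /sp pi.
  by have := pq i (conj pi qi).
rewrite -bigcapI (bigcap_big (s := s ++ s')); last first.
  move=> i; rewrite mem_cat negb_or => /andP[/AT -> /AT' ->].
  by rewrite setIT.
rewrite mF ?cat_uniq ?us ?us' ?dis //; last by move=> i _; apply: FI.
rewrite big_cat /= (bigcap_big AT) (bigcap_big AT') !mF //; congr (_ * _)%E.
  rewrite big_seq [RHS]big_seq; apply: eq_bigr => i si.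
  rewrite AT' ?setIT //; apply: contra dis => s'i; apply/hasP.
  by exists i.
rewrite big_seq [RHS]big_seq; apply: eq_bigr => i si.
rewrite AT ?setTI //; apply: contra dis => s'i; apply/hasP.
by exists i.
Qed.

End grouping.

(** A finite list of pairs is grouped by first component: independence between rows splits off the
    groups, independence inside each row splits the group. *)
Lemma mutually_independent_pair (I J : eqType) (F : I -> J -> set (set T)) :
  (forall i, mutually_independent P (F i)) ->
  mutually_independent P (fun i => <<s \bigcup_j F i j >>) ->
  mutually_independent P (fun a : I * J => F a.1 a.2).
Proof.
move=> mFi mF s A us FA.
rewrite [RHS]big_group [in LHS]big_group /= mF ?undup_uniq //.
  apply: eq_bigr => i _; rewrite (mFi i) //.
    rewrite map_inj_in_uniq ?filter_uniq // => -[x y] [x' y'].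
    by rewrite !mem_filter /= => /andP[/eqP -> _] /andP[/eqP -> _] ->.
  move=> j /mapP[[x y]]; rewrite mem_filter /= => /andP[/eqP -> xs] ->.
  exact: (FA _ xs).
move=> i _; rewrite big_seq; apply: big_ind.
- exact: (@measurableT _ (g_sigma_algebraType (\bigcup_j F i j))).
- exact: (@measurableI _ (g_sigma_algebraType (\bigcup_j F i j))).
- move=> j /mapP[[x y]]; rewrite mem_filter /= => /andP[/eqP -> xs] ->.
  by apply: sub_gen_smallest; exists y => //; exact: (FA _ xs).
Qed.

Lemma mutually_independent_option (J : eqType) (F0 : set (set T))
    (F : J -> set (set T)) :
  independent2 P F0 <<s \bigcup_j F j >> -> mutually_independent P F ->
  mutually_independent P (fun a => if a is Some j then F j else F0).
Proof.
move=> F0F mF s A us FA.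
have ups : uniq (pmap id s) by apply: (@pmap_uniq _ _ id Some) => //; case.
have FAs j : j \in pmap id s -> F j (A (Some j)).
  by rewrite mem_pmap map_id => /FA.
have sB : <<s \bigcup_j F j >> (\big[setI/setT]_(j <- pmap id s) A (Some j)).
  rewrite big_seq; apply: big_ind.
  - exact: (@measurableT _ (g_sigma_algebraType (\bigcup_j F j))).
  - exact: (@measurableI _ (g_sigma_algebraType (\bigcup_j F j))).
  - by move=> j /FAs Fj; apply: sub_gen_smallest; exists j.
rewrite !big_option //=; case: (boolP (None \in s)) => [Ns|_].
  by rewrite F0F ?mF //; exact: (FA _ Ns).
by rewrite setTI mul1e mF.
Qed.

Lemma mutually_independent_bool (F : bool -> set (set T)) :
  independent2 P (F false) (F true) -> mutually_independent P F.
Proof.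
move=> FF s A us FA.
case: s us FA => [|a [|b [|c s]]].
- by rewrite !big_nil probability_setT.
- by rewrite !big_seq1.
- rewrite !big_cons !big_nil /= setIT mule1 => ab FA.
  have Fa : F a (A a) by apply: FA; rewrite inE eqxx.
  have Fb : F b (A b) by apply: FA; rewrite !inE eqxx orbT.
  move: a b ab Fa Fb {FA} => [] [] //= _ Fa Fb; last exact: FF.
  by rewrite setIC FF // muleC.
(* A duplicate-free list of booleans has at most two elements. *)
- move=> us _; exfalso; move: us; rewrite /= !inE.
  by case: a; case: b; case: c; rewrite /= ?orbT /= ?andbF.
Qed.

End Independence.

(** * Integrals under independence *)

Section IndependentVariables.
Context d (T : measurableType d) (R : realType) (P : probability T R).
Context d1 d2 (T1 : measurableType d1) (T2 : measurableType d2).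

Definition indep_rv (X : T -> T1) (Y : T -> T2) := forall A B,
  measurable A -> measurable B ->
  P (X @^-1` A `&` Y @^-1` B) = (P (X @^-1` A) * P (Y @^-1` B))%E.

Lemma indep_rv_sub (F G : set (set T)) (X : T -> T1) (Y : T -> T2) :
  independent2 P <<s F >> <<s G >> ->
  measurable_fun setT (X : g_sigma_algebraType F -> T1) ->
  measurable_fun setT (Y : g_sigma_algebraType G -> T2) ->
  indep_rv X Y.
Proof.
move=> FG mX mY A B mA mB; apply: FG.
  by rewrite -[_ @^-1` _]setTI; exact: mX.
by rewrite -[_ @^-1` _]setTI; exact: mY.
Qed.

(** The joint law is the product law by uniqueness of product measures, and Tonelli applies. The
    second variable is integrated over a fresh copy of the same space, so no auxiliary space is
    introduced. *)
Lemma indep_integral (X : T -> T1) (Y : T -> T2) (f : T1 * T2 -> \bar R) :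
  measurable_fun setT X -> measurable_fun setT Y -> indep_rv X Y ->
  measurable_fun setT f -> (forall z, 0 <= f z)%E ->
  (\int[P]_w f (X w, Y w) = \int[P]_w \int[P]_w' f (X w, Y w'))%E.
Proof.
move=> mX mY XY mf f0.
pose X' := HB.pack_for {mfun T >-> T1} X (isMeasurableFun.Build _ _ _ _ X mX).
pose Y' := HB.pack_for {mfun T >-> T2} Y (isMeasurableFun.Build _ _ _ _ Y mY).
have mZ : measurable_fun setT (fun w => (X w, Y w)) by exact: measurable_fun_pair.
pose Z := HB.pack_for {mfun T >-> (T1 * T2)%type} (fun w => (X w, Y w))
  (isMeasurableFun.Build _ _ _ _ _ mZ).
transitivity (\int[distribution P Z]_z f z)%E.
  by rewrite ge0_integral_distribution.
transitivity (\int[(distribution P X' \x distribution P Y')%E]_z f z)%E.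
  apply: eq_measure_integral => A mA _; apply/esym.
  apply: (product_measure_unique (m1 := distribution P X')
    (m2 := distribution P Y')) => // ? ? *; exact: XY.
rewrite fubini_tonelli1 //= /fubini_F ge0_integral_distribution //.
- apply: eq_integral => w _ /=; rewrite ge0_integral_distribution //.
  exact: measurableT_comp.
- exact: measurable_fun_fubini_tonelli_F.
- by move=> x; exact: integral_ge0.
Qed.

End IndependentVariables.

Section NonnegIntegral.
Context d (T : measurableType d) (R : realType) (mu : {measure set T -> \bar R}).
Implicit Types f g : T -> R.

Lemma nnint_le f g : measurable_fun setT f -> measurable_fun setT g ->
  (forall w, 0 <= f w) -> (forall w, f w <= g w) ->
  (\int[mu]_w (f w)%:E <= \int[mu]_w (g w)%:E)%E.
Proof.
move=> mf mg f0 fg; apply: ge0_le_integral => //.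
- by move=> w _; rewrite lee_fin.
- exact/measurable_EFinP.
- exact/measurable_EFinP.
- by move=> w _; rewrite lee_fin.
Qed.

Lemma nnintD f g : measurable_fun setT f -> measurable_fun setT g ->
  (forall w, 0 <= f w) -> (forall w, 0 <= g w) ->
  (\int[mu]_w (f w + g w)%:E = \int[mu]_w (f w)%:E + \int[mu]_w (g w)%:E)%E.
Proof.
move=> mf mg f0 g0; under eq_integral do rewrite EFinD.
rewrite ge0_integralD //.
- by move=> w _; rewrite lee_fin.
- exact/measurable_EFinP.
- by move=> w _; rewrite lee_fin.
- exact/measurable_EFinP.
Qed.

Lemma nnintZ (k : R) f : measurable_fun setT f -> 0 <= k ->
  (forall w, 0 <= f w) ->
  (\int[mu]_w (k * f w)%:E = k%:E * \int[mu]_w (f w)%:E)%E.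
Proof.
move=> mf k0 f0; under eq_integral do rewrite EFinM.
rewrite ge0_integralZl ?lee_fin //; first exact/measurable_EFinP.
by move=> w _; rewrite lee_fin.
Qed.

Lemma nnint_sum (I : Type) (s : seq I) (F : I -> T -> R) :
  (forall i, measurable_fun setT (F i)) -> (forall i w, 0 <= F i w) ->
  (\int[mu]_w (\sum_(i <- s) F i w)%:E = \sum_(i <- s) \int[mu]_w (F i w)%:E)%E.
Proof.
move=> mF F0; under eq_integral do rewrite -sumEFin.
rewrite ge0_integral_sum //.
- by move=> i; exact/measurable_EFinP.
- by move=> i w _; rewrite lee_fin.
Qed.

End NonnegIntegral.

Lemma prob_int_cst d (T : measurableType d) (R : realType) (P : probability T R)
  (k : \bar R) : (\int[P]_w k = k)%E.
Proof. by rewrite integral_cst //= probability_setT mule1. Qed.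

Lemma measurable_fun_nat_index d (T : measurableType d) d2 (T2 : measurableType d2)
    (g : T -> nat) (F : nat -> T -> T2) :
  measurable_fun setT g -> (forall m, measurable_fun setT (F m)) ->
  measurable_fun setT (fun w => F (g w) w).
Proof.
move=> mg mF.
have -> : [set: T] = \bigcup_m (g @^-1` [set m]).
  by apply/esym/seteqP; split => // w _; exists (g w).
apply/measurable_fun_bigcup => m.
  by rewrite -[X in measurable X]setTI; exact: mg.
apply: (eq_measurable_fun (F m)); last exact: measurable_funTS.
by move=> w; rewrite inE /= => ->.
Qed.

(** * Lipschitz test functions *)

Section Lipschitz.
Variable R : realType.
(** One-sided, so that it chains directly with [le_trans]; exchanging [x] and [y] gives the usual
    condition, see [lip_norm]. *)
Definition lip (L : R) (f : R -> R) := forall x y, f x <= f y + L * `|x - y|.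

Lemma lip_ge0 L f : lip L f -> 0 <= L.
Proof.
by move=> lf; have := lf 0 1; have := lf 1 0; rewrite subr0 sub0r normrN normr1; lra.
Qed.

Lemma lip_shift L f r : lip L f -> lip L (fun s => f (r + s)).
Proof.
move=> lf x y; have := lf (r + x) (r + y).
by have -> : r + x - (r + y) = x - y by ring.
Qed.

Lemma lip_affine L f c q : `|c| <= 1 -> lip L f -> lip L (fun s => f (c * (q + s))).
Proof.
move=> c1 lf x y; apply: le_trans (lf _ (c * (q + y))) _; rewrite lerD2l.
have -> : c * (q + x) - c * (q + y) = c * (x - y) by ring.
by rewrite ler_wpM2l ?(lip_ge0 lf) // normrM ler_piMl.
Qed.

Lemma lip_norm L f : lip L f -> forall x y, `|f x - f y| <= L * `|x - y|.
Proof.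
move=> lf x y; rewrite ler_norml lerBlDl lf lerBrDl lerBlDr.
by rewrite (le_trans (lf y x)) // distrC.
Qed.

Lemma lip_continuous L f : lip L f -> continuous f.
Proof.
move=> lf x; have L0 := lip_ge0 lf.
apply/cvgrPdist_le => e e0; near=> y.
apply: le_trans (lip_norm lf _ _) _.
apply: (@le_trans _ _ ((L + 1) * `|x - y|)).
  by rewrite ler_wpM2r // lerDl.
rewrite -ler_pdivlMl ?ltr_wpDl //; near: y.
apply: cvgr_dist_le => //; rewrite mulr_gt0 // invr_gt0 ltr_wpDl //.
Unshelve. all: by end_near. Qed.

Lemma lip_measurable L f : lip L f -> measurable_fun setT f.
Proof. by move=> /lip_continuous; exact: continuous_measurable_fun. Qed.

End Lipschitz.

Lemma measurable_gt_set d (T : measurableType d) (R : realType) (f : T -> R) a :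
  measurable_fun setT f -> measurable [set z | a < f z].
Proof.
move=> mf; have := mf measurableT _ (measurable_itv `]a, +oo[).
rewrite setTI; congr measurable; apply/seteqP.
by split=> z; rewrite /= in_itv /= andbT.
Qed.

(** * Comparison of one generation *)

Section PartialSums.
Context d (T : measurableType d) (R : realType) (P : probability T R).
Variable X : nat -> T -> R.
Hypothesis mX : forall l, measurable_fun setT (X l).

Definition psum m w := \sum_(l < m) X l w.

Lemma measurable_psum m : measurable_fun setT (psum m).
Proof. by apply: measurable_sum => i. Qed.

Hypothesis X_psum : forall m, indep_rv P (X m) (psum m).
Variable M : R.
Hypothesis XM : forall l, (\int[P]_w (`|X l w|)%:E <= M%:E)%E.

Lemma mean_ge0 : 0 <= M.
Proof.
by rewrite -lee_fin; apply: le_trans (XM 0%N); apply: integral_ge0.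
Qed.

Lemma mean_psum_dist a b :
  (\int[P]_w (`|psum a w - psum b w|)%:E <= (M * `|a%:R - b%:R|)%:E)%E.
Proof.
wlog ab : a b / (a <= b)%N => [H|].
  have [/H //|/ltnW /H] := leqP a b; rewrite distrC.
  by under eq_integral do rewrite distrC.
apply: (@le_trans _ _ (\int[P]_w (\sum_(a <= l < b) `|X l w|)%:E)%E).
  apply: nnint_le => //.
  - apply: measurableT_comp => //; apply: measurable_funB;
    exact: measurable_psum.
  - by apply: measurable_sum => i; apply: measurableT_comp.
  - move=> w; rewrite distrC /psum -!(big_mkord xpredT (X ^~ w)).
    rewrite [X in X - _](_ : _ = \sum_(0 <= l < a) X l w +
      \sum_(a <= l < b) X l w); last by rewrite -big_cat_nat.
    rewrite addrAC subrr add0r.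
    exact: ler_norm_sum.
rewrite nnint_sum //; last by move=> i; apply: measurableT_comp.
rewrite distrC -natrB // ger0_norm // mulr_natr.
apply: (@le_trans _ _ (\sum_(a <= l < b) M%:E)%E); first exact: lee_sum.
by rewrite sumEFin sumr_const_nat.
Qed.

Lemma mean_psum m : (\int[P]_w (`|psum m w|)%:E <= (M * m%:R)%:E)%E.
Proof.
have := mean_psum_dist m 0; rewrite subr0 ger0_norm //.
by under eq_integral do rewrite /psum big_ord0 subr0.
Qed.

Variables (Xi : (R -> R) -> R) (delta : R).
Hypothesis Xi_mono : forall f g e, (forall x, f x <= g x + e) -> Xi f <= Xi g + e.
Hypothesis X_Xi : forall l f L, (forall x, 0 <= f x) -> lip L f ->
  (\int[P]_w (f (X l w))%:E <= (Xi f + delta * L)%:E)%E.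

(** Summands are exchanged one at a time, as in Lindeberg's method. Integrating out the first [m] of
    them leaves a function [g] of the last one that is again nonnegative and [L]-Lipschitz, so
    [X_Xi] applies to it at the price [delta * L]; the induction hypothesis then bounds [g]
    pointwise. *)
Lemma mean_psum_le m h L : (forall x, 0 <= h x) -> lip L h ->
  (\int[P]_w (h (psum m w))%:E <= (conv_iter Xi m h + m%:R * delta * L)%:E)%E.
Proof.
move=> h0 hL; have L0 := lip_ge0 hL.
elim: m h h0 hL => [|m IH] h h0 hL.
  rewrite /= !mul0r addr0; under eq_integral do rewrite /psum big_ord0.
  by rewrite prob_int_cst.
have mh := lip_measurable hL.
have mh2 : measurable_fun [set: R * R] (fun z => (h (z.1 + z.2))%:E).
  apply/measurable_EFinP; apply: measurableT_comp => //.
  exact: measurable_funD.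
have -> : (\int[P]_w (h (psum m.+1 w))%:E =
    \int[P]_w \int[P]_w' (h (X m w + psum m w'))%:E)%E.
  rewrite -(indep_integral (f := fun z : R * R => (h (z.1 + z.2))%:E)) //.
  - by apply: eq_integral => w _; rewrite /psum big_ord_recr /= addrC.
  - exact: measurable_psum.
  - by move=> z; rewrite lee_fin.
pose g r := fine (\int[P]_w' (h (r + psum m w'))%:E)%E.
have mhr r : measurable_fun setT (fun w => h (r + psum m w)).
  apply: measurableT_comp => //; apply: measurable_funD => //.
  exact: measurable_psum.
have IHr r := IH _ (fun x => h0 (r + x)) (lip_shift r hL).
have gE r : (\int[P]_w' (h (r + psum m w'))%:E)%E = (g r)%:E.
  rewrite fineK // ge0_fin_numE; first exact: le_lt_trans (IHr r) (ltry _).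
  by apply: integral_ge0 => w _; rewrite lee_fin.
under eq_integral do rewrite gE.
have g0 r : 0 <= g r.
  by rewrite /g fine_ge0 // integral_ge0 // => w _; rewrite lee_fin.
have gL : lip L g.
  move=> x y; rewrite -lee_fin EFinD -!gE.
  rewrite -(prob_int_cst P (L * `|x - y|)%:E) -nnintD //; last first.
    by move=> _; rewrite mulr_ge0.
  apply: nnint_le => //.
    by apply: measurable_funD => //.
  by move=> w; rewrite ![_ + psum m w]addrC; exact: (lip_shift _ hL).
apply: le_trans (X_Xi m g0 gL) _; rewrite lee_fin /=.
rewrite -natr1 !mulrDl mul1r addrA lerD2r.
apply: Xi_mono => r; rewrite -lee_fin -gE.
exact: (IHr r).
Qed.

End PartialSums.

Section Comparison.
Context d (T : measurableType d) (R : realType) (P : probability T R).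
Variable X : nat -> T -> R.
Hypothesis mX : forall l, measurable_fun setT (X l).
Hypothesis X_psum : forall m, indep_rv P (X m) (psum X m).
Variable M : R.
Hypothesis XM : forall l, (\int[P]_w (`|X l w|)%:E <= M%:E)%E.

Definition branch_mean (f : R -> R) (m : nat) (q c : R) : \bar R :=
  (\int[P]_w (f (c * (q + psum X m w)))%:E)%E.

Lemma measurable_branch (f : R -> R) m q c : measurable_fun setT f ->
  measurable_fun setT (fun w => f (c * (q + psum X m w))).
Proof.
move=> mf; apply: measurableT_comp => //; apply: measurable_funM => //.
by apply: measurable_funD => //; exact: measurable_psum.
Qed.

Lemma measurable_branch_mean (f : R -> R) : (forall x, 0 <= f x) -> measurable_fun setT f ->
  measurable_fun setT (fun x : nat * R * R => branch_mean f x.1.1 x.1.2 x.2).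
Proof.
move=> f0 mf; apply: (@measurable_fun_nat_index _ _ _ _ (fun x : nat * R * R => x.1.1)
  (fun m x => branch_mean f m x.1.2 x.2)).
  by apply: measurableT_comp.
move=> m.
pose F (z : (R * R) * T) : \bar R := (f (z.1.2 * (z.1.1 + psum X m z.2)))%:E.
have mF : measurable_fun [set: (R * R) * T] F.
  apply/measurable_EFinP; apply: measurableT_comp => //.
  apply: measurable_funM; first by apply: measurableT_comp.
  apply: measurable_funD; first by apply: measurableT_comp.
  by apply: measurableT_comp => //; exact: measurable_psum.
have F0 z : (0 <= F z)%E by rewrite lee_fin f0.
have mG := @measurable_fun_fubini_tonelli_F _ _ _ _ _ P F mF F0.
apply: (@measurableT_comp _ _ _ _ _ _ _ _ (fun x : nat * R * R => (x.1.2, x.2)) mG).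
by apply: measurable_fun_pair => //; apply: measurableT_comp.
Qed.

(** The increment is split so that [c], bounded by 1, multiplies the differences, while [c - c']
    multiplies the primed sum. Thus only one of the two laws needs bounded weights, and the last
    product is the only term that is not Lipschitz. *)
Lemma branch_mean_lip f L m q c m' q' c' :
  (forall x, 0 <= f x) -> lip L f -> `|c| <= 1 ->
  (branch_mean f m' q' c' <= branch_mean f m q c +
     (L * (`|q - q'| + M * `|m%:R - m'%:R| + `|c - c'| * (`|q'| + M * m'%:R)))%:E)%E.
Proof.
move=> f0 fL c1; have L0 := lip_ge0 fL; have mf := lip_measurable fL.
have mS k := measurable_psum mX k.
pose D w := L * `|q - q'| + L * `|c - c'| * `|q'| +
  (L * `|psum X m w - psum X m' w| + (L * `|c - c'|) * `|psum X m' w|).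
have mD1 : measurable_fun setT (fun w => `|psum X m w - psum X m' w|).
  by apply: measurableT_comp => //; apply: measurable_funB.
have mD2 : measurable_fun setT (fun w => `|psum X m' w|).
  by apply: measurableT_comp.
have mD : measurable_fun setT D.
  by apply: measurable_funD => //; apply: measurable_funD => //;
     apply: measurable_funM.
have D0 w : 0 <= D w by rewrite /D !(addr_ge0, mulr_ge0).
apply: (@le_trans _ _ (\int[P]_w (f (c * (q + psum X m w)) + D w)%:E)%E).
  apply: nnint_le => //; first exact: measurable_branch.
    by apply: measurable_funD => //; exact: measurable_branch.
  move=> w; apply: le_trans (fL _ (c * (q + psum X m w))) _; rewrite lerD2l.
  rewrite /D -!mulrA -!mulrDr ler_wpM2l //.
  have -> : c' * (q' + psum X m' w) - c * (q + psum X m w) =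
    - (c * (q - q')) - (c - c') * q' - (c * (psum X m w - psum X m' w)
       + (c - c') * psum X m' w) by ring.
  apply: le_trans (ler_normB _ _) _; apply: lerD.
    apply: le_trans (ler_normB _ _) _; rewrite normrN !normrM lerD2r.
    by rewrite ler_piMl.
  apply: le_trans (ler_normD _ _) _; rewrite !normrM lerD2r.
  by rewrite ler_piMl.
rewrite nnintD //; [|exact: measurable_branch].
rewrite leeD2l // /D nnintD //; last 3 first.
- by apply: measurable_funD => //; apply: measurable_funM.
- by move=> _; rewrite addr_ge0 // !mulr_ge0.
- by move=> w; rewrite addr_ge0 // !mulr_ge0.
rewrite prob_int_cst nnintD //; last 4 first.
- by apply: measurable_funM.
- by apply: measurable_funM.
- by move=> w; rewrite mulr_ge0.
- by move=> w; rewrite !mulr_ge0.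
rewrite !nnintZ ?mulr_ge0 //.
have H1 := mean_psum_dist mX XM m m'.
have H2 := mean_psum mX XM m'.
apply: (@le_trans _ _ ((L * `|q - q'| + L * `|c - c'| * `|q'|)%:E +
   (L%:E * (M * `|m%:R - m'%:R|)%:E + (L * `|c - c'|)%:E * (M * m'%:R)%:E))%E).
  apply: leeD2l; apply: leeD; apply: lee_wpmul2l => //; rewrite lee_fin //.
  exact: mulr_ge0.
rewrite -!EFinM -!EFinD lee_fin le_eqVlt; apply/orP; left; apply/eqP; ring.
Qed.

Context dZ (Z : measurableType dZ) (pi : probability Z R).
Variables (m1 m2 : Z -> nat) (q1 q2 c1 c2 : Z -> R).
Hypotheses (mm1 : measurable_fun setT m1) (mm2 : measurable_fun setT m2)
  (mq1 : measurable_fun setT q1) (mq2 : measurable_fun setT q2)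
  (mc1 : measurable_fun setT c1) (mc2 : measurable_fun setT c2).
Variables (J : finType) (p : J -> R) (mj : J -> nat) (qj cj : J -> R).
Hypotheses (p0 : forall j, 0 <= p j) (cj1 : forall j, `|cj j| <= 1).
Variables (N : T -> nat) (Q C : T -> R).
Hypothesis marginal1 : forall Phi : nat * R * R -> \bar R,
  measurable_fun setT Phi -> (forall x, 0 <= Phi x)%E ->
  (\int[pi]_z Phi (m1 z, q1 z, c1 z) = \sum_j (p j)%:E * Phi (mj j, qj j, cj j))%E.
Hypothesis marginal2 : forall Phi : nat * R * R -> \bar R,
  measurable_fun setT Phi -> (forall x, 0 <= Phi x)%E ->
  (\int[pi]_z Phi (m2 z, q2 z, c2 z) = \int[P]_w \int[P]_w' Phi (N w, Q w, C w'))%E.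
Variables (eta K tail : R).
Hypotheses (eta_m : (\int[pi]_z (`|(m1 z)%:R - (m2 z)%:R|)%:E <= eta%:E)%E)
  (eta_q : (\int[pi]_z (`|q1 z - q2 z|)%:E <= eta%:E)%E)
  (eta_c : (\int[pi]_z (`|c1 z - c2 z|)%:E <= eta%:E)%E).
Hypothesis K0 : 0 <= K.
Hypothesis tailP : (\int[P]_w \int[P]_w' ((1 + `|C w'|) *
   Num.max (`|Q w| + M * (N w)%:R - K) 0)%:E <= tail%:E)%E.
Variables (Xi : (R -> R) -> R) (delta : R).
Hypothesis Xi_mono : forall f g e, (forall x, f x <= g x + e) -> Xi f <= Xi g + e.
Hypothesis X_Xi : forall l f L, (forall x, 0 <= f x) -> lip L f ->
  (\int[P]_w (f (X l w))%:E <= (Xi f + delta * L)%:E)%E.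

Let M0 : 0 <= M := mean_ge0 XM.

(** The bound is known at the atoms of the first marginal; integrating the indicator of its failure
    transfers it to the coupling. *)
Lemma marginal1_ae : {ae pi, forall z, `|c1 z| <= 1}.
Proof.
exists [set z | 1 < `|c1 z|]; split.
- by apply: measurable_gt_set; exact: measurableT_comp.
- pose A : set (nat * R * R) := [set x | 1 < `|x.2|].
  have mA : measurable A.
    by apply: measurable_gt_set; do 2 apply: measurableT_comp => //.
  have mI : measurable_fun setT (fun x => (\1_A x)%:E : \bar R).
    by apply/measurable_EFinP; exact: measurable_indic.
  have := marginal1 mI (fun x => _).
  rewrite big1; last first.
    by move=> j _; rewrite indicE memNset ?mule0 // /A /= ltNge cj1.
  move=> H; have {}H : (\int[pi]_z (\1_A (m1 z, q1 z, c1 z))%:E = 0)%E.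
    by apply: H => x; rewrite lee_fin.
  transitivity (\int[pi]_z (\1_[set z | 1 < `|c1 z|] z)%:E)%E.
    rewrite integral_indic ?setIT //.
    by apply: measurable_gt_set; exact: measurableT_comp.
  by rewrite -[RHS]H.
- by move=> z /= /negP; rewrite -ltNge.
Qed.

(** Moving along the coupling from the limit marginal to the discrete one costs [L * D]. In
    [|c1 - c2| * H] the factor [H = |q2| + M * m2] is unbounded: its part up to [K] is paid by
    [K * eta], and its excess over [K] by [tail], using [|c1 - c2| <= 1 + |c2|]. On the discrete
    side the sums are then replaced by [conv_iter Xi]. *)
Lemma branch_comparison f L : (forall x, 0 <= f x) -> lip L f ->
  (\int[P]_w \int[P]_w' branch_mean f (N w) (Q w) (C w') <=
   (\sum_j p j * conv_iter Xi (mj j) (fun s => f (cj j * (qj j + s)))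
    + ((\sum_j p j * (mj j)%:R) * delta + (1 + M + K) * eta + tail) * L)%:E)%E.
Proof.
move=> f0 fL; have L0 := lip_ge0 fL; have mf := lip_measurable fL.
have mB := measurable_branch_mean f0 mf.
have B0 x : (0 <= (fun x : nat * R * R => branch_mean f x.1.1 x.1.2 x.2) x)%E.
  by apply: integral_ge0 => w _; rewrite lee_fin.
rewrite -(marginal2 mB B0) /=.
pose H (x : nat * R * R) := `|x.1.2| + M * (x.1.1)%:R.
have H0 x : 0 <= H x by rewrite addr_ge0 // mulr_ge0.
have mH : measurable_fun setT H.
  apply: measurable_funD; first by do 2 apply: measurableT_comp => //.
  by apply: measurable_funM => //; do 2 apply: measurableT_comp => //.
pose tl (x : nat * R * R) := (1 + `|x.2|) * Num.max (H x - K) 0.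
have tl0 x : 0 <= tl x by rewrite mulr_ge0 // ?addr_ge0 // le_max lexx orbT.
have mtl : measurable_fun setT tl.
  apply: measurable_funM.
    by apply: measurable_funD => //; do 2 apply: measurableT_comp => //.
  by apply: measurable_maxr => //; apply: measurable_funB.
pose D z := `|q1 z - q2 z| + M * `|(m1 z)%:R - (m2 z)%:R| + K * `|c1 z - c2 z|
  + tl (m2 z, q2 z, c2 z).
have mnum : measurable_fun setT (fun z => `|(m1 z)%:R - (m2 z)%:R| : R).
  apply: measurableT_comp => //.
  by apply: measurable_funB => //; apply: measurableT_comp.
have mq : measurable_fun setT (fun z => `|q1 z - q2 z|).
  by apply: measurableT_comp => //; apply: measurable_funB.
have mc : measurable_fun setT (fun z => `|c1 z - c2 z|).
  by apply: measurableT_comp => //; apply: measurable_funB.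
have mtl2 : measurable_fun setT (fun z => tl (m2 z, q2 z, c2 z)).
  apply: measurableT_comp => //; apply: measurable_fun_pair => //.
  exact: measurable_fun_pair.
have mK1 : measurable_fun setT (fun z => M * `|(m1 z)%:R - (m2 z)%:R| : R).
  exact: measurable_funM.
have mK2 : measurable_fun setT (fun z => K * `|c1 z - c2 z|).
  exact: measurable_funM.
have mD : measurable_fun setT D.
  by do 3 apply: measurable_funD => //.
have D0 z : 0 <= D z by rewrite /D !addr_ge0 ?tl0 ?mulr_ge0.
have mB1 : measurable_fun setT (fun z => branch_mean f (m1 z) (q1 z) (c1 z)).
  apply: (@measurableT_comp _ _ _ _ _ _ _ _ (fun z => (m1 z, q1 z, c1 z)) mB).
  by apply: measurable_fun_pair => //; exact: measurable_fun_pair.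
have mB2 : measurable_fun setT (fun z => branch_mean f (m2 z) (q2 z) (c2 z)).
  apply: (@measurableT_comp _ _ _ _ _ _ _ _ (fun z => (m2 z, q2 z, c2 z)) mB).
  by apply: measurable_fun_pair => //; exact: measurable_fun_pair.
have ID : (\int[pi]_z (D z)%:E <= ((1 + M + K) * eta + tail)%:E)%E.
  rewrite /D nnintD //; last 2 first.
  - by do 2 apply: measurable_funD => //.
  - by move=> z; rewrite !(addr_ge0, mulr_ge0).
  rewrite nnintD //; last 3 first.
  - by apply: measurable_funD.
  - by move=> z; rewrite !(addr_ge0, mulr_ge0).
  - by move=> z; rewrite mulr_ge0.
  rewrite nnintD //; last by move=> z; rewrite mulr_ge0.
  rewrite (nnintZ pi mnum M0) ?(nnintZ pi mc K0) //.
  have -> : ((1 + M + K) * eta + tail)%:E =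
     (eta%:E + M%:E * eta%:E + K%:E * eta%:E + tail%:E)%E.
    by rewrite -!EFinM -!EFinD; congr EFin; ring.
  have Ht : (\int[pi]_z (tl (m2 z, q2 z, c2 z))%:E <= tail%:E)%E.
    rewrite (marginal2 (Phi := EFin \o tl)) //; exact/measurable_EFinP.
  have M0' : (0 <= M%:E)%E by rewrite lee_fin.
  have K0' : (0 <= K%:E)%E by rewrite lee_fin.
  exact: leeD (leeD (leeD eta_q (lee_wpmul2l M0' eta_m)) (lee_wpmul2l K0' eta_c)) Ht.
apply: (@le_trans _ _ (\int[pi]_z (branch_mean f (m1 z) (q1 z) (c1 z)
    + (L * D z)%:E))%E).
  apply: ae_ge0_le_integral => //.
  - by move=> z _; exact: (B0 (m2 z, q2 z, c2 z)).
  - move=> z _; apply: adde_ge0; first exact: (B0 (m1 z, q1 z, c1 z)).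
    by rewrite lee_fin mulr_ge0.
  - apply: emeasurable_funD => //; apply/measurable_EFinP.
    exact: measurable_funM.
  - apply: filterS marginal1_ae => z z1 _.
    apply: le_trans (branch_mean_lip (m1 z) (q1 z) (m2 z) (q2 z) (c2 z) f0 fL z1) _.
    apply: leeD2l; rewrite lee_fin ler_wpM2l // /D -!addrA !lerD2l.
    rewrite /tl -/(H (m2 z, q2 z, c2 z)) /=.
    set h := H _; have h0 : 0 <= h by exact: H0.
    (* Below [K] the product is at most [K * |c1 - c2|]; above it, the excess [h - K] is charged to
       [tl]. *)
    have [hK|Kh] := leP (h - K) 0.
      rewrite mulr0 addr0 mulrC ler_wpM2r //.
      by rewrite -subr_le0.
    have -> : `|c1 z - c2 z| * h = K * `|c1 z - c2 z| + `|c1 z - c2 z| * (h - K).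
      by ring.
    rewrite lerD2l ler_wpM2r ?(ltW Kh) //.
    by apply: le_trans (ler_normB _ _) _; rewrite lerD2r.
rewrite ge0_integralD //; last 3 first.
- by move=> z _; exact: (B0 (m1 z, q1 z, c1 z)).
- by move=> z _; rewrite lee_fin mulr_ge0.
- by apply/measurable_EFinP; exact: measurable_funM.
rewrite nnintZ // (marginal1 mB B0) /=.
apply: (@le_trans _ _ ((\sum_j p j * (conv_iter Xi (mj j) (fun s => f (cj j * (qj j + s)))
   + (mj j)%:R * delta * L))%:E + L%:E * ((1 + M + K) * eta + tail)%:E)%E).
  apply: leeD; last exact: lee_wpmul2l.
  rewrite -sumEFin; apply: lee_sum => j _; rewrite EFinM.
  apply: lee_wpmul2l; first by rewrite lee_fin.
  have := mean_psum_le mX X_psum Xi_mono X_Xi (mj j)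
    (h := fun s => f (cj j * (qj j + s))) (L := L); apply => //.
  exact: lip_affine.
rewrite -EFinM -EFinD lee_fin le_eqVlt; apply/orP; left; apply/eqP.
rewrite (eq_bigr (fun j => p j * conv_iter Xi (mj j) (fun s => f (cj j * (qj j + s)))
  + p j * (mj j)%:R * (delta * L))); last by move=> j _; ring.
rewrite big_split /= -mulr_suml; ring.
Qed.

End Comparison.

(** * The branching tree and its endogenous solution *)

Section SameLaw.
Context d (T : measurableType d) (R : realType) (P : probability T R).
Context d' (T' : measurableType d').

Lemma same_law_integral (X Y : T -> T') (f : T' -> \bar R) :
  measurable_fun setT X -> measurable_fun setT Y -> same_law P X Y ->
  measurable_fun setT f -> (forall x, 0 <= f x)%E ->
  (\int[P]_w f (X w) = \int[P]_w f (Y w))%E.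
Proof.
move=> mX mY XY mf f0.
pose X' := HB.pack_for {mfun T >-> T'} X (isMeasurableFun.Build _ _ _ _ X mX).
pose Y' := HB.pack_for {mfun T >-> T'} Y (isMeasurableFun.Build _ _ _ _ Y mY).
transitivity (\int[distribution P X']_z f z)%E.
  by rewrite ge0_integral_distribution.
transitivity (\int[distribution P Y']_z f z)%E.
  by apply: eq_measure_integral => A mA _; exact: XY.
by rewrite ge0_integral_distribution.
Qed.

End SameLaw.

Section RandomIndex.
Context d (T : measurableType d) (R : realType) (P : probability T R).
Variables (N : T -> nat) (Q : T -> R) (Y : nat -> T -> R).
Hypotheses (mN : measurable_fun setT N) (mQ : measurable_fun setT Q)
  (mY : forall m, measurable_fun setT (Y m)).
Hypothesis NQY : forall m, indep_rv P (fun w => (N w, Q w)) (Y m).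

(** On each event [N = m] the index is frozen and [Y m] is independent of [(N, Q)]; the countably
    many events are summed. On the right the index comes from [w] and the sum from the fresh copy
    [w']. *)
Lemma random_index (h : nat -> R * R -> \bar R) :
  (forall m, measurable_fun setT (h m)) -> (forall m x, 0 <= h m x)%E ->
  (\int[P]_w h (N w) (Q w, Y (N w) w) =
   \int[P]_w \int[P]_w' h (N w) (Q w, Y (N w) w'))%E.
Proof.
move=> mh h0.
pose E m := N @^-1` [set m].
have mE m : measurable (E m) by rewrite -[E m]setTI; exact: mN.
have UE : [set: T] = \bigcup_m E m.
  by apply/esym/seteqP; split => // w _; exists (N w).
have tE : trivIset setT E.
  by move=> i j _ _ [w [/= <- <-]].
have mQY m : measurable_fun setT (fun w => h m (Q w, Y m w)).
  by apply: measurableT_comp => //; exact: measurable_fun_pair.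
have mQY2 m w : measurable_fun setT (fun w' => h m (Q w, Y m w')).
  by apply: measurableT_comp => //; exact: measurable_fun_pair.
(* The event [N = m] is written into the integrand, so that it becomes a function of the pair
   [(N, Q)]. *)
pose phi m (z : (nat * R) * R) := if z.1.1 == m then h m (z.1.2, z.2) else 0%E.
have mphi m : measurable_fun setT (phi m).
  apply: measurable_fun_ifT => //.
    apply: (measurable_fun_bool true).
    rewrite (_ : _ @^-1` _ = (fun z : (nat * R) * R => z.1.1) @^-1` [set m]);
      last by apply/seteqP; split => z /eqP.
    have : measurable_fun setT (fun z : (nat * R) * R => z.1.1).
      exact: measurableT_comp.
    by apply.
  apply: measurableT_comp => //; apply: measurable_fun_pair => //.
  exact: measurableT_comp.
have phi0 m z : (0 <= phi m z)%E by rewrite /phi; case: ifP.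
have mL : measurable_fun setT (fun w => h (N w) (Q w, Y (N w) w)).
  exact: (measurable_fun_nat_index mN mQY).
have mR2 m : measurable_fun setT (fun w => \int[P]_w' phi m ((N w, Q w), Y m w'))%E.
  have mG : measurable_fun setT (fun z : (nat * R) * T => phi m (z.1, Y m z.2)).
    apply: measurableT_comp => //; apply: measurable_fun_pair => //.
    exact: measurableT_comp.
  have G0 z : (0 <= (fun z : (nat * R) * T => phi m (z.1, Y m z.2)) z)%E by [].
  have mF := @measurable_fun_fubini_tonelli_F _ _ _ _ _ P _ mG G0.
  apply: (@measurableT_comp _ _ _ _ _ _ _ _ (fun w => (N w, Q w)) mF).
  exact: measurable_fun_pair.
have mR : measurable_fun setT (fun w => \int[P]_w' h (N w) (Q w, Y (N w) w'))%E.
  rewrite [X in measurable_fun X _]UE; apply/measurable_fun_bigcup => // m.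
  apply: (eq_measurable_fun (fun w => \int[P]_w' phi m ((N w, Q w), Y m w'))%E);
    last exact: measurable_funTS.
  move=> w /set_mem Nw; have {}Nw : N w = m by [].
  by rewrite -Nw /=; apply: eq_integral => w' _; rewrite /phi /= eqxx.
have splitE (F : T -> \bar R) : measurable_fun setT F -> (forall w, 0 <= F w)%E ->
    (\int[P]_w F w = \sum_(0 <= m <oo) \int[P]_(w in E m) F w)%E.
  move=> mF F0; rewrite [X in integral _ X _]UE ge0_integral_bigcup //.
  by rewrite -UE.
rewrite !splitE //; last by move=> w; exact: integral_ge0.
apply: eq_eseriesr => m _.
  transitivity (\int[P]_w phi m ((N w, Q w), Y m w))%E.
    rewrite integral_mkcond; apply: eq_integral => w _.
    rewrite patchE.
    case: ifPn => [/set_mem Nw|/negP Nm]; rewrite /phi /=.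
      by have {}Nw : N w = m by []; rewrite Nw eqxx.
    by case: eqP => // Nw; exfalso; apply: Nm; apply/mem_set.
  rewrite (indep_integral (f := phi m)) //; last exact: measurable_fun_pair.
  rewrite [RHS]integral_mkcond; apply: eq_integral => w _; rewrite patchE.
  case: ifPn => [/set_mem Nw|/negP Nm].
    have {}Nw : N w = m by []; rewrite -Nw.
    by apply: eq_integral => w' _; rewrite /phi /= eqxx.
  rewrite [LHS](eq_integral (cst 0%E)) ?integral0 // => w' _; rewrite /phi /=.
  by case: eqP => // Nw; exfalso; apply: Nm; apply/mem_set.
Qed.

End RandomIndex.

Section MeasurableLimit.
Context d (T : measurableType d) (R : realType).

(** The sequence converges exactly where its limsup and liminf are finite and equal, a measurable
    set [Cv]. On [Cv] the limit is the limsup, and elsewhere [limn] is one fixed default value. *)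
Lemma measurable_fun_limn (u : nat -> T -> R) :
  (forall n, measurable_fun setT (u n)) ->
  measurable_fun setT (fun w => limn (fun n => u n w)).
Proof.
move=> mu.
pose eu n w : \bar R := (u n w)%:E.
have meu n : measurable_fun setT (eu n) by exact/measurable_EFinP.
pose s w := limn_esup (eu ^~ w); pose i w := limn_einf (eu ^~ w).
have ms : measurable_fun setT s by exact: measurable_fun_limn_esup.
have mi : measurable_fun setT i.
  have -> : i = (fun w => - limn_esup (fun n => - eu n w))%E.
    by apply/funext => w; rewrite (limn_esupN (eu ^~ w)) oppeK.
  apply: measurableT_comp => //; apply: measurable_fun_limn_esup => n.
  exact: measurableT_comp.
pose Cv := [set w | s w \is a fin_num] `&` [set w | i w \is a fin_num] `&`
   [set w | fine (s w) == fine (i w)].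
have mCv : measurable Cv.
  apply: measurableI; first apply: measurableI.
  - by rewrite -[X in measurable X]setTI; exact: emeasurable_fin_num.
  - by rewrite -[X in measurable X]setTI; exact: emeasurable_fin_num.
  - rewrite -[X in measurable X]setTI.
    have : measurable_fun setT (fun w => fine (s w) == fine (i w)).
      by apply: measurable_fun_eqr; apply: measurableT_comp => //; exact: fine_measurable.
    by move=> /(_ measurableT [set true]); rewrite preimage_true; apply.
have cvgE w : Cv w -> u ^~ w @ \oo --> fine (s w).
  move=> [[sf fi] /eqP si]; apply: (fine_cvg (f := eu ^~ w)); rewrite fineK //.
  have {si}si : s w = i w by rewrite -(fineK sf) -(fineK fi) si.
  apply: (@squeeze_cvge _ _ _ _ (einfs (eu ^~ w)) _ (esups (eu ^~ w))).
  - near=> n; apply/andP; split.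
      by apply: ereal_inf_lbound; exists n => //=.
    by apply: ereal_sup_ubound; exists n => //=.
  - by rewrite si /i limn_einf_lim; exact: is_cvg_einfs.
  - by rewrite /s limn_esup_lim; exact: is_cvg_esups.
have dvgE w : ~ Cv w -> ~ cvgn (u ^~ w).
  move=> nC /cvg_ex[l ul]; apply: nC.
  have eul : eu ^~ w @ \oo --> l%:E.
    by apply/fine_cvgP; split; [near=> n|exact: ul].
  have [il sl] := cvg_limn_einf_sup eul.
  by rewrite /Cv /= /s /i il sl; split.
rewrite -(setUv Cv); apply/measurable_funU => //; first exact: measurableC.
split.
  apply: (eq_measurable_fun (fine \o s)).
    by move=> w /set_mem /cvgE /cvg_lim -> //.
  by apply: measurable_funTS; apply: measurableT_comp => //; exact: fine_measurable.
apply: (eq_measurable_fun (cst point)); last exact: measurable_cst.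
by move=> w /set_mem /dvgE /dvgP ->.
Unshelve. all: by end_near. Qed.

End MeasurableLimit.

Section TreeSums.
Variables (R : realType) (T : Type) (Nt : seq nat -> T -> nat)
  (Qt : seq nat -> T -> R) (Ct : seq nat -> nat -> T -> R).

(** The contribution to node [i] of its descendants [k] generations away, with path weights counted
    from [i]. *)
Fixpoint layer k i w : R :=
  if k is k'.+1 then \sum_(l < Nt i w) Ct i l w * layer k' (val l :: i) w
  else Qt i w.

Fixpoint abs_layer k i w : R :=
  if k is k'.+1 then
    \sum_(l < Nt i w) `|Ct i l w| * abs_layer k' (val l :: i) w
  else `|Qt i w|.

Fixpoint trunc_tree k i w : R :=
  if k is k'.+1 then
    Qt i w + \sum_(l < Nt i w) Ct i l w * trunc_tree k' (val l :: i) w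
  else 0.

Lemma abs_layer_ge0 k i w : 0 <= abs_layer k i w.
Proof. by elim: k i => [|k IH] i //=; apply: sumr_ge0 => l _; rewrite mulr_ge0. Qed.

Lemma layer_le k i w : `|layer k i w| <= abs_layer k i w.
Proof.
elim: k i => [|k IH] i //=; apply: le_trans (ler_norm_sum _ _ _) _.
by apply: ler_sum => l _; rewrite normrM ler_wpM2l.
Qed.

Lemma trunc_treeE k i w : trunc_tree k i w = \sum_(t < k) layer t i w.
Proof.
elim: k i => [|k IH] i; first by rewrite big_ord0.
rewrite /= big_ord_recl /=; congr (_ + _).
rewrite (exchange_big_dep xpredT) //=; apply: eq_bigr => l _.
by rewrite IH mulr_sumr.
Qed.

End TreeSums.

Definition desc (i j : seq nat) := exists s, j = s ++ i.

Lemma desc_refl i : desc i i. Proof. by exists [::]. Qed.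

Lemma desc_cons l i j : desc (l :: i) j -> desc i j.
Proof. by move=> [s ->]; exists (rcons s l); rewrite cat_rcons. Qed.

Lemma desc_cons_self l i : ~ desc (l :: i) i.
Proof.
move=> [s /(congr1 size)]; rewrite size_cat /= => e.
by have := leq_addl (size s) (size i).+1; rewrite -e ltnn.
Qed.

Lemma desc_cons_inj l m i j : desc (l :: i) j -> desc (m :: i) j -> l = m.
Proof.
move=> [s ->] [s' e]; have := congr1 size e; rewrite !size_cat => /eqP.
rewrite /= eqn_add2r => /eqP ss; move/eqP: e; rewrite eqseq_cat //.
by move=> /andP[_ /eqP[]].
Qed.

(** [generation] grows at the leaves while [layer] recurses from the root. Both are iterates of the
    operator [op], and the claim for an arbitrary [g] lets the induction peel off either end. *)
Lemma generation_sum d (T : measurableType d) (R : realType) (P : probability T R)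
    (Nt : seq nat -> {RV P >-> nat}) (Qt : seq nat -> {RV P >-> R})
    (Ct : seq nat -> nat -> {RV P >-> R}) w k :
  \sum_(i <- generation Nt w k) path_weight Ct w i * Qt i w =
  layer (fun i => Nt i) (fun i => Qt i) (fun i l => Ct i l) k [::] w.
Proof.
pose op (g : seq nat -> R) i := \sum_(l < Nt i w) Ct i l w * g (val l :: i).
have genE (g : seq nat -> R) : \sum_(i <- generation Nt w k) path_weight Ct w i * g i =
    iter k op g [::].
  elim: k g => [|k IH] g; first by rewrite big_seq1 /= mul1r.
  rewrite iterSr -IH /= big_allpairs_dep; apply: eq_bigr => i _.
  rewrite -[X in iota _ X]subn0 -/(index_iota _ _) big_mkord /op mulr_sumr.
  by apply: eq_bigr => l _; rewrite mulrA.
rewrite genE.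
have layE m i : layer (fun i => Nt i) (fun i => Qt i) (fun i l => Ct i l) m i w =
    iter m op (fun i => Qt i w) i.
  by elim: m i => [|m IH] i //=; apply: eq_bigr => l _; rewrite IH.
by rewrite layE.
Qed.

Section TreeMeasurable.
Variables (R : realType) (d : measure_display) (T : measurableType d).
Variables (Nt : seq nat -> T -> nat)
  (Qt : seq nat -> T -> R) (Ct : seq nat -> nat -> T -> R).

Lemma measurable_random_sum (N : T -> nat) (F : nat -> T -> R) :
  measurable_fun setT N -> (forall l, measurable_fun setT (F l)) ->
  measurable_fun setT (fun w => \sum_(l < N w) F l w).
Proof.
move=> mN mF.
apply: (measurable_fun_nat_index (F := fun m w => \sum_(l < m) F l w)) => // m.
by apply: measurable_sum => l; exact: mF.
Qed.

(** Measurability is required of the descendants of [i] only, and [T] is an arbitrary measurable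
    space: this allows the sigma-algebra generated by one subtree to be used in its place. *)
Lemma measurable_tree i :
  (forall j, desc i j -> [/\ measurable_fun setT (Nt j), measurable_fun setT (Qt j)
     & forall l, measurable_fun setT (Ct j l)]) ->
  forall k, [/\ measurable_fun setT (layer Nt Qt Ct k i),
    measurable_fun setT (abs_layer Nt Qt Ct k i)
    & measurable_fun setT (trunc_tree Nt Qt Ct k i)].
Proof.
move=> mi k; elim: k i mi => [|k IH] i mi; have [mN mQ mC] := mi _ (desc_refl i).
  by split => //; [exact: measurableT_comp | exact: measurable_cst].
have IHl l := IH (l :: i) (fun j ij => mi j (desc_cons ij)).
split.
- apply: (measurable_random_sum (F := fun l w => Ct i l w * layer Nt Qt Ct k (l :: i) w)) => // l.
  by have [mL _ _] := IHl l; exact: measurable_funM.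
- apply: (measurable_random_sum (F := fun l w => `|Ct i l w| * abs_layer Nt Qt Ct k (l :: i) w)) => // l.
  by have [_ mL _] := IHl l; apply: measurable_funM => //; exact: measurableT_comp.
- apply: measurable_funD => //.
  apply: (measurable_random_sum (F := fun l w => Ct i l w * trunc_tree Nt Qt Ct k (l :: i) w)) => // l.
  by have [_ _ mL] := IHl l; exact: measurable_funM.
Qed.

End TreeMeasurable.

Section SigmaOf.
Context d (T : measurableType d) d' (T' : measurableType d') (X : T -> T').

Lemma sigma_of_measurable : measurable_fun setT X -> sigma_of X `<=` measurable.
Proof. by move=> mX _ [B mB <-]; exact: mX. Qed.

Lemma sigma_of_setI : setI_closed (sigma_of X).
Proof.
move=> _ _ [A mA <-] [B mB <-]; exists (A `&` B); first exact: measurableI.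
by rewrite !setTI preimage_setI.
Qed.

Lemma sigma_of_setT : sigma_of X setT.
Proof. by exists setT => //; rewrite setTI preimage_setT. Qed.

Lemma sigma_of_fun (G : set (set T)) : sigma_of X `<=` <<s G >> ->
  measurable_fun setT (X : g_sigma_algebraType G -> T').
Proof. by move=> XG _ B mB; apply: XG; exists B. Qed.

End SigmaOf.

Section IndependentProduct.
Context d (T : measurableType d) (R : realType) (P : probability T R).

Lemma indep_mean_prod (X Y : T -> R) (a b : R) :
  measurable_fun setT X -> measurable_fun setT Y -> indep_rv P X Y -> 0 <= b ->
  (\int[P]_w (`|X w|)%:E <= a%:E)%E -> (\int[P]_w (`|Y w|)%:E <= b%:E)%E ->
  (\int[P]_w (`|X w| * `|Y w|)%:E <= (a * b)%:E)%E.
Proof.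
move=> mX mY XY b0 Xa Yb.
have mf : measurable_fun setT (fun z : R * R => (`|z.1| * `|z.2|)%:E).
  by apply/measurable_EFinP; apply: measurable_funM; exact: measurableT_comp.
rewrite (indep_integral (f := fun z : R * R => (`|z.1| * `|z.2|)%:E)) //.
apply: (@le_trans _ _ (\int[P]_w (b * `|X w|)%:E)%E).
  under eq_integral => w _.
    rewrite /= nnintZ //; last exact: measurableT_comp.
    over.
  apply: ge0_le_integral => //.
  - by move=> w _; rewrite mule_ge0 ?lee_fin // integral_ge0.
  - apply: emeasurable_funM => //.
    by apply/measurable_EFinP; exact: measurableT_comp.
  - apply/measurable_EFinP; apply: measurable_funM => //.
    exact: measurableT_comp.
  - move=> w _; rewrite mulrC EFinM; apply: lee_wpmul2l; last exact: Yb.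
    by rewrite lee_fin.
rewrite nnintZ //; last exact: measurableT_comp.
by rewrite mulrC EFinM; apply: lee_wpmul2l.
Qed.

Lemma measurable_gsigma_sub d' (T' : measurableType d') (F G : set (set T))
    (X : T -> T') : F `<=` G ->
  measurable_fun setT (X : g_sigma_algebraType F -> T') ->
  measurable_fun setT (X : g_sigma_algebraType G -> T').
Proof.
move=> FG mX _ B mB; have := mX measurableT _ mB.
by apply: sub_smallest2r => //; exact: smallest_sigma_algebra.
Qed.

Lemma measurable_of_gsigma d' (T' : measurableType d') (F : set (set T))
    (X : T -> T') : F `<=` measurable ->
  measurable_fun setT (X : g_sigma_algebraType F -> T') ->
  measurable_fun setT X.
Proof.
move=> Fm mX _ B mB; have := mX measurableT _ mB.
by apply: smallest_sub => //; exact: sigma_algebra_measurable.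
Qed.

End IndependentProduct.

Section TreeLaw.
Context d (T : measurableType d) (R : realType) (P : probability T R).
Variables (Nt : seq nat -> {RV P >-> nat}) (Qt : seq nat -> {RV P >-> R})
  (Ct : seq nat -> nat -> {RV P >-> R}) (N : {RV P >-> nat}) (Q C : {RV P >-> R}).
Hypothesis Hbr : branching_family Nt Qt Ct N Q C.

(** The independent sources of randomness: [(i, None)] is the pair [(N_i, Q_i)], kept together
    because its entries may be dependent, and [(i, Some l)] is the weight of the [l]-th child of
    [i]. *)
Definition atom (a : seq nat * option nat) : set (set T) :=
  if a.2 is Some l then sigma_of (Ct a.1 l)
  else sigma_of (pair_rv (Nt a.1) (Qt a.1)).

Lemma measurable_pair_rv i : measurable_fun setT (pair_rv (Nt i) (Qt i)).
Proof. exact: measurable_fun_pair. Qed.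

Lemma atom_measurable a : atom a `<=` measurable.
Proof.
rewrite /atom; case: a.2 => [l|]; apply: sigma_of_measurable => //.
exact: measurable_pair_rv.
Qed.

Lemma atom_setI a : setI_closed (atom a).
Proof. by rewrite /atom; case: a.2 => [l|]; exact: sigma_of_setI. Qed.

Lemma atom_setT a : atom a setT.
Proof. by rewrite /atom; case: a.2 => [l|]; exact: sigma_of_setT. Qed.

Lemma atoms_independent : mutually_independent P atom.
Proof.
have [_ Hv Hm] := Hbr.
apply: (mutually_independent_pair (F := fun i o => atom (i, o))).
  move=> i; have [[_ mC] NQC] := Hv i.
  exact: (mutually_independent_option NQC mC).
apply: mutually_independent_sub Hm => i.
apply: smallest_sub; first exact: smallest_sigma_algebra.
move=> A [x _]; rewrite /atom /=; case: x => [l|] xA; apply: sub_gen_smallest.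
  by right; exists l.
by left.
Qed.

Definition group (p : set (seq nat * option nat)) := \bigcup_(a in p) atom a.

Lemma groups_independent p q : p `&` q `<=` set0 ->
  independent2 P <<s group p >> <<s group q >>.
Proof.
move=> pq; apply: independent2_groups => //.
- exact: atom_measurable.
- exact: atom_setI.
- exact: atom_setT.
- exact: atoms_independent.
Qed.

Lemma group_pair (p : set (seq nat * option nat)) i : p (i, None) ->
  measurable_fun setT ((fun w => (Nt i w, Qt i w))
                        : g_sigma_algebraType (group p) -> nat * R).
Proof.
move=> p_i; apply: sigma_of_fun => A NQA; apply: sub_gen_smallest.
by exists (i, None).
Qed.

Lemma group_weight (p : set (seq nat * option nat)) i l : p (i, Some l) ->
  measurable_fun setT (Ct i l : g_sigma_algebraType (group p) -> R).
Proof.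
move=> p_i; apply: sigma_of_fun => A NQA; apply: sub_gen_smallest.
by exists (i, Some l).
Qed.

Local Notation nt := (fun i => Nt i : T -> nat).
Local Notation qt := (fun i => Qt i : T -> R).
Local Notation ct := (fun i l => Ct i l : T -> R).

Lemma group_tree (p : set (seq nat * option nat)) i :
  (forall a, desc i a.1 -> p a) -> forall k,
  let T' := g_sigma_algebraType (group p) in
  [/\ measurable_fun setT (layer nt qt ct k i : T' -> R),
      measurable_fun setT (abs_layer nt qt ct k i : T' -> R)
    & measurable_fun setT (trunc_tree nt qt ct k i : T' -> R)].
Proof.
move=> ip k /=.
apply: (@measurable_tree R _ (g_sigma_algebraType (group p)) nt qt ct) => j ij.
split.
- have := group_pair (ip (j, None) ij).
  by move=> /(measurableT_comp (@measurable_fst _ _ _ _)).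
- have := group_pair (ip (j, None) ij).
  by move=> /(measurableT_comp (@measurable_snd _ _ _ _)).
- by move=> l; apply: group_weight; exact: ip.
Qed.

Lemma tree_measurable k i :
  [/\ measurable_fun setT (layer nt qt ct k i),
      measurable_fun setT (abs_layer nt qt ct k i)
    & measurable_fun setT (trunc_tree nt qt ct k i)].
Proof. by apply: measurable_tree => j _; split. Qed.

(* The atoms on which the l-th subtree of node i depends, including the weight
   of the edge leading to it. *)
Definition subtree i l : set (seq nat * option nat) :=
  [set a | a = (i, Some l) \/ desc (l :: i) a.1].

Lemma subtree_disjoint i l m : l <> m -> subtree i l `&` subtree i m `<=` set0.
Proof.
move=> lm a [/= [->|jl] [e|jm]].
- by apply: lm; case: e.
- exact: (desc_cons_self jm).
- by rewrite e in jl; exact: (desc_cons_self jl).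
- by apply: lm; exact: (desc_cons_inj jl jm).
Qed.

Lemma root_subtree_disjoint i l : [set (i, None)] `&` subtree i l `<=` set0.
Proof.
by move=> a [/= -> [//|]] /=; exact: desc_cons_self.
Qed.

Section Siblings.
Variables (i : seq nat) (X : nat -> T -> R).
Hypothesis mX : forall l,
  measurable_fun setT (X l : g_sigma_algebraType (group (subtree i l)) -> R).

Lemma sibling_psum_measurable m :
  measurable_fun setT
    (psum X m : g_sigma_algebraType
       (group (\bigcup_(l in [set l | (l < m)%N]) subtree i l)) -> R).
Proof.
apply: measurable_sum => l; apply: (measurable_gsigma_sub _ (@mX l)) => A [a la aA].
by exists a => //; exists l => /=.
Qed.

Lemma sibling_independent m : indep_rv P (X m) (psum X m).
Proof.
have H : independent2 P <<s group (subtree i m) >>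
    <<s group (\bigcup_(l in [set l | (l < m)%N]) subtree i l) >>.
  apply: groups_independent => a [ma [l /= lm la]].
  apply: (@subtree_disjoint i m l _ a (conj ma la)) => ml.
  by rewrite ml ltnn in lm.
exact: (indep_rv_sub H (@mX m) (@sibling_psum_measurable m)).
Qed.

Lemma root_independent m :
  indep_rv P (fun w => (Nt i w, Qt i w)) (psum X m).
Proof.
have H : independent2 P <<s group [set (i, None)] >>
    <<s group (\bigcup_(l in [set l | (l < m)%N]) subtree i l) >>.
  apply: groups_independent => a [ma [l /= lm la]].
  exact: root_subtree_disjoint (conj ma la).
apply: (indep_rv_sub H _ (@sibling_psum_measurable m)).
exact: group_pair.
Qed.

End Siblings.

Lemma weight_subtree_independent i l k :
  indep_rv P (Ct i l) (abs_layer nt qt ct k (l :: i)) /\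
  indep_rv P (Ct i l) (trunc_tree nt qt ct k (l :: i)).
Proof.
have [_ mA mt] := group_tree (p := [set a | desc (l :: i) a.1]) (fun a H => H) k.
have mC := group_weight (p := [set (i, Some l)]) (i := i) (l := l) erefl.
have H : independent2 P <<s group [set (i, Some l)] >>
                        <<s group [set a | desc (l :: i) a.1] >>.
  by apply: groups_independent => a [/= -> /=]; exact: desc_cons_self.
by split; [exact: indep_rv_sub H mC mA|exact: indep_rv_sub H mC mt].
Qed.

Lemma subtree_measurable i l k :
  let T' := g_sigma_algebraType (group (subtree i l)) in
  measurable_fun setT
    ((fun w => `|Ct i l w| * abs_layer nt qt ct k (l :: i) w) : T' -> R) /\
  measurable_fun setT
    ((fun w => Ct i l w * trunc_tree nt qt ct k (l :: i) w) : T' -> R).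
Proof.
move=> T'; have mC : measurable_fun setT (Ct i l : T' -> R).
  by apply: group_weight; left.
have [_ mA mt] := group_tree (p := subtree i l) (fun a H => or_intror H) k.
split; last exact: measurable_funM.
by apply: measurable_funM => //; exact: measurableT_comp.
Qed.

Lemma node_integral i (f : nat * R -> \bar R) : measurable_fun setT f ->
  (forall x, 0 <= f x)%E ->
  (\int[P]_w f (Nt i w, Qt i w) = \int[P]_w f (N w, Q w))%E.
Proof.
move=> mf f0; have [H _ _] := Hbr.
have := same_law_integral (X := pair_rv (Nt i) (Qt i)) (Y := pair_rv N Q) _ _ (H i) mf f0.
by apply; exact: measurable_fun_pair.
Qed.

Lemma weight_integral i l (f : R -> \bar R) : measurable_fun setT f ->
  (forall x, 0 <= f x)%E ->
  (\int[P]_w f (Ct i l w) = \int[P]_w f (C w))%E.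
Proof.
move=> mf f0; have [_ H _] := Hbr; have [[Hl _] _] := H i.
exact: same_law_integral.
Qed.

End TreeLaw.

Lemma geometric_sum_le (R : realType) (x : R) m : 0 <= x < 1 ->
  \sum_(t < m) x ^+ t <= (1 - x)^-1.
Proof.
move=> /andP[x0 x1]; rewrite -[leRHS]mul1r ler_pdivlMr ?subr_gt0 // mulrC.
suff -> : (1 - x) * \sum_(t < m) x ^+ t = 1 - x ^+ m by rewrite gerBl exprn_ge0.
elim: m => [|m IH]; first by rewrite big_ord0 mulr0 subrr.
by rewrite big_ord_recr /= mulrDr IH exprS; ring.
Qed.

(** The bound lives in [\bar R]. A finite tail forces absolute convergence, so [limn] is the true
    sum; an infinite tail asserts nothing, and the default value of [limn] does no harm. *)
Lemma abs_series_tail (R : realType) (v a : nat -> R) k :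
  (forall n, `|v n| <= a n) ->
  (`|limn (series v) - \sum_(t < k) v t|%:E
     <= \sum_(0 <= n <oo) (a (k + n)%N)%:E)%E.
Proof.
move=> va; have a0 n : 0 <= a n := le_trans (normr_ge0 _) (va n).
set A := (\sum_(0 <= n <oo) _)%E.
have A0 : (0 <= A)%E by apply: nneseries_ge0 => n _ _; rewrite lee_fin.
have [Afin|] := boolP (A \is a fin_num); last first.
  by rewrite ge0_fin_numE // -leNgt leye_eq => /eqP ->; rewrite leey.
pose r := fine A; have rA : A = r%:E by rewrite fineK.
have part m : \sum_(0 <= n < m) a (k + n)%N <= r.
  rewrite -lee_fin -rA -sumEFin; apply: nneseries_lim_ge => n _ _.
  by rewrite lee_fin.
have tailm m : (k <= m)%N -> \sum_(k <= n < m) `|v n| <= r.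
  move=> km; apply: le_trans (part (m - k)%N).
  rewrite -{1}[k]add0n big_addn; apply: ler_sum => n _.
  by rewrite addnC.
have splitm m (u : nat -> R) : (k <= m)%N -> series u m =
    \sum_(t < k) u t + \sum_(k <= n < m) u n.
  by move=> km; rewrite /series /= (big_cat_nat (leq0n k) km) //= big_mkord.
have cv : cvgn (series v).
  apply: normed_cvg; apply: nondecreasing_is_cvgn.
    move=> n m nm.
    change (series (fun n => `|v n|) n <= series (fun n => `|v n|) m).
    rewrite /series /= (big_cat_nat (leq0n n) nm) //= lerDl sumr_ge0 //.
  exists (\sum_(t < k) `|v t| + r) => _ [m _ <-].
  change (series (fun n => `|v n|) m <= \sum_(t < k) `|v t| + r).
  have [km|/ltnW mk] := leqP k m.
    by rewrite splitm // lerD2l tailm.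
  apply: le_trans (_ : series (fun n => `|v n|) k <= _).
    rewrite /series /= (big_cat_nat (leq0n m) mk) //= lerDl sumr_ge0 //.
  by rewrite /series /= big_mkord lerDl -lee_fin -rA.
rewrite rA lee_fin.
have cv' : `|series v m - \sum_(t < k) v t| @[m --> \oo]
    --> `|limn (series v) - \sum_(t < k) v t|.
  by apply: cvg_norm; apply: cvgB => //; exact: cvg_cst.
apply: (ler_cvg_to cv' (cvg_cst r)).
near=> m; have km : (k <= m)%N by near: m; exact: nbhs_infty_ge.
rewrite splitm // addrAC subrr add0r.
by apply: le_trans (ler_norm_sum _ _ _) _; exact: tailm.
Unshelve. all: by end_near. Qed.

Lemma nneseries_le_fin (R : realType) (u : nat -> \bar R) (c : R) :
  (forall n, 0 <= u n)%E -> (forall m, \sum_(0 <= n < m) u n <= c%:E)%E ->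
  (\sum_(0 <= n <oo) u n <= c%:E)%E.
Proof.
move=> u0 uc; apply: lime_le; first by apply: is_cvg_nneseries => n _ _.
by near=> m; exact: uc.
Unshelve. all: by end_near. Qed.

(** * First moments of the branching tree *)

Section TreeMoments.
Context d (T : measurableType d) (R : realType) (P : probability T R).
Variables (Nt : seq nat -> {RV P >-> nat}) (Qt : seq nat -> {RV P >-> R})
  (Ct : seq nat -> nat -> {RV P >-> R}) (N : {RV P >-> nat}) (Q C : {RV P >-> R}).
Hypothesis Hbr : branching_family Nt Qt Ct N Q C.

Local Notation nt := (fun i => Nt i : T -> nat).
Local Notation qt := (fun i => Qt i : T -> R).
Local Notation ct := (fun i l => Ct i l : T -> R).

Variables (eN eQ eC : R).
Hypotheses (HN : (\int[P]_w ((N w)%:R)%:E <= eN%:E)%E)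
  (HQ : (\int[P]_w (`|Q w|)%:E <= eQ%:E)%E)
  (HC : (\int[P]_w (`|C w|)%:E <= eC%:E)%E).
Hypothesis rho1 : eN * eC < 1.

Lemma eN_ge0 : 0 <= eN.
Proof. by rewrite -lee_fin; apply: le_trans HN; exact: integral_ge0. Qed.

Lemma eQ_ge0 : 0 <= eQ.
Proof. by rewrite -lee_fin; apply: le_trans HQ; exact: integral_ge0. Qed.

Lemma eC_ge0 : 0 <= eC.
Proof. by rewrite -lee_fin; apply: le_trans HC; exact: integral_ge0. Qed.

Lemma weight_mean i l : (\int[P]_w (`|Ct i l w|)%:E <= eC%:E)%E.
Proof.
rewrite (weight_integral Hbr i l (f := fun x : R => (`|x|)%:E)) //.
by apply/measurable_EFinP; exact: normr_measurable.
Qed.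

(** Wald's argument in each generation: given the number of children, each contributes at most [eC]
    times the bound for the previous generation, and averaging that number gives the factor [eN]. *)
Lemma abs_layer_mean k i :
  (\int[P]_w (abs_layer nt qt ct k i w)%:E <= (eQ * (eN * eC) ^+ k)%:E)%E.
Proof.
elim: k i => [|k IH] i.
  rewrite /= expr0 mulr1.
  have := node_integral Hbr i (f := fun x : nat * R => (`|x.2|)%:E).
  move=> /= -> //; apply/measurable_EFinP.
  by do 2 apply: measurableT_comp => //.
pose X l w := `|Ct i l w| * abs_layer nt qt ct k (l :: i) w.
have X0 l w : 0 <= X l w by rewrite mulr_ge0 // abs_layer_ge0.
have mX l : measurable_fun setT (X l).
  have [_ mA _] := tree_measurable Nt Qt Ct k (l :: i).
  by apply: measurable_funM => //; exact: measurableT_comp.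
pose a := eQ * (eN * eC) ^+ k.
have a0 : 0 <= a.
  by rewrite mulr_ge0 ?eQ_ge0 // exprn_ge0 // mulr_ge0 ?eN_ge0 ?eC_ge0.
have XM l : (\int[P]_w (`|X l w|)%:E <= (eC * a)%:E)%E.
  have [_ mA _] := tree_measurable Nt Qt Ct k (l :: i).
  under eq_integral do rewrite /X normrM normr_id.
  apply: indep_mean_prod => //.
  - by have [] := weight_subtree_independent Hbr i l k.
  - exact: weight_mean.
  - under eq_integral do rewrite ger0_norm ?abs_layer_ge0 //.
    exact: IH.
have rI m : indep_rv P (fun w => (Nt i w, Qt i w)) (psum X m).
  apply: (root_independent Hbr) => l.
  by have [] := subtree_measurable Nt Qt Ct i l k.
have := random_index (N := Nt i) (Q := Qt i) (Y := psum X) _ _ _ rI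
  (h := fun _ z => (`|z.2|)%:E).
have psum0 m w : `|psum X m w| = psum X m w.
  by rewrite ger0_norm // /psum sumr_ge0.
rewrite /=; under eq_integral do rewrite psum0 /psum -/(X _ _).
move=> ->//; first last.
- by move=> _; apply/measurable_EFinP; apply: measurableT_comp.
- by move=> m; exact: measurable_psum.
apply: (@le_trans _ _ (\int[P]_w ((eC * a) * (Nt i w)%:R)%:E)%E).
  apply: ge0_le_integral => //.
  - by move=> w _; apply: integral_ge0.
  - apply: (measurable_fun_nat_index (F := fun m _ => \int[P]_w' (`|psum X m w'|)%:E)%E) => //.
  - by apply/measurable_EFinP; apply: measurable_funM => //; exact: measurableT_comp.
  - by move=> w _; exact: mean_psum.
rewrite nnintZ //; last 2 first.
- exact: measurableT_comp.
- by rewrite mulr_ge0 ?eC_ge0.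
have -> : eQ * (eN * eC) ^+ k.+1 = eC * a * eN by rewrite /a exprS; ring.
rewrite [X in (_ <= X)%E]EFinM; apply: lee_wpmul2l; first by rewrite lee_fin mulr_ge0 ?eC_ge0.
have := node_integral Hbr i (f := fun x : nat * R => ((x.1)%:R)%:E).
move=> /= -> //; apply/measurable_EFinP.
by apply: measurableT_comp.
Qed.

Let rho01 : 0 <= eN * eC < 1.
Proof. by rewrite rho1 andbT mulr_ge0 ?eN_ge0 ?eC_ge0. Qed.

Definition tree_bound := eQ / (1 - eN * eC).

Lemma tree_bound_ge0 : 0 <= tree_bound.
Proof. by rewrite divr_ge0 ?eQ_ge0 // subr_ge0 ltW. Qed.

Lemma trunc_tree_mean k i :
  (\int[P]_w (`|trunc_tree nt qt ct k i w|)%:E <= tree_bound%:E)%E.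
Proof.
apply: (@le_trans _ _ (\int[P]_w (\sum_(t < k) abs_layer nt qt ct t i w)%:E)%E).
  apply: nnint_le => //.
  - by apply: measurableT_comp => //; have [] := tree_measurable Nt Qt Ct k i.
  - by apply: measurable_sum => t; have [] := tree_measurable Nt Qt Ct t i.
  - move=> w; rewrite trunc_treeE; apply: le_trans (ler_norm_sum _ _ _) _.
    by apply: ler_sum => t _; exact: layer_le.
rewrite nnint_sum; first last.
- by move=> t w; exact: abs_layer_ge0.
- by move=> t; have [] := tree_measurable Nt Qt Ct t i.
apply: (@le_trans _ _ (\sum_(t < k) (eQ * (eN * eC) ^+ t)%:E)%E).
  by apply: lee_sum => t _; exact: abs_layer_mean.
rewrite sumEFin lee_fin -mulr_sumr ler_wpM2l ?eQ_ge0 //.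
exact: geometric_sum_le.
Qed.

Lemma edge_mean k i l :
  (\int[P]_w (`|Ct i l w * trunc_tree nt qt ct k (l :: i) w|)%:E
     <= (eC * tree_bound)%:E)%E.
Proof.
under eq_integral do rewrite normrM.
have [_ _ mt] := tree_measurable Nt Qt Ct k (l :: i).
apply: indep_mean_prod => //; last exact: trunc_tree_mean.
- by have [] := weight_subtree_independent Hbr i l k.
- exact: tree_bound_ge0.
- exact: weight_mean.
Qed.

Lemma endogenousE w :
  endogenous Nt Qt Ct w = limn (series (fun k => layer nt qt ct k [::] w)).
Proof.
by rewrite /endogenous; under eq_fun do rewrite generation_sum.
Qed.

Lemma measurable_endogenous : measurable_fun setT (endogenous Nt Qt Ct).
Proof.
rewrite (_ : endogenous _ _ _ =
  fun w => limn (fun n => \sum_(0 <= k < n) layer nt qt ct k [::] w)); last first.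
  by apply/funext => w; rewrite endogenousE.
apply: measurable_fun_limn => n; apply: measurable_sum => k.
by have [] := tree_measurable Nt Qt Ct k [::].
Qed.

(** The pointwise tail bound is integrated term by term into a geometric series. At [k = 0] it
    bounds the first moment of the endogenous solution itself. *)
Lemma endogenous_approx k :
  (\int[P]_w (`|endogenous Nt Qt Ct w - trunc_tree nt qt ct k [::] w|)%:E
    <= (tree_bound * (eN * eC) ^+ k)%:E)%E.
Proof.
pose f n w := (abs_layer nt qt ct (k + n) [::] w)%:E.
have mf n : measurable_fun setT (f n).
  by apply/measurable_EFinP; have [] := tree_measurable Nt Qt Ct (k + n) [::].
have f0 n w : (0 <= f n w)%E by rewrite lee_fin abs_layer_ge0.
apply: (@le_trans _ _ (\int[P]_w \sum_(0 <= n <oo) f n w)%E).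
  apply: ge0_le_integral => //.
  - apply/measurable_EFinP; apply: measurableT_comp => //.
    apply: measurable_funB; first exact: measurable_endogenous.
    by have [] := tree_measurable Nt Qt Ct k [::].
  - exact: (ge0_emeasurable_sum (P := xpredT)).
  - move=> w _; rewrite endogenousE trunc_treeE.
    exact: (abs_series_tail (a := fun n => abs_layer nt qt ct n [::] w) k
              (fun n => layer_le nt qt ct n [::] w)).
rewrite integral_nneseries //.
apply: nneseries_le_fin => [n|m]; first exact: integral_ge0.
apply: (@le_trans _ _ (\sum_(0 <= n < m) (eQ * (eN * eC) ^+ (k + n))%:E)%E).
  by apply: lee_sum => n _; exact: abs_layer_mean.
rewrite sumEFin lee_fin big_mkord.
have -> : \sum_(n < m) eQ * (eN * eC) ^+ (k + n) =
    (eQ * (eN * eC) ^+ k) * \sum_(n < m) (eN * eC) ^+ n.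
  by rewrite mulr_sumr; apply: eq_bigr => n _; rewrite exprD mulrA.
rewrite /tree_bound [leRHS]mulrAC ler_wpM2l //; last exact: geometric_sum_le.
by have /andP[? _] := rho01; rewrite mulr_ge0 ?eQ_ge0 // exprn_ge0.
Qed.

End TreeMoments.

(** * Comparison with the limiting tree *)

Section RootLaw.
Context d (T : measurableType d) (R : realType) (P : probability T R).
Variables (N0 : {RV P >-> nat}) (Q0 C : {RV P >-> R}).
Variables (Cs Rs : nat -> {RV P >-> R}) (Y : T -> R).
Hypotheses (Hb : branching_vector N0 Q0 Cs C) (HR : iid_copies Rs Y).
Hypothesis HbR : independent2 P (branching_sigma N0 Q0 Cs) (sigma_family Rs).

(* The first component separates the two independent families; the index
   (true, None) is a trivial sigma-algebra that only fills the product type. *)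
Definition root_atom (a : bool * option nat) : set (set T) :=
  match a with
  | (false, None) => sigma_of (pair_rv N0 Q0)
  | (false, Some l) => sigma_of (Cs l)
  | (true, None) => [set setT]
  | (true, Some l) => sigma_of (Rs l)
  end.

Lemma root_atom_measurable a : root_atom a `<=` measurable.
Proof.
move: a => [[] [l|]] /=; try exact: sigma_of_measurable.
  by move=> A ->.
by apply: sigma_of_measurable; exact: measurable_fun_pair.
Qed.

Lemma root_atom_setI a : setI_closed (root_atom a).
Proof.
move: a => [[] [l|]] /=; try exact: sigma_of_setI.
by move=> A B -> ->; rewrite setIT.
Qed.

Lemma root_atom_setT a : root_atom a setT.
Proof. by move: a => [[] [l|]] //=; exact: sigma_of_setT. Qed.

Lemma root_atoms_independent : mutually_independent P root_atom.
Proof.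
have [[_ mC] NQC] := Hb; have [_ mR] := HR.
apply: (@mutually_independent_sub _ _ _ _ _ _ (fun a : bool * option nat => root_atom (a.1, a.2))).
  by move=> [a b] A.
apply: (mutually_independent_pair (F := fun b o => root_atom (b, o))).
  case; last exact: (mutually_independent_option NQC mC).
  apply: (mutually_independent_option (F0 := [set setT]) _ mR) => A B -> _.
  by rewrite setTI probability_setT mul1e.
apply: mutually_independent_bool.
apply: independent2_sub HbR; (apply: smallest_sub; first exact: smallest_sigma_algebra).
  move=> A [x _]; case: x => [l|] xA; apply: sub_gen_smallest.
    by right; exists l.
  by left.
move=> A [x _]; case: x => [l|] xA; first by apply: sub_gen_smallest; exists l.
move: xA => ->.
exact: (@measurableT _ (g_sigma_algebraType (\bigcup_i sigma_of (Rs i)))).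
Qed.

Definition root_group (p : set (bool * option nat)) := \bigcup_(a in p) root_atom a.

Lemma root_groups_independent p q : p `&` q `<=` set0 ->
  independent2 P <<s root_group p >> <<s root_group q >>.
Proof.
move=> pq; apply: independent2_groups => //.
- exact: root_atom_measurable.
- exact: root_atom_setI.
- exact: root_atom_setT.
- exact: root_atoms_independent.
Qed.

Lemma root_group_weight (p : set (bool * option nat)) l : p (false, Some l) ->
  measurable_fun setT (Cs l : g_sigma_algebraType (root_group p) -> R).
Proof.
move=> p_l; apply: sigma_of_fun => A lA; apply: sub_gen_smallest.
by exists (false, Some l).
Qed.

Lemma root_group_rank (p : set (bool * option nat)) l : p (true, Some l) ->
  measurable_fun setT (Rs l : g_sigma_algebraType (root_group p) -> R).
Proof.
move=> p_l; apply: sigma_of_fun => A lA; apply: sub_gen_smallest.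
by exists (true, Some l).
Qed.

Definition root_edge l w := Cs l w * Rs l w.

Definition edge_atoms l : set (bool * option nat) := [set a | a.2 = Some l].

Lemma root_edge_measurable (p : set (bool * option nat)) l : edge_atoms l `<=` p ->
  measurable_fun setT (root_edge l : g_sigma_algebraType (root_group p) -> R).
Proof.
move=> lp; apply: measurable_funM; [apply: root_group_weight|apply: root_group_rank];
  exact: lp.
Qed.

Lemma root_psum_measurable m : measurable_fun setT
  (psum root_edge m : g_sigma_algebraType
     (root_group (\bigcup_(l in [set l | (l < m)%N]) edge_atoms l)) -> R).
Proof.
apply: measurable_sum => l; apply: root_edge_measurable => a la.
by exists l => /=.
Qed.

Lemma root_edge_independent m : indep_rv P (root_edge m) (psum root_edge m).
Proof.
have H : independent2 P <<s root_group (edge_atoms m) >>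
    <<s root_group (\bigcup_(l in [set l | (l < m)%N]) edge_atoms l) >>.
  apply: root_groups_independent => a [am [l /= lm al]].
  by move: lm; move: al; rewrite /edge_atoms /= am => -[->]; rewrite ltnn.
apply: (indep_rv_sub H _ (@root_psum_measurable m)).
exact: root_edge_measurable.
Qed.

Lemma root_node_independent m :
  indep_rv P (fun w => (N0 w, Q0 w)) (psum root_edge m).
Proof.
have H : independent2 P <<s root_group [set (false, None)] >>
    <<s root_group (\bigcup_(l in [set l | (l < m)%N]) edge_atoms l) >>.
  by apply: root_groups_independent => a [-> [l /= lm]].
apply: (indep_rv_sub H _ (@root_psum_measurable m)).
apply: sigma_of_fun => A NQA; apply: sub_gen_smallest.
by exists (false, None).
Qed.

Lemma root_weight_independent l : indep_rv P (Cs l) (Rs l).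
Proof.
have H : independent2 P <<s root_group [set (false, Some l)] >>
    <<s root_group [set (true, Some l)] >>.
  by apply: root_groups_independent => a [/= -> ].
by apply: (indep_rv_sub H); [exact: root_group_weight|exact: root_group_rank].
Qed.

End RootLaw.

(* A coupling, with mean l1 distance at most [eta] in each coordinate, of the
   discrete law sum_j p_j delta_(mj, qj, cj) with law(N, Q) * law(C). *)
Definition close_laws (R : realType) (eta : R) (J : finType) (p : J -> R)
    (mj : J -> nat) (qj cj : J -> R) d (T : measurableType d)
    (P : probability T R) (N : T -> nat) (Q C : T -> R) : Prop :=
  exists (dZ : measure_display) (Z : measurableType dZ) (pi : probability Z R)
    (m1 m2 : Z -> nat) (q1 q2 c1 c2 : Z -> R),
  [/\ [/\ measurable_fun setT m1, measurable_fun setT q1 & measurable_fun setT c1],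
      [/\ measurable_fun setT m2, measurable_fun setT q2 & measurable_fun setT c2],
      forall Phi : nat * R * R -> \bar R,
        measurable_fun setT Phi -> (forall x, 0 <= Phi x)%E ->
        (\int[pi]_z Phi (m1 z, q1 z, c1 z)
           = \sum_j (p j)%:E * Phi (mj j, qj j, cj j))%E,
      forall Phi : nat * R * R -> \bar R,
        measurable_fun setT Phi -> (forall x, 0 <= Phi x)%E ->
        (\int[pi]_z Phi (m2 z, q2 z, c2 z)
           = \int[P]_w \int[P]_w' Phi (N w, Q w, C w'))%E
    & [/\ (\int[pi]_z (`|(m1 z)%:R - (m2 z)%:R|)%:E <= eta%:E)%E,
          (\int[pi]_z (`|q1 z - q2 z|)%:E <= eta%:E)%E
        & (\int[pi]_z (`|c1 z - c2 z|)%:E <= eta%:E)%E]].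

Definition tail_le (R : realType) d (T : measurableType d) (P : probability T R)
    (N : T -> nat) (Q C : T -> R) (M K tail : R) : Prop :=
  (\int[P]_w \int[P]_w' ((1 + `|C w'|) *
     Num.max (`|Q w| + M * (N w)%:R - K) 0)%:E <= tail%:E)%E.

Section TreeComparison.
Context d (T : measurableType d) (R : realType) (P : probability T R).
Variables (Nt : seq nat -> {RV P >-> nat}) (Qt : seq nat -> {RV P >-> R})
  (Ct : seq nat -> nat -> {RV P >-> R}) (N : {RV P >-> nat}) (Q C : {RV P >-> R}).
Hypothesis Hbr : branching_family Nt Qt Ct N Q C.
Variables (eN eQ eC : R).
Hypotheses (HN : (\int[P]_w ((N w)%:R)%:E <= eN%:E)%E)
  (HQ : (\int[P]_w (`|Q w|)%:E <= eQ%:E)%E)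
  (HC : (\int[P]_w (`|C w|)%:E <= eC%:E)%E).
Hypothesis rho1 : eN * eC < 1.

Local Notation nt := (fun i => Nt i : T -> nat).
Local Notation qt := (fun i => Qt i : T -> R).
Local Notation ct := (fun i l => Ct i l : T -> R).
Local Notation tr := (trunc_tree nt qt ct).

(** Bounds the mean of [|C * R|] for one child; it serves as [M] in the comparison of one
    generation. *)
Definition edge_bound := eC * tree_bound eN eQ eC.

Variables (n L : nat) (own : 'I_L -> 'I_n) (NN : 'I_n -> nat) (CC QQ : 'I_n -> R).
Hypotheses (L0 : (0 < L)%N) (CC1 : forall y, `|CC (own y)| <= 1).
Variables (eta K tail A : R).
Hypotheses (K0 : 0 <= K) (HK : tail_le P N Q C edge_bound K tail).
Hypothesis close : close_laws eta (fun _ : 'I_L => L%:R^-1 : R)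
  (fun y => NN (own y)) (fun y => QQ (own y)) (fun y => CC (own y)) P N Q C.
Hypothesis HA : mean_indeg R own NN <= A.

Local Notation Xi := (Xi own NN CC QQ).

Lemma edge_integral i l k (f : R -> R) Lf : (forall x, 0 <= f x) -> lip Lf f ->
  (\int[P]_w (f (Ct i l w * tr k (l :: i) w))%:E =
   \int[P]_w' \int[P]_w (f (C w' * tr k (l :: i) w))%:E)%E.
Proof.
move=> f0 fL; have mf := lip_measurable fL.
have [_ _ mt] := tree_measurable Nt Qt Ct k (l :: i).
have mF : measurable_fun setT (fun z : R * R => (f (z.1 * z.2))%:E).
  apply/measurable_EFinP; apply: measurableT_comp => //.
  exact: measurable_funM.
have [_ ind] := weight_subtree_independent Hbr i l k.
rewrite (indep_integral (f := fun z : R * R => (f (z.1 * z.2))%:E) _ mt ind) //=;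
  last by move=> z; rewrite lee_fin.
have mG : measurable_fun setT (fun z : R * T => (f (z.1 * tr k (l :: i) z.2))%:E).
  apply/measurable_EFinP; apply: measurableT_comp => //.
  apply: measurable_funM => //; exact: measurableT_comp.
have G0 z : (0 <= (fun z : R * T => (f (z.1 * tr k (l :: i) z.2))%:E) z)%E.
  by rewrite lee_fin.
have mH := @measurable_fun_fubini_tonelli_F _ _ _ _ _ P _ mG G0.
rewrite (weight_integral Hbr i l
   (f := fun c : R => \int[P]_w (f (c * tr k (l :: i) w))%:E)%E) // => x.
by apply: integral_ge0 => w _; rewrite lee_fin.
Qed.

(** The weight above a node is grouped with the node's own [(N, Q)]. This independent triple is the
    limit of the size-biased empirical law, in which weight, in-degree and personalization likewise
    belong to the same node, so one generation is an instance of [branch_comparison]. *)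
Lemma tree_step k delta :
  (forall i f Lf, (forall x, 0 <= f x) -> lip Lf f ->
    (\int[P]_w' \int[P]_w (f (C w' * tr k i w))%:E <= (Xi k f + delta * Lf)%:E)%E) ->
  0 <= delta ->
  forall i f Lf, (forall x, 0 <= f x) -> lip Lf f ->
    (\int[P]_w' \int[P]_w (f (C w' * tr k.+1 i w))%:E
      <= (Xi k.+1 f + (A * delta + (1 + edge_bound + K) * eta + tail) * Lf)%:E)%E.
Proof.
move=> IH delta0 i f Lf f0 fL; have mf := lip_measurable fL.
pose X l w := Ct i l w * tr k (l :: i) w.
have mX l : measurable_fun setT (X l).
  have [_ _ mt] := tree_measurable Nt Qt Ct k (l :: i).
  exact: measurable_funM.
have gX l : measurable_fun setT
   (X l : g_sigma_algebraType (group Nt Qt Ct (subtree i l)) -> R).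
  by have [] := subtree_measurable Nt Qt Ct i l k.
have sX m : indep_rv P (X m) (psum X m) by exact: (sibling_independent Hbr gX).
have rX m := root_independent Hbr gX m.
have XM l : (\int[P]_w (`|X l w|)%:E <= edge_bound%:E)%E.
  exact: (edge_mean Hbr HN HQ HC rho1).
have XXi l g Lg : (forall x, 0 <= g x) -> lip Lg g ->
    (\int[P]_w (g (X l w))%:E <= (Xi k g + delta * Lg)%:E)%E.
  by move=> g0 gL; rewrite (edge_integral i l k g0 gL); exact: IH.
have mB := measurable_branch_mean P mX f0 mf.
have B0 x : (0 <= (fun x : nat * R * R => branch_mean P X f x.1.1 x.1.2 x.2) x)%E.
  by apply: integral_ge0 => w _; rewrite lee_fin.
have E : (\int[P]_w' \int[P]_w (f (C w' * tr k.+1 i w))%:E =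
    \int[P]_w \int[P]_w' branch_mean P X f (N w) (Q w) (C w'))%E.
  have mG : measurable_fun setT
      (fun z : T * T => branch_mean P X f (N z.1) (Q z.1) (C z.2)).
    apply: (@measurableT_comp _ _ _ _ _ _ _ _
      (fun z : T * T => (N z.1, Q z.1, C z.2)) mB).
    apply: measurable_fun_pair; last exact: measurableT_comp.
    by apply: measurable_fun_pair; exact: measurableT_comp.
  have -> := fubini_tonelli (m1 := P) (m2 := P)
     (fun z : T * T => branch_mean P X f (N z.1) (Q z.1) (C z.2)) mG
     (fun z => B0 (N z.1, Q z.1, C z.2)).
  apply: eq_integral => w' _ /=.
  rewrite -(node_integral Hbr i
      (f := fun x : nat * R => branch_mean P X f x.1 x.2 (C w'))); first last.
  - by move=> x; exact: (B0 (x.1, x.2, C w')).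
  - apply: (@measurableT_comp _ _ _ _ _ _ _ _
      (fun x : nat * R => (x.1, x.2, C w')) mB).
    by apply: measurable_fun_pair => //; exact: measurable_fun_pair.
  apply: (random_index (h := fun _ z => (f (C w' * (z.1 + z.2)))%:E) _ _ _ rX) => //.
  - by move=> m; exact: measurable_psum.
  - move=> _; apply/measurable_EFinP; apply: measurableT_comp => //.
    by apply: measurable_funM => //; exact: measurable_funD.
  - by move=> _ z; rewrite lee_fin.
rewrite E.
have [dZ [Z [pi [m1 [m2 [q1 [q2 [c1 [c2 [[mm1 mq1 mc1] [mm2 mq2 mc2] Ma1 Ma2 [em eq ec]]]]]]]]]]] := close.
apply: le_trans (branch_comparison mX sX XM mm1 mm2 mq1 mq2 mc1 mc2
  (p := fun=> L%:R^-1) _ CC1 Ma1 Ma2 em eq ec K0 HK _ XXi f0 fL) _.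
- by move=> _; rewrite invr_ge0.
- by move=> g g' e; exact: Xi_le.
rewrite lee_fin -mulr_sumr lerD2l ler_wpM2r ?(lip_ge0 fL) // !lerD2r ler_wpM2r //.
by rewrite -mulr_sumr.
Qed.

(** Each generation multiplies the inherited error by the bound [A] on the size-biased mean
    in-degree, which may exceed 1, and adds one coupling error. It is small only when [eta] and
    [tail] are chosen after [k]. *)
Fixpoint tree_error k : R :=
  if k is k'.+1 then A * tree_error k' + (1 + edge_bound + K) * eta + tail else 0.

Hypotheses (A0 : 0 <= A) (eta0 : 0 <= eta) (tail0 : 0 <= tail).

Lemma edge_bound_ge0 : 0 <= edge_bound.
Proof.
by rewrite mulr_ge0 ?(eC_ge0 HC) // (tree_bound_ge0 HQ rho1).
Qed.

Lemma tree_error_ge0 k : 0 <= tree_error k.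
Proof.
elim: k => //= k IH; rewrite !addr_ge0 // ?mulr_ge0 // !addr_ge0 //.
exact: edge_bound_ge0.
Qed.

Lemma tree_comparison k i f Lf : (forall x, 0 <= f x) -> lip Lf f ->
  (\int[P]_w' \int[P]_w (f (C w' * tr k i w))%:E
    <= (Xi k f + tree_error k * Lf)%:E)%E.
Proof.
elim: k i f Lf => [|k IH] i f Lf f0 fL; last first.
  by apply: tree_step => //; exact: tree_error_ge0.
rewrite /= mul0r addr0.
under eq_integral do under eq_integral do rewrite mulr0.
by rewrite !prob_int_cst.
Qed.

Section Root.
Variables (N0 : {RV P >-> nat}) (Q0 : {RV P >-> R}).
Variables (Cs Rs : nat -> {RV P >-> R}).
Hypotheses (Hb : branching_vector N0 Q0 Cs C)
  (HR : iid_copies Rs (endogenous Nt Qt Ct)).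
Hypothesis HbR : independent2 P (branching_sigma N0 Q0 Cs) (sigma_family Rs).
Variables (p : 'I_n -> R) (tail0' A0' : R).
Hypotheses (p0 : forall v, 0 <= p v)
  (HK0 : tail_le P N0 Q0 (fun=> 1) edge_bound K tail0').
Hypothesis close0 : close_laws eta p NN QQ (fun=> 1) P N0 Q0 (fun=> 1).
Hypothesis HA0 : \sum_v p v * (NN v)%:R <= A0'.

Definition root_error k : R :=
  A0' * (tree_error k + edge_bound * (eN * eC) ^+ k)
    + (1 + edge_bound + K) * eta + tail0'.

Lemma measurable_rank_f (f : R -> R) (Y : T -> R) : measurable_fun setT f ->
  measurable_fun setT Y ->
  measurable_fun setT (fun z : R * T => f (z.1 * Y z.2)).
Proof.
move=> mf mY; apply: measurableT_comp => //; apply: measurable_funM => //.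
exact: measurableT_comp.
Qed.

(** The one-generation step at the root, with node weights [p] and no weight above the root, hence
    [c = 1] on both sides. Below it stand full endogenous solutions rather than truncated trees,
    which adds the geometric tail in [root_error]. *)
Lemma root_comparison k f Lf : (forall x, 0 <= f x) -> lip Lf f ->
  (\int[P]_w (f (limit_rank N0 Q0 Cs Rs w))%:E <=
   (\sum_v p v * conv_iter (Xi k) (NN v) (fun s => f (QQ v + s))
     + root_error k * Lf)%:E)%E.
Proof.
move=> f0 fL; have mf := lip_measurable fL.
have mE : measurable_fun setT (endogenous Nt Qt Ct) by exact: measurable_endogenous.
have [[HCs _] _] := Hb; have [HRs _] := HR.
pose X := root_edge Cs Rs.
have mX l : measurable_fun setT (X l) by exact: measurable_funM.
have sX m : indep_rv P (X m) (psum X m) by exact: (root_edge_independent Hb HR HbR).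
have rX m := root_node_independent Hb HR HbR m.
have tb0 := tree_bound_ge0 HQ rho1.
have rho0 : 0 <= eN * eC by rewrite mulr_ge0 ?(eN_ge0 HN) ?(eC_ge0 HC).
have bk0 : 0 <= tree_bound eN eQ eC * (eN * eC) ^+ k.
  by rewrite mulr_ge0 ?tb0 ?exprn_ge0.
have RM l : (\int[P]_w (`|Rs l w|)%:E <= (tree_bound eN eQ eC)%:E)%E.
  rewrite (same_law_integral (f := fun x : R => (`|x|)%:E) _ mE (HRs l)) //.
    have := endogenous_approx Hbr HN HQ HC rho1 0.
    by rewrite expr0 mulr1; under eq_integral do rewrite subr0.
  by apply/measurable_EFinP; exact: normr_measurable.
have CM l : (\int[P]_w (`|Cs l w|)%:E <= eC%:E)%E.
  rewrite (same_law_integral (f := fun x : R => (`|x|)%:E) _ _ (HCs l)) //.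
  by apply/measurable_EFinP; exact: normr_measurable.
have XM l : (\int[P]_w (`|X l w|)%:E <= edge_bound%:E)%E.
  rewrite /X /root_edge; under eq_integral do rewrite normrM.
  by apply: indep_mean_prod => //; exact: (root_weight_independent Hb HR HbR).
(* Replacing [Rs l] by the depth-[k] tree costs [Lg * |C|] times the mean truncation error;
   [tree_comparison] does the rest. *)
have XXi l g Lg : (forall x, 0 <= g x) -> lip Lg g ->
   (\int[P]_w (g (X l w))%:E <=
     (Xi k g + (tree_error k + edge_bound * (eN * eC) ^+ k) * Lg)%:E)%E.
  move=> g0 gL; have mg := lip_measurable gL; have Lg0 := lip_ge0 gL.
  have mg2 : measurable_fun setT (fun z : R * R => (g (z.1 * z.2))%:E).
    by apply/measurable_EFinP; apply: measurableT_comp => //; exact: measurable_funM.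
  have mI (Y : T -> R) : measurable_fun setT Y ->
      measurable_fun setT (fun c : R => \int[P]_w (g (c * Y w))%:E)%E.
    move=> mY; have mG : measurable_fun setT (fun z : R * T => (g (z.1 * Y z.2))%:E).
      by apply/measurable_EFinP; exact: (measurable_rank_f mg mY).
    have G0 z : (0 <= (fun z : R * T => (g (z.1 * Y z.2))%:E) z)%E by rewrite lee_fin.
    exact: (@measurable_fun_fubini_tonelli_F _ _ _ _ _ P _ mG G0).
  have mIC (Y : T -> R) : measurable_fun setT Y ->
      measurable_fun setT (fun w' => \int[P]_w (g (C w' * Y w))%:E)%E.
    by move=> mY; exact: (measurableT_comp (mI Y mY)).
  have I0 (Y : T -> R) x : (0 <= \int[P]_w (g (x * Y w))%:E)%E.
    by apply: integral_ge0 => w _; rewrite lee_fin.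
  rewrite /X /root_edge (indep_integral (f := fun z : R * R => (g (z.1 * z.2))%:E)
    _ _ (root_weight_independent Hb HR HbR l)) //=; last by move=> z; rewrite lee_fin.
  rewrite (same_law_integral (f := fun c : R => \int[P]_w (g (c * Rs l w))%:E)%E
    _ _ (HCs l)) //; last exact: mI.
  pose Dk w := `|endogenous Nt Qt Ct w - tr k [::] w|.
  have D0 w : 0 <= Dk w by rewrite normr_ge0.
  have [_ _ mt] := tree_measurable Nt Qt Ct k [::].
  have mD : measurable_fun setT Dk.
    by apply: measurableT_comp => //; exact: measurable_funB.
  apply: (@le_trans _ _ (\int[P]_w' (\int[P]_w (g (C w' * tr k [::] w))%:E
     + ((Lg * `|C w'|) * (tree_bound eN eQ eC * (eN * eC) ^+ k))%:E))%E).
    apply: ge0_le_integral => //.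
    - exact: mIC.
    - apply: emeasurable_funD; first exact: mIC.
      apply/measurable_EFinP; do 2 (apply: measurable_funM => //).
      exact: measurableT_comp.
    - move=> w' _.
      have mgc : measurable_fun setT (fun w => g (C w' * tr k [::] w)).
        by apply: measurableT_comp => //; exact: measurable_funM.
      have mgC : measurable_fun setT (fun x : R => (g (C w' * x))%:E).
        by apply/measurable_EFinP; apply: measurableT_comp.
      rewrite (same_law_integral (f := fun x : R => (g (C w' * x))%:E) _ mE (HRs l)) //;
        last by move=> x; rewrite lee_fin.
      apply: (@le_trans _ _ (\int[P]_w (g (C w' * tr k [::] w)
         + (Lg * `|C w'|) * Dk w)%:E)%E).
        apply: nnint_le => //.
        + by apply: measurableT_comp => //; exact: measurable_funM.
        + by apply: measurable_funD => //; exact: measurable_funM.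
        + move=> w; apply: le_trans (gL _ (C w' * tr k [::] w)) _.
          by rewrite lerD2l -mulrBr normrM mulrA.
      rewrite nnintD //; last 2 first.
      + exact: measurable_funM.
      + by move=> w; rewrite mulr_ge0 ?D0 // mulr_ge0.
      rewrite leeD2l // nnintZ ?mulr_ge0 // [X in (_ <= X)%E]EFinM; apply: lee_wpmul2l.
        by rewrite lee_fin mulr_ge0.
      exact: (endogenous_approx Hbr HN HQ HC rho1).
  rewrite ge0_integralD //; last 3 first.
  - exact: mIC.
  - by move=> w _; rewrite lee_fin mulr_ge0 ?bk0 // mulr_ge0.
  - apply/measurable_EFinP; do 2 (apply: measurable_funM => //).
    exact: measurableT_comp.
  have -> : (Xi k g + (tree_error k + edge_bound * (eN * eC) ^+ k) * Lg)%:E =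
     ((Xi k g + tree_error k * Lg)%:E + (edge_bound * (eN * eC) ^+ k * Lg)%:E)%E.
    by rewrite -EFinD; congr EFin; ring.
  apply: leeD; first exact: tree_comparison.
  under eq_integral do rewrite mulrAC.
  rewrite nnintZ //; last 2 first.
  - exact: measurableT_comp.
  - by rewrite mulr_ge0 ?bk0.
  have -> : edge_bound * (eN * eC) ^+ k * Lg =
    (Lg * (tree_bound eN eQ eC * (eN * eC) ^+ k)) * eC by rewrite /edge_bound; ring.
  rewrite [X in (_ <= X)%E]EFinM; apply: lee_wpmul2l => //.
  by rewrite lee_fin mulr_ge0 ?bk0.
have -> : (\int[P]_w (f (limit_rank N0 Q0 Cs Rs w))%:E =
    \int[P]_w \int[P]_w' branch_mean P X f (N0 w) (Q0 w) 1%R)%E.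
  transitivity (\int[P]_w (f (Q0 w + psum X (N0 w) w))%:E)%E.
    by apply: eq_integral => w _; rewrite /limit_rank addrC.
  rewrite (random_index (h := fun _ z => (f (z.1 + z.2))%:E) _ _ _ rX) //.
  - apply: eq_integral => w _; rewrite /= prob_int_cst /branch_mean.
    by under [in RHS]eq_integral do rewrite mul1r.
  - by move=> m; exact: measurable_psum.
  - move=> _; apply/measurable_EFinP; apply: measurableT_comp => //.
    exact: measurable_funD.
  - by move=> _ z; rewrite lee_fin.
have [dZ [Z [pi [m1 [m2 [q1 [q2 [c1 [c2 [[mm1 mq1 mc1] [mm2 mq2 mc2] Ma1 Ma2 [em eq ec]]]]]]]]]]] := close0.
apply: le_trans (branch_comparison mX sX XM mm1 mm2 mq1 mq2 mc1 mc2
  (p := p) p0 (cj := fun=> 1) _ Ma1 Ma2 em eq ec K0 HK0 _ XXi f0 fL) _.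
- by move=> _; rewrite normr1.
- by move=> g g' e; exact: Xi_le.
rewrite lee_fin; apply: lerD.
  rewrite le_eqVlt; apply/orP; left; apply/eqP; apply: eq_bigr => v _.
  congr (_ * _); apply: conv_iter_ext; first by move=> g g'; exact: Xi_ext.
  by move=> s; rewrite mul1r.
rewrite ler_wpM2r ?(lip_ge0 fL) // /root_error !lerD2r ler_wpM2r //.
by rewrite addr_ge0 ?tree_error_ge0 // mulr_ge0 ?edge_bound_ge0 // exprn_ge0.
Qed.

End Root.
End TreeComparison.

(** * From Wasserstein distance to couplings *)

Section Orthants.
Context (R : realType) (m : nat).
Local Notation Rm := (m.-tuple R).

Let orthants : set (set Rm) := range (@lower_orthant R m).

Lemma measurable_orthant (a : Rm) : measurable (lower_orthant a).
Proof.
have -> : lower_orthant a = \bigcap_(i in [set: 'I_m]) [set x | tnth x i <= tnth a i].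
  by apply/seteqP; split => x H i; [move=> _; exact: H|exact: H].
apply: fin_bigcap_measurable => [|i _]; first exact: finite_finset.
have := @measurable_tnth _ R m i measurableT _ (measurable_itv `]-oo, tnth a i]).
by rewrite setTI; congr measurable.
Qed.

Lemma orthants_measurable : measurable = <<s orthants >>.
Proof.
apply/seteqP; split; last first.
  apply: smallest_sub; first exact: sigma_algebra_measurable.
  by move=> _ [a _ <-]; exact: measurable_orthant.
apply: smallest_sub; first exact: smallest_sigma_algebra.
have gen (i : 'I_m) : preimage_set_system setT (fun x : Rm => tnth x i) measurable
    `<=` <<s orthants >>.
  have : measurable_fun setT ((fun x : Rm => tnth x i)
      : g_sigma_algebraType orthants -> R).
    apply: (measurability _ (RGenOInfty.measurableE R)) => _ [_ [a ->] <-].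
    rewrite setTI.
    rewrite (_ : _ @^-1` _ = ~` [set x | tnth x i <= a]); last first.
      apply/seteqP; split => x; rewrite /= in_itv /= andbT ltNge; by move/negP.
    apply: measurableC.
    (* A half-space in coordinate [i] is the increasing union of orthants whose other bounds are
       [k]. *)
    rewrite (_ : [set x | _] = \bigcup_k
      lower_orthant [tuple (if j == i then a else k%:R) | j < m]).
      apply: bigcupT_measurable => k; apply: sub_gen_smallest.
      by exists [tuple (if j == i then a else k%:R) | j < m].
    apply/seteqP; split => x /=.
      move=> xa; exists (Num.truncn (\sum_j `|tnth x j|)).+1 => // j.
      rewrite tnth_mktuple; case: eqP => [-> //|_].
      apply: le_trans (ltW (truncnS_gt _)).
      by rewrite (bigD1 j) //= (le_trans (ler_norm _)) // lerDl sumr_ge0.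
    by move=> [k _ /(_ i)]; rewrite tnth_mktuple eqxx.
  by move=> mi _ [B mB <-]; exact: mi.
move=> A.
elim/big_ind : _ => //.
  by move=> X Y HX HY [/HX|/HY].
by move=> i _; exact: gen.
Qed.

Lemma orthant_unique (mu nu : probability Rm R) :
  (forall a, mu (lower_orthant a) = nu (lower_orthant a)) ->
  forall A, measurable A -> mu A = nu A.
Proof.
move=> E A mA.
apply: (measure_unique orthants (fun k => lower_orthant [tuple k%:R | j < m])) => //.
- exact: orthants_measurable.
- move=> _ _ [a _ <-] [b _ <-].
  exists [tuple Num.min (tnth a i) (tnth b i) | i < m] => //.
  apply/seteqP; split=> x /=.
    by move=> H; split => i; have := H i; rewrite tnth_mktuple le_min => /andP[].
  by move=> [H H'] i; rewrite tnth_mktuple le_min H H'.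
- by move=> k; exists [tuple k%:R | j < m].
- apply/seteqP; split => // x _.
  exists (Num.truncn (\sum_j `|tnth x j|)).+1 => // j.
  rewrite tnth_mktuple; apply: le_trans (ltW (truncnS_gt _)).
  by rewrite (bigD1 j) //= (le_trans (ler_norm _)) // lerDl sumr_ge0.
- by move=> _ [a _ <-]; exact: E.
- by move=> k; rewrite ltey_eq fin_num_measure // -?[_ @^-1` _]setTI; exact: measurable_orthant.
Qed.

End Orthants.

Section DiscreteLaw.
Context d (T : measurableType d) (R : realType) (n : nat).
Variables (p : 'I_n.+1 -> {nonneg R}) (x : 'I_n.+1 -> T).
Hypothesis p1 : \sum_k (p k)%:num = 1.

(** [msum] runs over natural numbers, hence [inord]. *)
Definition discrete_law : set T -> \bar R :=
  msum (fun k => mscale (p (inord k)) \d_(x (inord k))) n.+1.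
HB.instance Definition _ := Measure.on discrete_law.

Lemma discrete_lawE A : discrete_law A = (\sum_k (p k)%:num * (x k \in A)%:R)%:E.
Proof.
rewrite /discrete_law /msum /= -sumEFin; apply: eq_bigr => k _.
rewrite inord_val /mscale /= EFinM; congr (_ * _)%E; exact: diracE.
Qed.

Lemma discrete_lawT : discrete_law setT = 1%E.
Proof.
rewrite discrete_lawE -{2}p1; congr EFin; apply: eq_bigr => k _.
by rewrite in_setT mulr1.
Qed.

Definition discrete_prob : probability T R :=
  HB.pack_for (probability T R) discrete_law
    (Measure_isProbability.Build _ _ _ discrete_law discrete_lawT).

Lemma integral_discrete_law f : measurable_fun setT f -> (forall y, 0 <= f y)%E ->
  (\int[discrete_law]_y f y = \sum_k ((p k)%:num)%:E * f (x k))%E.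
Proof.
move=> mf f0; rewrite /discrete_law ge0_integral_measure_sum //.
apply: eq_bigr => k _; rewrite ge0_integral_mscale // integral_dirac //.
by rewrite inord_val diracT mul1e.
Qed.

End DiscreteLaw.

Lemma measurable_truncn (R : realType) :
  measurable_fun setT (fun x : R => Num.truncn x).
Proof.
have gt n : measurable [set x : R | (n < Num.truncn x)%N].
  rewrite (_ : [set x | _] = `[n.+1%:R, +oo[%classic); first exact: measurable_itv.
  by apply/seteqP; split => x; rewrite /= in_itv /= andbT truncn_gt_nat.
move=> _ B _; rewrite setTI.
rewrite (_ : _ @^-1` B = \bigcup_(n in B) [set x : R | Num.truncn x = n]).
  apply: bigcup_measurable => n _.
  case: n => [|n].
    rewrite (_ : [set x | _] = ~` [set x : R | (0 < Num.truncn x)%N]).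
      exact: measurableC.
    apply/seteqP; split => x /=; first by move=> H; rewrite H.
    by move/negP; rewrite -eqn0Ngt => /eqP.
  rewrite (_ : [set x | _] = [set x : R | (n < Num.truncn x)%N] `\`
      [set x : R | (n.+1 < Num.truncn x)%N]); first exact: measurableD.
  apply/seteqP; split => x /=; first by move=> H; rewrite H ltnSn ltnn.
  by move=> [nx /negP]; rewrite -leqNgt => xn; apply/eqP; rewrite eqn_leq nx xn.
apply/seteqP; split => [x Bx|x [n Bn /= xn]]; first by exists (Num.truncn x).
by rewrite /= xn.
Qed.

Section CloseOfCoupling.
Context (R : realType) (m n : nat) d (T : measurableType d) (P : probability T R).
Local Notation Rm := (m.-tuple R).
Variables (p : 'I_n.+1 -> {nonneg R}) (x : 'I_n.+1 -> Rm).
Hypothesis p1 : \sum_k (p k)%:num = 1.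
Variables (NN : 'I_n.+1 -> nat) (QQ CC : 'I_n.+1 -> R).
Variables (N : T -> nat) (Q C : T -> R) (V : T * T -> Rm).
Hypothesis mV : measurable_fun setT V.
Variables (i0 i1 : 'I_m) (c : Rm -> R).
Hypotheses (mc : measurable_fun setT c)
  (c_lip : forall y z, `|c y - c z| <= l1_dist y z).
Hypotheses (xN : forall k, tnth (x k) i0 = (NN k)%:R)
  (xQ : forall k, tnth (x k) i1 = QQ k) (xC : forall k, c (x k) = CC k).
Hypotheses (VN : forall z, tnth (V z) i0 = (N z.1)%:R)
  (VQ : forall z, tnth (V z) i1 = Q z.1) (VC : forall z, c (V z) = C z.2).
Variables (pi : probability (Rm * Rm)%type R) (eta : R).
Hypotheses
  (pi1 : forall a, pi (fst @^-1` lower_orthant a)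
     = (\sum_k (p k)%:num * (x k \in lower_orthant a)%:R)%:E)
  (pi2 : forall a, pi (snd @^-1` lower_orthant a)
     = (P \x P)%E (V @^-1` lower_orthant a))
  (pi_eta : (\int[pi]_z (l1_dist z.1 z.2)%:E <= eta%:E)%E).

Lemma coupling_marginal (h : Rm * Rm -> Rm) (nu : probability Rm R) :
  measurable_fun setT h ->
  (forall a, pi (h @^-1` lower_orthant a) = nu (lower_orthant a)) ->
  forall f, measurable_fun setT f -> (forall y, 0 <= f y)%E ->
  (\int[pi]_z f (h z) = \int[nu]_y f y)%E.
Proof.
move=> mh E f mf f0.
pose h' := HB.pack_for {mfun (Rm * Rm)%type >-> Rm} h
  (isMeasurableFun.Build _ _ _ _ h mh).
transitivity (\int[distribution pi h']_y f y)%E.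
  by rewrite ge0_integral_distribution.
apply: eq_measure_integral => A mA _.
exact: (orthant_unique (mu := distribution pi h')).
Qed.

Lemma coupling_fst f : measurable_fun setT f -> (forall y, 0 <= f y)%E ->
  (\int[pi]_z f z.1 = \sum_k ((p k)%:num)%:E * f (x k))%E.
Proof.
move=> mf f0; rewrite -(integral_discrete_law p x mf f0).
have E a : pi (fst @^-1` lower_orthant a) = discrete_prob x p1 (lower_orthant a).
  by rewrite pi1 /= discrete_lawE.
rewrite (coupling_marginal measurable_fst E mf f0).
exact: eq_measure_integral.
Qed.

Lemma coupling_snd f : measurable_fun setT f -> (forall y, 0 <= f y)%E ->
  (\int[pi]_z f z.2 = \int[P]_w \int[P]_w' f (V (w, w')))%E.
Proof.
move=> mf f0.
pose V' := HB.pack_for {mfun (T * T)%type >-> Rm} V (isMeasurableFun.Build _ _ _ _ V mV).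
have E a : pi (snd @^-1` lower_orthant a) =
    distribution (P \x P)%E V' (lower_orthant a) by rewrite pi2.
rewrite (coupling_marginal measurable_snd E) // ge0_integral_distribution //.
rewrite fubini_tonelli1 //; last by move=> z; exact: f0.
exact: measurableT_comp.
Qed.

Let good : set Rm := [set y | tnth y i0 == (Num.truncn (tnth y i0))%:R].

Let mtn (i : 'I_m) : measurable_fun setT (fun y : Rm => tnth y i).
Proof. exact: measurable_tnth. Qed.

Let mtr : measurable_fun setT (fun y : Rm => Num.truncn (tnth y i0)).
Proof. by apply: measurableT_comp; [exact: measurable_truncn|exact: mtn]. Qed.

Lemma measurable_good : measurable good.
Proof.
have : measurable_fun setT (fun y : Rm => tnth y i0 == (Num.truncn (tnth y i0))%:R).
  by apply: measurable_fun_eqr => //; exact: measurableT_comp.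
by move=> /(_ measurableT [set true]); rewrite preimage_true setTI; apply.
Qed.

Let mbad : measurable_fun setT (fun y => (\1_(~` good) y)%:E : \bar R).
Proof.
apply/measurable_EFinP; apply: measurable_indic; apply: measurableC.
exact: measurable_good.
Qed.

(** The coupling lives on real tuples, but both marginals have an integer in-degree coordinate.
    Almost everywhere [truncn] is therefore exact, and the distance of the recovered integers is at
    most the [l1] distance. *)
Lemma coupling_good : {ae pi, forall z, good z.1 /\ good z.2}.
Proof.
have ae_good (h : Rm * Rm -> Rm) : measurable_fun setT h ->
    (\int[pi]_z (\1_(~` good) (h z))%:E = 0)%E -> {ae pi, forall z, good (h z)}.
  move=> mh I0; exists (h @^-1` (~` good)); split => //.
    by rewrite -[X in measurable X]setTI; apply: mh => //; apply: measurableC; exact: measurable_good.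
  rewrite -I0 -[RHS](_ : \int[pi]_z (\1_(h @^-1` (~` good)) z)%:E = _)%E.
    rewrite integral_indic ?setIT //.
    by rewrite -[X in measurable X]setTI; apply: mh => //; apply: measurableC; exact: measurable_good.
  by apply: eq_integral.
apply: filterS2; [|apply: (ae_good fst)|apply: (ae_good snd)] => //.
- rewrite (coupling_fst mbad); last by move=> y; rewrite lee_fin.
  rewrite big1 // => k _; rewrite indicE memNset ?mule0 // /good /= => H; apply: H.
  by rewrite xN natrK.
- rewrite (coupling_snd mbad); last by move=> y; rewrite lee_fin.
  rewrite integral0_eq // => w _; rewrite integral0_eq // => w' _.
  rewrite indicE memNset // /good /= => H; apply: H.
  by rewrite VN natrK.
Qed.

Lemma l1_dist_coord (y z : Rm) i : `|tnth y i - tnth z i| <= l1_dist y z.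
Proof. by rewrite /l1_dist (bigD1 i) //= lerDl sumr_ge0. Qed.

Lemma measurable_l1_dist : measurable_fun setT (fun z : Rm * Rm => l1_dist z.1 z.2).
Proof.
apply: measurable_sum => i; apply: measurableT_comp => //.
by apply: measurable_funB; [exact: (measurableT_comp (mtn i) measurable_fst)|
  exact: (measurableT_comp (mtn i) measurable_snd)].
Qed.

(** Pairs and triples are treated together: [c] reads the third coordinate of a triple and is
    constantly 1 on pairs. [V] is defined on [T * T] so that [(N, Q)] and [C] come from independent
    coordinates. *)
Lemma close_of_coupling :
  close_laws eta (fun k => (p k)%:num) NN QQ CC P N Q C.
Proof.
have ml : measurable_fun setT (fun z : Rm * Rm => (l1_dist z.1 z.2)%:E).
  by apply/measurable_EFinP; exact: measurable_l1_dist.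
pose dec (y : Rm) := (Num.truncn (tnth y i0), tnth y i1, c y).
have mdec : measurable_fun setT dec.
  by apply: measurable_fun_pair => //; apply: measurable_fun_pair.
exists _, _, pi, (fun z => Num.truncn (tnth z.1 i0)), (fun z => Num.truncn (tnth z.2 i0)),
  (fun z => tnth z.1 i1), (fun z => tnth z.2 i1), (fun z => c z.1), (fun z => c z.2).
split.
- by split; [exact: (measurableT_comp mtr measurable_fst)|
    exact: (measurableT_comp (mtn i1) measurable_fst)|
    exact: (measurableT_comp mc measurable_fst)].
- by split; [exact: (measurableT_comp mtr measurable_snd)|
    exact: (measurableT_comp (mtn i1) measurable_snd)|
    exact: (measurableT_comp mc measurable_snd)].
- move=> Phi mPhi Phi0.
  rewrite (coupling_fst (measurableT_comp mPhi mdec) (fun y => Phi0 (dec y))).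
  by apply: eq_bigr => k _; rewrite /dec /= xN xQ xC natrK.
- move=> Phi mPhi Phi0.
  rewrite (coupling_snd (measurableT_comp mPhi mdec) (fun y => Phi0 (dec y))).
  apply: eq_integral => w _; apply: eq_integral => w' _.
  by rewrite /dec /= VN VQ VC natrK.
have mn (h : Rm * Rm -> Rm) : measurable_fun setT h ->
    measurable_fun setT (fun z => (Num.truncn (tnth (h z) i0))%:R : R).
  by move=> mh; apply: (measurableT_comp _ (measurableT_comp mtr mh)).
split; apply: le_trans pi_eta.
- apply: ae_ge0_le_integral => //.
  + apply/measurable_EFinP; apply: measurableT_comp => //.
    by apply: measurable_funB; [exact: (mn fst)|exact: (mn snd)].
  + by move=> z _; rewrite lee_fin sumr_ge0.
  + apply: filterS coupling_good => z [/eqP g1 /eqP g2] _.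
    by rewrite -g1 -g2 lee_fin l1_dist_coord.
- apply: ge0_le_integral => //.
  + apply/measurable_EFinP; apply: measurableT_comp => //.
    by apply: measurable_funB; [exact: (measurableT_comp (mtn i1) measurable_fst)|
      exact: (measurableT_comp (mtn i1) measurable_snd)].
  + by move=> z _; rewrite lee_fin l1_dist_coord.
- apply: ge0_le_integral => //.
  + apply/measurable_EFinP; apply: measurableT_comp => //.
    by apply: measurable_funB; [exact: (measurableT_comp mc measurable_fst)|
      exact: (measurableT_comp mc measurable_snd)].
  + by move=> z _; rewrite lee_fin c_lip.
Qed.

End CloseOfCoupling.

Section CloseFromDistance.
Context (R : realType) (n : nat) d (T : measurableType d) (P : probability T R).
Variables (NN : 'I_n.+1 -> nat) (QQ CC : 'I_n.+1 -> R).

(** The infimum in [d1] need not be attained, so the strict inequality is what yields a coupling. *)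
Lemma d1_coupling m (F G : m.-tuple R -> \bar R) (eta : R) :
  (d1 F G < eta%:E)%E -> exists pi : probability (m.-tuple R * m.-tuple R)%type R,
    [/\ forall a, pi (fst @^-1` lower_orthant a) = F a,
        forall a, pi (snd @^-1` lower_orthant a) = G a
      & (\int[pi]_z (l1_dist z.1 z.2)%:E <= eta%:E)%E].
Proof.
move=> /ereal_inf_lt[_ [pi [H1 H2] <-] lt]; exists pi; split => //.
exact: ltW.
Qed.

Lemma close_empirical (N0 : {RV P >-> nat}) (Q0 : {RV P >-> R}) (eta : R) :
  (d1 (fun v : 2.-tuple R => (n.+1%:R^-1 *
        \sum_k (((NN k)%:R <= v`_0) && (QQ k <= v`_1))%:R)%R%:E)
      (fun v : 2.-tuple R => P [set w | (N0 w)%:R <= v`_0 /\ Q0 w <= v`_1]%R)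
    < eta%:E)%E ->
  close_laws eta (fun=> n.+1%:R^-1) NN QQ (fun=> 1) P N0 Q0 (fun=> 1).
Proof.
move=> /d1_coupling[pi [H1 H2 Heta]].
have n0 : 0 <= n.+1%:R^-1 :> R by rewrite invr_ge0.
pose i1 : 'I_2 := lift ord0 ord0.
pose x k := [tuple (NN k)%:R; QQ k] : 2.-tuple R.
pose V (z : T * T) := [tuple (N0 z.1)%:R; Q0 z.1] : 2.-tuple R.
have orth (y : R * R) (a : 2.-tuple R) : lower_orthant a [tuple y.1; y.2]
    <-> y.1 <= a`_0 /\ y.2 <= a`_1.
  split=> [H|[h0 h1] [[|[|]] // i]].
    by have := H ord0; have := H i1; rewrite !(tnth_nth 0).
  - by rewrite !(tnth_nth 0).
  - by rewrite !(tnth_nth 0).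
have mV : measurable_fun setT V.
  apply/measurable_fun_tnthP => -[[|[|]] // i].
  - rewrite (_ : _ \o _ = (fun z : T * T => (N0 z.1)%:R)); last first.
      by apply/funext => z /=; rewrite (tnth_nth 0).
    by do 2 apply: measurableT_comp => //.
  - rewrite (_ : _ \o _ = (fun z : T * T => Q0 z.1)); last first.
      by apply/funext => z /=; rewrite (tnth_nth 0).
    exact: measurableT_comp.
apply: (@close_of_coupling R 2 n _ T P (fun=> NngNum n0) x _ NN QQ (fun=> 1) N0 Q0
  (fun=> 1) V mV ord0 i1 (fun=> 1) _ _ _ _ _ _ _ _ pi eta _ _ Heta) => //.
- by rewrite /= sumr_const card_ord -[_ *+ _]mulr_natr mulVf.
- by move=> y z; rewrite subrr normr0 sumr_ge0.
- by move=> a; rewrite H1 mulr_sumr; congr EFin; apply: eq_bigr => k _;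
    congr (_ * _%:R); congr nat_of_bool; apply/idP/idP;
    rewrite inE (orth ((NN k)%:R, QQ k)) /=; move/andP.
- move=> a; rewrite H2.
  have -> : V @^-1` lower_orthant a =
      [set w | (N0 w)%:R <= a`_0 /\ Q0 w <= a`_1] `*` setT.
    apply/seteqP; split => z.
      by move=> /(orth ((N0 z.1)%:R, Q0 z.1)).
    by move=> [H _]; apply/(orth ((N0 z.1)%:R, Q0 z.1)).
  rewrite product_measure1E //=; first by rewrite probability_setT mule1.
  have -> : [set w | (N0 w)%:R <= a`_0 /\ Q0 w <= a`_1] =
    (fun w => (N0 w)%:R : R) @^-1` `]-oo, a`_0] `&` Q0 @^-1` `]-oo, a`_1].
    by apply/seteqP; split => w; rewrite /= !in_itv.
  apply: measurableI; rewrite -[X in measurable X]setTI.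
    have mN : measurable_fun setT (fun w => (N0 w)%:R : R) by exact: measurableT_comp.
    exact: mN.
  exact: (measurable_funP Q0).
Qed.

Lemma close_biased (DD : 'I_n.+1 -> nat) (N : {RV P >-> nat}) (Q C : {RV P >-> R})
    (eta : R) : (0 < \sum_k DD k)%N ->
  (d1 (fun v : 3.-tuple R => (\sum_k [&& (NN k)%:R <= v`_0, QQ k <= v`_1
            & CC k <= v`_2]%:R * ((DD k)%:R / (\sum_k DD k)%:R))%:E)
      (fun v : 3.-tuple R => P [set w | (N w)%:R <= v`_0 /\ Q w <= v`_1]%R
         * P [set w | C w <= v`_2]%R)%E
    < eta%:E)%E ->
  close_laws eta (fun k => (DD k)%:R / (\sum_k DD k)%:R) NN QQ CC P N Q C.
Proof.
move=> L0 /d1_coupling[pi [H1 H2 Heta]].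
have n0 k : 0 <= (DD k)%:R / (\sum_k DD k)%:R :> R by rewrite divr_ge0.
pose i1 : 'I_3 := lift ord0 ord0.
pose i2 : 'I_3 := lift ord0 (lift ord0 ord0).
pose x k := [tuple (NN k)%:R; QQ k; CC k] : 3.-tuple R.
pose V (z : T * T) := [tuple (N z.1)%:R; Q z.1; C z.2] : 3.-tuple R.
have orth (y : R * R * R) (a : 3.-tuple R) :
   lower_orthant a [tuple y.1.1; y.1.2; y.2]
    <-> [/\ y.1.1 <= a`_0, y.1.2 <= a`_1 & y.2 <= a`_2].
  split=> [H|[h0 h1 h2] [[|[|[|]]] // i]].
    by have := H ord0; have := H i1; have := H i2; rewrite !(tnth_nth 0).
  - by rewrite !(tnth_nth 0).
  - by rewrite !(tnth_nth 0).
  - by rewrite !(tnth_nth 0).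
have mV : measurable_fun setT V.
  apply/measurable_fun_tnthP => -[[|[|[|]]] // i].
  - rewrite (_ : _ \o _ = (fun z : T * T => (N z.1)%:R)); last first.
      by apply/funext => z /=; rewrite (tnth_nth 0).
    by do 2 apply: measurableT_comp => //.
  - rewrite (_ : _ \o _ = (fun z : T * T => Q z.1)); last first.
      by apply/funext => z /=; rewrite (tnth_nth 0).
    exact: measurableT_comp.
  - rewrite (_ : _ \o _ = (fun z : T * T => C z.2)); last first.
      by apply/funext => z /=; rewrite (tnth_nth 0).
    exact: measurableT_comp.
apply: (@close_of_coupling R 3 n _ T P (fun k => NngNum (n0 k)) x _ NN QQ CC N Q
  C V mV ord0 i1 (fun y => tnth y i2) _ _ _ _ _ _ _ _ pi eta _ _ Heta) => //.
- by rewrite /= -mulr_suml natr_sum mulfV // -natr_sum pnatr_eq0 -lt0n.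
- exact: measurable_tnth.
- by move=> y z; exact: l1_dist_coord.
- move=> a; rewrite H1; congr EFin; apply: eq_bigr => k _; rewrite mulrC.
  congr (_ * _%:R); congr nat_of_bool; apply/idP/idP;
  by rewrite inE (orth ((NN k)%:R, QQ k, CC k)) /=; move/and3P.
- move=> a; rewrite H2.
  have -> : V @^-1` lower_orthant a =
      [set w | (N w)%:R <= a`_0 /\ Q w <= a`_1] `*` [set w | C w <= a`_2].
    apply/seteqP; split => z.
      by move=> /(orth ((N z.1)%:R, Q z.1, C z.2)) [].
    by move=> [[? ?] ?]; apply/(orth ((N z.1)%:R, Q z.1, C z.2)).
  rewrite product_measure1E //.
  - have -> : [set w | (N w)%:R <= a`_0 /\ Q w <= a`_1] =
      (fun w => (N w)%:R : R) @^-1` `]-oo, a`_0] `&` Q @^-1` `]-oo, a`_1].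
      by apply/seteqP; split => w; rewrite /= !in_itv.
    apply: measurableI; rewrite -[X in measurable X]setTI.
      have mN : measurable_fun setT (fun w => (N w)%:R : R) by exact: measurableT_comp.
      exact: mN.
    exact: (measurable_funP Q).
  - have -> : [set w | C w <= a`_2] = C @^-1` `]-oo, a`_2].
      by apply/seteqP; split => w; rewrite /= !in_itv.
    by rewrite -[X in measurable X]setTI; exact: (measurable_funP C).
Qed.

(** A uniform outbound stub has owner [k] with probability [D_k / L]. This turns the size-biased law
    of the assumption into the uniform average over stubs from which [Xi] is built. *)
Lemma close_stubs L (own : 'I_L -> 'I_n.+1) (DD : 'I_n.+1 -> nat)
    (N : T -> nat) (Q C : T -> R) (eta : R) :
  (forall v, \sum_(y : 'I_L | own y == v) 1 = DD v)%N ->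
  close_laws eta (fun k => (DD k)%:R / L%:R) NN QQ CC P N Q C ->
  close_laws eta (fun _ : 'I_L => L%:R^-1) (fun y => NN (own y))
    (fun y => QQ (own y)) (fun y => CC (own y)) P N Q C.
Proof.
move=> ownE [dZ [Z [pi [m1 [m2 [q1 [q2 [c1 [c2 [M1 M2 Ma1 Ma2 Me]]]]]]]]]].
exists dZ, Z, pi, m1, m2, q1, q2, c1, c2; split => // Phi mPhi Phi0.
rewrite Ma1 // [RHS](partition_big own xpredT) //=; apply: eq_bigr => v _.
rewrite (eq_bigr (fun=> (L%:R^-1)%:E * Phi (NN v, QQ v, CC v))%E); last first.
  by move=> y /eqP ->.
rewrite -(ownE v) natr_sum mulr_suml -sumEFin.
rewrite ge0_sume_distrl; last by move=> y _; rewrite lee_fin mulr_ge0 ?invr_ge0.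
by apply: eq_bigr => y _; rewrite mul1r.
Qed.

End CloseFromDistance.

(** * Stubs, pairings and the rank vector *)

Section StubEnumeration.
Variables (n : nat) (a : 'I_n.+1 -> nat) (L : nat).
Hypothesis aL : (\sum_i a i = L)%N.

Definition stub_seq : seq ('I_n.+1 * nat) :=
  [seq (i, l) | i <- enum 'I_n.+1, l <- iota 0 (a i)].

Lemma size_stub_seq : size stub_seq = L.
Proof.
rewrite size_allpairs_dep sumnE big_map -aL big_enum /=.
by apply: eq_bigr => i _; rewrite size_iota.
Qed.

Lemma mem_stub_seq x : (x \in stub_seq) = (x.2 < a x.1)%N.
Proof.
case: x => i l; apply/allpairsPdep/idP => [[j [m [_]]]|la] /=.
  by rewrite mem_iota add0n => /= ma [-> ->].
by exists i, l; rewrite mem_enum mem_iota add0n.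
Qed.

Lemma uniq_stub_seq : uniq stub_seq.
Proof.
apply: allpairs_uniq_dep; first exact: enum_uniq.
- by move=> i _; exact: iota_uniq.
- by move=> [i l] [j m] _ _ [-> ->].
Qed.

Definition stub (y : 'I_L) : 'I_n.+1 * nat := nth (ord0, 0%N) stub_seq y.

Lemma stubP y : ((stub y).2 < a (stub y).1)%N.
Proof. by rewrite -mem_stub_seq mem_nth // size_stub_seq. Qed.

Lemma stub_inj : injective stub.
Proof.
move=> x y /eqP; rewrite nth_uniq ?uniq_stub_seq ?size_stub_seq // => /eqP.
exact: val_inj.
Qed.

Lemma stub_surj x : (x.2 < a x.1)%N -> exists y, stub y = x.
Proof.
rewrite -mem_stub_seq => xs.
have xL : (index x stub_seq < L)%N by rewrite -size_stub_seq index_mem.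
by exists (Ordinal xL); rewrite /stub nth_index.
Qed.

Lemma sum_stubs (R : nmodType) (F : 'I_n.+1 -> nat -> R) :
  \sum_(y : 'I_L) F (stub y).1 (stub y).2 = \sum_i \sum_(l < a i) F i l.
Proof.
transitivity (\sum_(x <- stub_seq) F x.1 x.2).
  by rewrite (big_nth (ord0, 0%N)) size_stub_seq big_mkord.
rewrite big_allpairs_dep /= big_enum /=; apply: eq_bigr => i _.
by rewrite -[X in iota _ X]subn0 -/(index_iota _ _) big_mkord.
Qed.

Hypothesis L0 : (0 < L)%N.

Definition stub_rank (v : 'I_n.+1) (l : nat) : 'I_L :=
  odflt (Ordinal L0) [pick y | stub y == (v, l)].

Lemma stub_rankK v l : (l < a v)%N -> stub (stub_rank v l) = (v, l).
Proof.
move=> lv; rewrite /stub_rank; case: pickP => [y /eqP //|no].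
by have [y yE] := @stub_surj (v, l) lv; have := no y; rewrite yE eqxx.
Qed.

Lemma stub_rankE y : stub_rank (stub y).1 (stub y).2 = y.
Proof. by apply: stub_inj; rewrite stub_rankK ?stubP // -surjective_pairing. Qed.

Lemma stub_rank_inj u u' l l' : (l < a u)%N -> (l' < a u')%N ->
  stub_rank u l = stub_rank u' l' -> u = u' /\ l = l'.
Proof. by move=> lu lu' /(congr1 stub); rewrite !stub_rankK // => -[-> ->]. Qed.

Lemma stub_owner_count v : (\sum_(y : 'I_L | (stub y).1 == v) 1 = a v)%N.
Proof.
rewrite big_mkcond /= (sum_stubs (fun i _ => if i == v then 1%N else 0%N)).
rewrite (bigD1 v) //= eqxx sum_nat_const card_ord muln1.
rewrite [X in (_ + X)%R]big1 ?addr0 // => i /negbTE iv.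
by rewrite big1 // => l _; rewrite iv.
Qed.

End StubEnumeration.

(** * The rank vector of a fixed pairing *)

Section RankVector.
Variables (R : realType) (n : nat) (nn dd : 'I_n.+1 -> nat) (L : nat).
Hypotheses (nnL : (\sum_i nn i = L)%N) (ddL : (\sum_i dd i = L)%N) (L0 : (0 < L)%N).
Variables (CC QQ : 'I_n.+1 -> R).

Definition owner (y : 'I_L) : 'I_n.+1 := (stub dd y).1.
Definition in_rank := stub_rank nn L0.
Local Notation rk := (tree_rank owner nn CC QQ in_rank).

(* The permutation sends an inbound stub to the outbound stub paired with it. *)
Definition pairing_of (s : 'S_L) (x : 'I_n.+1 * nat) : 'I_n.+1 * nat :=
  stub nn ((s^-1)%g (stub_rank dd L0 x.1 x.2)).

Lemma pairing_of_bij s : set_bij (stubs dd) (stubs nn) (pairing_of s).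
Proof.
split.
- by move=> x _; exact: stubP.
- move=> x y /set_mem xd /set_mem yd /(stub_inj nnL) /perm_inj.
  move=> /(stub_rank_inj ddL) []// e1 e2.
  by rewrite [x]surjective_pairing [y]surjective_pairing e1 e2.
- move=> x xn; have [z zE] := stub_surj nnL xn.
  exists (stub dd (s z)); first exact: stubP.
  by rewrite /pairing_of stub_rankE // permK.
Qed.

Lemma pairing_of_inj s s' :
  (forall x, stubs dd x -> pairing_of s x = pairing_of s' x) -> s = s'.
Proof.
move=> H; suff E : (s^-1)%g = (s'^-1)%g by rewrite -[s]invgK E invgK.
apply/permP => y; have := H (stub dd y) (stubP ddL y).
by rewrite /pairing_of stub_rankE // => /(stub_inj nnL).
Qed.

Lemma pairing_of_surj f : set_bij (stubs dd) (stubs nn) f ->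
  exists s, forall x, stubs dd x -> f x = pairing_of s x.
Proof.
move=> [f1 f2 _].
pose g (y : 'I_L) := in_rank (f (stub dd y)).1 (f (stub dd y)).2.
have gE y : stub nn (g y) = f (stub dd y).
  rewrite /g stub_rankK //; first by rewrite -surjective_pairing.
  exact: (f1 _ (stubP ddL y)).
have gi : injective g.
  move=> y y' e; apply: (stub_inj ddL); apply: f2; try exact/mem_set/stubP.
  by rewrite -!gE e.
exists (perm gi)^-1%g => x xd.
by rewrite /pairing_of invgK permE gE stub_rankK // -surjective_pairing.
Qed.

(** Passes from the inbound stubs of [v], which the exploration follows, to the outbound stubs
    paired with [v], which the rank matrix counts. *)
Lemma tree_rankS s k v : rk s k.+1 v = QQ v +
  \sum_i \sum_(l < dd i | (pairing_of s (i, val l)).1 == v) CC i * rk s k i.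
Proof.
rewrite /=; congr (_ + _).
pose F y := CC (owner y) * rk s k (owner y).
transitivity (\sum_(x : 'I_L | (stub nn x).1 == v) F (s x)).
  rewrite [RHS]big_mkcond /=.
  pose F' i l := if i == v then F (s (in_rank i l)) else 0.
  transitivity (\sum_(x : 'I_L) F' (stub nn x).1 (stub nn x).2); last first.
    by apply: eq_bigr => x _; rewrite /F' /in_rank stub_rankE.
  rewrite sum_stubs // (bigD1 v) //= [X in _ = _ + X]big1 ?addr0.
    by apply: eq_bigr => l _; rewrite /F' eqxx.
  by move=> i /negbTE iv; rewrite big1 // => l _; rewrite /F' iv.
(* Reindexing by the inverse makes the summation variable the outbound stub. *)
rewrite (reindex_inj (perm_inj (s := (s^-1)%g))) /=.
under eq_bigr do rewrite permKV.
rewrite [LHS]big_mkcond /=.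
pose F' i l := if (pairing_of s (i, l)).1 == v then CC i * rk s k i else 0.
transitivity (\sum_(y : 'I_L) F' (stub dd y).1 (stub dd y).2).
  by apply: eq_bigr => y _; rewrite /F' /pairing_of stub_rankE.
by rewrite sum_stubs //; apply: eq_bigr => i _; rewrite [RHS]big_mkcond.
Qed.

Lemma mx_rankE (M : 'M[R]_n.+1) s k :
  (forall i j, M i j =
     (\sum_(l < dd i) ((pairing_of s (i, val l)).1 == j))%:R * CC i) ->
  \sum_(0 <= t < k) (\row_i QQ i *m M ^+ t) = \row_v rk s k v.
Proof.
move=> ME; elim: k => [|k IH].
  by rewrite big_nil; apply/rowP => v; rewrite !mxE.
rewrite big_nat_recl // expr0 mulmx1.
under eq_bigr do rewrite exprSr mulmxA.
rewrite -mulmx_suml IH; apply/rowP => v; rewrite [RHS]mxE tree_rankS [LHS]mxE [X in X + _]mxE.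
congr (_ + _); rewrite mxE; apply: eq_bigr => i _; rewrite mxE ME.
rewrite [RHS]big_mkcond /= natr_sum mulr_suml mulr_sumr.
by apply: eq_bigr => l _; case: (_ == v) => /=; ring.
Qed.

Variable c : R.
Hypotheses (c0 : 0 < c) (c1 : c < 1).
Hypothesis Cc : forall r, `|CC r| * (dd r)%:R <= c.

Definition rank_diff s k v := rk s k.+1 v - rk s k v.

Lemma rank_diff_sum s k v : \sum_(t < k) rank_diff s t v = rk s k v.
Proof.
elim: k => [|k IH]; first by rewrite big_ord0.
by rewrite big_ord_recr /= IH /rank_diff addrC subrK.
Qed.

(** Every outbound stub of [i] feeds exactly one node, so summing over nodes multiplies the entry of
    [i] by at most [|C_i| D_i <= c], whatever the pairing. *)
Lemma rank_diff_norm s k :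
  \sum_v `|rank_diff s k v| <= c ^+ k * \sum_v `|QQ v|.
Proof.
elim: k => [|k IH].
  rewrite expr0 mul1r; apply: ler_sum => v _; rewrite /rank_diff subr0 tree_rankS.
  rewrite [X in _ + X]big1 ?addr0 // => i _; rewrite big1 // => l _.
  by rewrite mulr0.
apply: (@le_trans _ _ (c * \sum_v `|rank_diff s k v|)); last first.
  by rewrite exprS -mulrA ler_wpM2l // ltW.
pose F' v i l := if (pairing_of s (i, l)).1 == v then CC i * rank_diff s k i else 0.
have E v : rank_diff s k.+1 v = \sum_i \sum_(l < dd i) F' v i l.
  rewrite /rank_diff !(tree_rankS s _ v) opprD addrACA subrr add0r -sumrB; apply: eq_bigr => i _.
  rewrite -big_mkcond -sumrB; apply: eq_bigr => l _.
  by rewrite -mulrBr.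
apply: (@le_trans _ _ (\sum_v \sum_i \sum_(l < dd i) `|F' v i l|)).
  apply: ler_sum => v _; rewrite E; apply: le_trans (ler_norm_sum _ _ _) _.
  by apply: ler_sum => i _; exact: ler_norm_sum.
rewrite exchange_big /= mulr_sumr; apply: ler_sum => i _.
rewrite exchange_big /=.
rewrite (eq_bigr (fun=> `|CC i| * `|rank_diff s k i|)); last first.
  move=> l _; rewrite (bigD1 (pairing_of s (i, val l)).1) //= /F' eqxx normrM.
  rewrite big1 ?addr0 // => j; rewrite eq_sym => /negbTE ->.
  exact: normr0.
rewrite sumr_const card_ord -[_ *+ _]mulr_natr mulrAC.
by rewrite ler_wpM2r.
Qed.

Lemma rank_diff_le s k v : `|rank_diff s k v| <= c ^+ k * \sum_v `|QQ v|.
Proof.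
by apply: le_trans (rank_diff_norm s k); rewrite (bigD1 v) //= lerDl sumr_ge0.
Qed.

Definition full_rank s v := limn (fun k => rk s k v).

Lemma full_rankE s v : full_rank s v = limn (series (fun t => rank_diff s t v)).
Proof.
congr (lim (_ @ \oo)); apply/funext => k.
by rewrite /series /= big_mkord rank_diff_sum.
Qed.

Lemma is_cvg_rank s v : cvgn (fun k => rk s k v).
Proof.
have -> : (fun k => rk s k v) = series (fun t => rank_diff s t v).
  by apply/funext => k; rewrite /series /= big_mkord rank_diff_sum.
apply: normed_cvg.
apply: (series_le_cvg (v_ := geometric (\sum_v `|QQ v|) c)) => [t|t|t|].
- exact: normr_ge0.
- by rewrite /geometric /= mulr_ge0 ?sumr_ge0 ?exprn_ge0 ?ltW.
- by rewrite /geometric /= mulrC rank_diff_le.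
- by apply: is_cvg_geometric_series; rewrite ger0_norm // ltW.
Qed.

Lemma full_rank_tail s k :
  \sum_v `|full_rank s v - rk s k v| <= c ^+ k / (1 - c) * \sum_v `|QQ v|.
Proof.
rewrite -lee_fin -sumEFin.
apply: (@le_trans _ _ (\sum_v \sum_(0 <= t <oo) (`|rank_diff s (k + t)%N v|)%:E)%E).
  apply: lee_sum => v _; rewrite full_rankE -rank_diff_sum.
  exact: (abs_series_tail (a := fun t => `|rank_diff s t v|)).
rewrite -nneseries_sum; last by move=> v t _; rewrite lee_fin.
apply: nneseries_le_fin => [t|m].
  by apply: sume_ge0 => v _; rewrite lee_fin.
apply: (@le_trans _ _ (\sum_(0 <= t < m) (c ^+ (k + t) * \sum_v `|QQ v|)%:E)%E).
  by apply: lee_sum => t _; rewrite sumEFin lee_fin rank_diff_norm.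
rewrite sumEFin lee_fin -mulr_suml ler_wpM2r ?sumr_ge0 // big_mkord.
under eq_bigr do rewrite exprD.
rewrite -mulr_sumr ler_wpM2l ?exprn_ge0 ?(ltW c0) //.
by apply: geometric_sum_le; rewrite c1 ltW.
Qed.

End RankVector.

(** * Integration over the configuration model *)

Section LowerIntegral.
Context d (T : measurableType d) (R : realType).

Lemma ge0_integral_minorant (mu : {measure set T -> \bar R}) (f g : T -> \bar R) :
  (forall x, 0 <= g x)%E -> (forall x, g x <= f x)%E ->
  (\int[mu]_x g x <= \int[mu]_x f x)%E.
Proof.
move=> g0 gf; have f0 x : (0 <= f x)%E := le_trans (g0 x) (gf x).
rewrite !ge0_integralTE //; apply: ereal_sup_le => _ /= [u ug <-].
by exists u => // x; exact: le_trans (ug x) (gf x).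
Qed.

Lemma ge0_integral_mrestr (mu : {measure set T -> \bar R}) (B : set T)
    (mB : measurable B) (f : T -> \bar R) :
  measurable_fun setT f -> (forall x, 0 <= f x)%E ->
  (\int[mrestr mu mB]_x f x = \int[mu]_(x in B) f x)%E.
Proof.
move=> mf f0; rewrite -(setUv B) ge0_integral_setU //=; last 3 first.
- exact: measurableC.
- by rewrite setUv.
- by apply/disj_setPCl.
rewrite (@eq_measure_integral _ _ _ B mu); last first.
  by move=> A mA AB; rewrite /= /mrestr setIidl.
rewrite (@eq_measure_integral _ _ _ (~` B) mzero); last first.
  by move=> A mA AB; rewrite /= /mrestr ((disjoints_subset A B).2 AB) measure0.
by rewrite integral_measure_zero adde0.
Qed.

End LowerIntegral.

Section ConditionalIntegral.
Context d (T : measurableType d) (R : realType) (P : probability T R).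
Variables (GG : set (set T)) (Om B : set T) (p : {nonneg R}).
Hypotheses (GGm : GG `<=` measurable) (mOm : measurable Om)
  (mOB : measurable (Om `&` B)).
Hypothesis OmB : forall A, <<s GG >> A ->
  P (A `&` (Om `&` B)) = (P (A `&` Om) * p%:num%:E)%E.

(** On [Om], the event [B] has conditional probability [p] given the sigma-algebra of [GG].
    Restricted to that sigma-algebra, the two measures differ by the factor [p], and [f] sees
    nothing finer. *)
Lemma conditional_integral (f : T -> \bar R) :
  measurable_fun setT (f : g_sigma_algebraType GG -> \bar R) ->
  (forall x, 0 <= f x)%E ->
  (\int[P]_(x in Om `&` B) f x = p%:num%:E * \int[P]_(x in Om) f x)%E.
Proof.
move=> mf f0; have mf' := measurable_of_gsigma GGm mf.
pose Te := g_sigma_algebraType GG.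
(* The identity onto the coarser measurable space; pushing forward along it restricts a measure to
   [GG]. *)
have mid : measurable_fun setT (idfun : T -> Te).
  move=> _ A mA; rewrite setTI preimage_id.
  by move: A mA; apply: smallest_sub => //; exact: sigma_algebra_measurable.
rewrite -(ge0_integral_mrestr P mOm) // -(ge0_integral_mrestr P mOB) //.
have H1 := ge0_integral_pushforward mid (mrestr P mOB) measurableT mf
  (fun x _ => f0 x).
have H2 := ge0_integral_pushforward mid (mrestr P mOm) measurableT mf
  (fun x _ => f0 x).
etransitivity; first exact: (esym H1).
have {}H2 := H2 : (_ = \int[mrestr P mOm]_x f x)%E.
rewrite -H2 -ge0_integral_mscale //; apply: eq_measure_integral => A mA _.
by rewrite /mscale /= /pushforward /mrestr /= preimage_id OmB // muleC.
Qed.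

End ConditionalIntegral.

Lemma row_cvg (R : realType) n (u : nat -> 'rV[R]_n.+1) (l : 'rV[R]_n.+1) :
  (forall v, u k ord0 v @[k --> \oo] --> l ord0 v) -> u @ \oo --> l.
Proof.
move=> H; apply/cvgrPdist_le => e e0.
have H' : \forall k \near \oo, forall v : 'I_n.+1, `|l ord0 v - u k ord0 v| <= e.
  apply: filter_forall => v.
  by have /cvgrPdist_le := H v; apply.
near=> k.
have Hk : forall v : 'I_n.+1, `|l ord0 v - u k ord0 v| <= e by near: k.
rewrite [leLHS]/Num.norm /= mx_normrE; apply/bigmax_leP; split => [|[i v] _ /=].
  exact: ltW.
by rewrite !mxE ord1; exact: Hk.
Unshelve. all: by end_near. Qed.

Section DegreeClass.
Context d (T : measurableType d) (R : realType) (P : probability T R) (n : nat).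
Variables (S : ext_bidegree P n.+1) (G : dcm S).

(** The generators of [ext_sigma], isolated so that this sigma-algebra can be used as the measurable
    space [Te]. *)
Definition env_gens : set (set T) := \bigcup_i
    ((sigma_of (indeg S i) `|` sigma_of (outdeg S i)) `|`
    (sigma_of (weight S i) `|` sigma_of (perso S i))).
Local Notation Te := (g_sigma_algebraType env_gens).

Lemma env_gens_measurable : env_gens `<=` measurable.
Proof.
by move=> A [i _ [[|]|[|]]]; apply: sigma_of_measurable.
Qed.

Lemma env_indeg i : measurable_fun setT (indeg S i : Te -> nat).
Proof. by apply: sigma_of_fun => A HA; apply: sub_gen_smallest; exists i => //; left; left. Qed.

Lemma env_outdeg i : measurable_fun setT (outdeg S i : Te -> nat).
Proof. by apply: sigma_of_fun => A HA; apply: sub_gen_smallest; exists i => //; left; right. Qed.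

Lemma env_weight i : measurable_fun setT (weight S i : Te -> R).
Proof. by apply: sigma_of_fun => A HA; apply: sub_gen_smallest; exists i => //; right; left. Qed.

Lemma env_perso i : measurable_fun setT (perso S i : Te -> R).
Proof. by apply: sigma_of_fun => A HA; apply: sub_gen_smallest; exists i => //; right; right. Qed.

Lemma measurable_tree_rank du (U : measurableType du) L (own : 'I_L -> 'I_n.+1) nn
    (CC QQ : 'I_n.+1 -> U -> R) st s :
  (forall i, measurable_fun setT (CC i)) -> (forall i, measurable_fun setT (QQ i)) ->
  forall k v, measurable_fun setT
    (fun w => tree_rank own nn (CC ^~ w) (QQ ^~ w) st s k v).
Proof.
move=> mC mQ; elim=> [|k IH] v /=; first exact: measurable_cst.
apply: measurable_funD => //; apply: measurable_sum => l.
exact: measurable_funM.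
Qed.

Variables (nn dd : 'I_n.+1 -> nat) (L : nat).
Hypotheses (nnL : (\sum_i nn i = L)%N) (ddL : (\sum_i dd i = L)%N) (L0 : (0 < L)%N).
Variables (c : R).
Hypotheses (c0 : 0 < c) (c1 : c < 1).
Variable h : R -> R.
Hypotheses (mh : measurable_fun setT h) (h0 : forall x, 0 <= h x).

Definition env_rank s v w :=
  full_rank nn dd L0 (fun i => weight S i w) (fun i => perso S i w) s v.

Definition env_class : set T := degree_event S nn dd `&`
  [set w | forall r, `|weight S r w| * (dd r)%:R <= c].

Definition pairing_class s v : set T :=
  [set w | forall p, stubs dd p -> pairing G w p = pairing_of nn dd L0 s p]
    `&` [set w | node G w = v].

Lemma weight_event_env :
  measurable ([set w | forall r, `|weight S r w| * (dd r)%:R <= c] : set Te).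
Proof.
rewrite (_ : [set w | _] = \bigcap_(r in [set: 'I_n.+1])
    ~` [set w : Te | c < `|weight S r w| * (dd r)%:R]); last first.
  apply/seteqP; split => w /= H r; last by rewrite leNgt; apply/negP; exact: H.
  by move=> _; apply/negP; rewrite -leNgt; exact: H.
apply: fin_bigcap_measurable => [|r _]; first exact: finite_finset.
apply: measurableC; apply: measurable_gt_set; apply: measurable_funM => //.
by apply: measurableT_comp => //; exact: env_weight.
Qed.

Lemma degree_event_env : measurable (degree_event S nn dd : set Te).
Proof.
have -> : degree_event S nn dd = \bigcap_(i in [set: 'I_n.+1])
   (((indeg S i : Te -> nat) @^-1` [set nn i]) `&`
    ((outdeg S i : Te -> nat) @^-1` [set dd i])).
  apply/seteqP; split => [w [H1 H2] i _|w H]; first by split; [exact: H1|exact: H2].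
  by split => i; have [] := H i Logic.I.
apply: fin_bigcap_measurable => [|i _]; first exact: finite_finset.
apply: measurableI; rewrite -[X in measurable X]setTI.
  exact: env_indeg.
exact: env_outdeg.
Qed.

Lemma env_class_env : <<s env_gens >> env_class.
Proof. exact: (measurableI _ _ degree_event_env weight_event_env). Qed.

Lemma measurable_env_class : measurable env_class.
Proof.
have := env_class_env; apply: smallest_sub; first exact: sigma_algebra_measurable.
exact: env_gens_measurable.
Qed.

Definition pairing_prob : {nonneg R} := ((L`!)%:R^-1 * n.+1%:R^-1)%:nng.

(** The weight bound in [env_class] is itself an event of the extended bi-degree sequence, so it can
    be absorbed into the conditioning event of [pairing_node_uniform]. *)
Lemma pairing_class_mass s v A : <<s env_gens >> A ->
  measurable (env_class `&` pairing_class s v) /\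
  P (A `&` (env_class `&` pairing_class s v)) =
    (P (A `&` env_class) * pairing_prob%:num%:E)%E.
Proof.
move=> mA; have bij := pairing_of_bij nnL ddL L0 s.
have := pairing_node_uniform G v bij weight_event_env.
rewrite /= ddL; set X := _ `&` _ `&` _ => -[mX _].
have mAW : ext_sigma S (A `&` [set w | forall r, `|weight S r w| * (dd r)%:R <= c]).
  exact: (measurableI _ _ (mA : measurable (A : set Te)) weight_event_env).
have [_] := pairing_node_uniform G v bij mAW.
rewrite /= ddL => E.
split.
  move: mX; rewrite /X /env_class /pairing_class.
  by move: (degree_event S nn dd) => D0; rewrite setIA [D0 `&` _]setIC.
move: E; rewrite /env_class /pairing_class.
move: (degree_event S nn dd) => D0; rewrite [D0 `&` _]setIC !setIA; exact.
Qed.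

Lemma env_rank_measurable s v : measurable_fun setT (env_rank s v : Te -> R).
Proof.
apply: (@measurable_fun_limn _ Te R) => k.
apply: (@measurable_tree_rank _ Te) => i; [exact: env_weight|exact: env_perso].
Qed.

Lemma rank_vectorE s v w : (env_class `&` pairing_class s v) w ->
  node_rank G w = env_rank s v w.
Proof.
move=> [[[H1 H2] Hc] [Hp Hv]].
have ME i j : rank_matrix G w i j =
    (\sum_(l < dd i) ((pairing_of nn dd L0 s (i, val l)).1 == j))%:R * weight S i w.
  rewrite mxE /edge_mult H2; congr (_%:R * _); apply: eq_bigr => l _.
  by rewrite Hp //; exact: ltn_ord.
have cv u : cvgn (fun k => tree_rank (owner dd (L := L)) nn (fun i => weight S i w)
    (fun i => perso S i w) (in_rank nn L0) s k u).
  exact: (@is_cvg_rank _ _ _ _ _ nnL ddL L0 _ _ c c0 c1 Hc).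
have cvr : series (fun l => perso_row S w *m rank_matrix G w ^+ l) @ \oo -->
    \row_v env_rank s v w.
  apply: row_cvg => u; rewrite mxE.
  rewrite (_ : (fun k => _) = (fun k => tree_rank (owner dd (L := L)) nn
      (fun i => weight S i w) (fun i => perso S i w) (in_rank nn L0) s k u)).
    exact: cv.
  apply/funext => k; rewrite /series /=.
  have := mx_rankE nnL ddL (fun i => perso S i w) (s := s) k ME.
  by move=> ->; rewrite mxE.
rewrite /node_rank /rank_vector Hv.
by rewrite (cvg_lim _ cvr) // mxE.
Qed.

(** On [env_class] exactly one term is nonzero, the one of the realized pairing and node, and it is
    [h] of the rank. Written as a finite sum over pairings and nodes, the function is measurable by
    construction. *)
Definition class_minorant w : R :=
  \sum_s \sum_v \1_(env_class `&` pairing_class s v) w * h (env_rank s v w).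

Lemma class_minorant_ge0 w : 0 <= class_minorant w.
Proof. by do 2 apply: sumr_ge0 => ? _; rewrite mulr_ge0. Qed.

Lemma class_minorant_le w :
  class_minorant w <= \1_env_class w * h (node_rank G w).
Proof.
rewrite /class_minorant indicE; case: (boolP (w \in env_class)) => wE; last first.
  rewrite mul0r big1 // => s _; rewrite big1 // => v _.
  rewrite indicE memNset ?mul0r // => -[wE' _].
  by move/negP: wE; apply; exact/mem_set.
have wE' := set_mem wE; have [[H1 H2] _] := wE'.
have bij := pairing_bij G w.
have fE : (fun i => outdeg S i w) = dd by apply/funext => i; exact: H2.
have gE : (fun i => indeg S i w) = nn by apply/funext => i; exact: H1.
rewrite fE gE in bij.
have [s Hs] := pairing_of_surj nnL ddL L0 bij.
rewrite mul1r (bigD1 s) //= (bigD1 (node G w)) //=.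
have ws : (env_class `&` pairing_class s (node G w)) w by [].
rewrite indicE mem_set // mul1r -(rank_vectorE ws).
rewrite big1; last first.
  move=> v; rewrite eq_sym => /eqP vn; rewrite indicE memNset ?mul0r //.
  by move=> [_ [_ /= ]] /vn.
rewrite big1 ?addr0 // => s' /eqP ss; rewrite big1 // => v _.
rewrite indicE memNset ?mul0r // => -[_ [Hs' _]]; apply: ss.
apply: (pairing_of_inj nnL ddL) => p pd.
by rewrite -Hs' // Hs.
Qed.

Lemma measurable_class_minorant : measurable_fun setT class_minorant.
Proof.
apply: measurable_sum => s; apply: measurable_sum => v; apply: measurable_funM.
  apply: measurable_indic.
  by have [] := pairing_class_mass s v (@measurableT _ Te).
apply: measurableT_comp => //.
exact: (measurable_of_gsigma env_gens_measurable (env_rank_measurable s v)).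
Qed.

(** Conditionally on the bi-degree sequence, every indicator of a pairing and a node becomes the
    factor [1 / (L! n)]. The integrand is then the average bounded below by [low], with degrees,
    weights and personalization values fixed. *)
Lemma class_minorant_integral (Good : set T) (low : R) :
  measurable Good -> 0 <= low ->
  (forall w, env_class w -> Good w ->
     low <= n.+1%:R^-1 * \sum_v ((L`!)%:R^-1 * \sum_s h (env_rank s v w))) ->
  (low%:E * P (env_class `&` Good) <= \int[P]_w (class_minorant w)%:E)%E.
Proof.
move=> mG low0 Hlow.
have mE := measurable_env_class.
have mphi s v : measurable_fun setT ((fun w => h (env_rank s v w)) : Te -> R).
  by apply: measurableT_comp => //; exact: env_rank_measurable.
have mphi' s v := measurable_of_gsigma env_gens_measurable (mphi s v).
have mind s v : measurable_fun setT
   (fun w => \1_(env_class `&` pairing_class s v) w * h (env_rank s v w)).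
  apply: measurable_funM => //; apply: measurable_indic.
  by have [] := pairing_class_mass s v (@measurableT _ Te).
have E s v : (\int[P]_w (\1_(env_class `&` pairing_class s v) w * h (env_rank s v w))%:E
   = pairing_prob%:num%:E * \int[P]_(w in env_class) (h (env_rank s v w))%:E)%E.
  rewrite -(conditional_integral (B := pairing_class s v) env_gens_measurable mE
     _ _ (f := fun w => (h (env_rank s v w))%:E)).
  - rewrite [RHS]integral_mkcond; apply: eq_integral => w _.
    by rewrite patchE indicE; case: ifP => _; rewrite ?mul1r ?mul0r.
  - by have [] := pairing_class_mass s v (@measurableT _ Te).
  - by move=> A mA; have [] := pairing_class_mass s v mA.
  - exact/measurable_EFinP.
  - by move=> w; rewrite lee_fin.
pose F w := \sum_s \sum_v h (env_rank s v w).
have mF : measurable_fun setT F.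
  by apply: measurable_sum => s; apply: measurable_sum => v; exact: mphi'.
have F0 w : 0 <= F w by apply: sumr_ge0 => s _; apply: sumr_ge0.
have -> : (\int[P]_w (class_minorant w)%:E =
   pairing_prob%:num%:E * \int[P]_(w in env_class) (F w)%:E)%E.
  rewrite /class_minorant nnint_sum; last 2 first.
  - by move=> s; apply: measurable_sum => v; exact: mind.
  - by move=> s w; apply: sumr_ge0 => v _; rewrite mulr_ge0.
  have -> : (\int[P]_(w in env_class) (F w)%:E =
      \sum_s \sum_v \int[P]_(w in env_class) (h (env_rank s v w))%:E)%E.
    rewrite /F; under eq_integral do rewrite -sumEFin.
    rewrite ge0_integral_sum //.
    + apply: eq_bigr => s _; under eq_integral do rewrite -sumEFin.
      rewrite ge0_integral_sum // => v.
        by apply/measurable_EFinP; exact: measurable_funTS.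
      by move=> w _; rewrite lee_fin.
    + move=> s; apply/measurable_EFinP; apply: measurable_funTS.
      by apply: measurable_sum => v.
    + by move=> s w _; rewrite lee_fin sumr_ge0.
  rewrite ge0_sume_distrr; last first.
    by move=> s _; apply: sume_ge0 => v _; apply: integral_ge0 => w _; rewrite lee_fin.
  apply: eq_bigr => s _; rewrite nnint_sum //; last by move=> v w; rewrite mulr_ge0.
  rewrite ge0_sume_distrr; last first.
    by move=> v _; apply: integral_ge0 => w _; rewrite lee_fin.
  by apply: eq_bigr => v _; rewrite E.
rewrite -ge0_integralZl //; last 2 first.
- by apply/measurable_EFinP; exact: measurable_funTS.
- by move=> w _; rewrite lee_fin.
rewrite -(integral_cst P (measurableI _ _ mE mG)).
apply: (@le_trans _ _ (\int[P]_(w in env_class `&` Good)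
   ((pairing_prob%:num)%:E * (F w)%:E))%E).
  apply: ge0_le_integral => //.
  - exact: measurableI.
  - by apply/measurable_EFinP; apply: measurable_funTS; apply: measurable_funM.
  - move=> w [wE wG]; rewrite lee_fin; apply: le_trans (Hlow w wE wG) _.
    rewrite /= /F exchange_big /= -mulr_sumr mulrA [_^-1 * _^-1]mulrC //.
apply: ge0_subset_integral => //.
- exact: measurableI.
- by apply/measurable_EFinP; apply: measurable_funTS; apply: measurable_funM.
- by move=> w _; rewrite -EFinM lee_fin mulr_ge0.
Qed.

End DegreeClass.

Section AllDegreeClasses.
Context d (T : measurableType d) (R : realType) (P : probability T R) (n : nat).
Variables (S : ext_bidegree P n.+1) (G : dcm S).
Variables (c : R) (h : R -> R).
Hypotheses (c0 : 0 < c) (c1 : c < 1).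
Hypotheses (mh : measurable_fun setT h) (h0 : forall x, 0 <= h x).
Variables (Good : set T) (b : nat) (low : R).
Hypotheses (mGood : measurable Good) (low0 : 0 <= low).
Hypothesis stubs_gt0 : forall w, Good w -> (0 < nb_stubs S w)%N.
Hypothesis stubs_le : forall w, Good w -> (nb_stubs S w <= b)%N.
Hypothesis weights_le : forall w, Good w ->
  forall r, `|weight S r w| * (outdeg S r w)%:R <= c.
Hypothesis pairing_mean_ge : forall nn dd L (L0 : (0 < L)%N) w,
  (\sum_i nn i = L)%N -> (\sum_i dd i = L)%N -> Good w -> degree_event S nn dd w ->
  low <= n.+1%:R^-1 * \sum_v ((L`!)%:R^-1 * \sum_s h (env_rank S nn dd L0 s v w)).

(** On [Good] every degree is at most the number of stubs, hence at most [b], so finitely many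
    degree classes cover it. *)
Let degrees := ({ffun 'I_n.+1 -> 'I_b.+1} * {ffun 'I_n.+1 -> 'I_b.+1})%type.
Let class (e : degrees) : set T :=
  env_class S (fun i => val (e.1 i)) (fun i => val (e.2 i)) c.

Let measurable_class e : measurable (class e).
Proof. exact: measurable_env_class. Qed.

Let exists_minorant (e : degrees) : exists g : T -> R,
  [/\ measurable_fun setT g, forall w, 0 <= g w,
      forall w, g w <= \1_(class e) w * h (node_rank G w) &
      (low%:E * P (class e `&` Good) <= \int[P]_w (g w)%:E)%E].
Proof.
set nn := fun i => val (e.1 i); set dd := fun i => val (e.2 i).
have [HL|HL] := boolP ((0 < \sum_i dd i)%N && (\sum_i nn i == \sum_i dd i)%N).
  case/andP: HL => L0 /eqP nnL.
  exists (class_minorant G nn dd L0 c h); split.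
  - exact: measurable_class_minorant.
  - by move=> w; exact: class_minorant_ge0.
  - by move=> w; exact: class_minorant_le.
  - apply: class_minorant_integral => // w [Dw _] Gw.
    exact: pairing_mean_ge.
(* A class without stubs, or with unequal totals, does not meet [Good], so the zero function
   serves. *)
exists (fun=> 0); split => //.
- by move=> w; rewrite mulr_ge0.
- rewrite (_ : _ `&` _ = set0) ?measure0 ?mule0 ?integral0 //.
  apply/seteqP; split => // w [[[H1 H2] _] Gw]; move/negP: HL; apply.
  have -> : (\sum_i dd i = nb_stubs S w)%N by apply: eq_bigr => i _; rewrite H2.
  rewrite stubs_gt0 //= /nb_stubs -(sum_degE S w); apply/eqP.
  by apply: eq_bigr => i _; rewrite H1.
Qed.

(** The degree classes are disjoint, so the sum of their minorants is still a minorant, and the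
    lower bounds add up over the cover of [Good]. *)
Lemma node_rank_integral_ge :
  (low%:E * P Good <= \int[P]_w (h (node_rank G w))%:E)%E.
Proof.
have [g Hg] := boolp.choice exists_minorant.
have mg e : measurable_fun setT (g e) by have [] := Hg e.
have g0 e w : 0 <= g e w by have [] := Hg e.
have mind (e : degrees) : measurable_fun setT (\1_(class e `&` Good) : T -> R).
  by apply: measurable_indic; exact: measurableI.
have cover w : Good w -> exists e, class e w.
  move=> Gw.
  have H1 i : (indeg S i w < b.+1)%N.
    rewrite ltnS (leq_trans _ (stubs_le Gw)) // /nb_stubs -sum_degE.
    by rewrite (bigD1 i) //= leq_addr.
  have H2 i : (outdeg S i w < b.+1)%N.
    by rewrite ltnS (leq_trans _ (stubs_le Gw)) // /nb_stubs (bigD1 i) //= leq_addr.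
  exists ([ffun i => Ordinal (H1 i)], [ffun i => Ordinal (H2 i)]); split => /=.
    by split => i; rewrite ffunE.
  by move=> r; rewrite ffunE /=; exact: weights_le.
have class_uniq w e e' : class e w -> class e' w -> e = e'.
  case: e e' => [e1 e2] [e1' e2'] [[H1 H2] _] [[H1' H2'] _].
  by congr pair; apply/ffunP => i; apply: val_inj; rewrite /= -?(H1 i) -?(H2 i) ?H1' ?H2'.
have PG : (P Good <= \sum_(e : degrees) P (class e `&` Good))%E.
  rewrite -[P Good]mul1e -(integral_cst P mGood) integral_mkcond.
  apply: (@le_trans _ _ (\int[P]_w (\sum_(e : degrees) \1_(class e `&` Good) w)%:E)%E).
    apply: ge0_le_integral => //.
    - by move=> w _; rewrite patchE; case: ifP.
    - by apply/(measurable_restrictT _ mGood); exact: measurable_cst.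
    - by apply/measurable_EFinP; apply: measurable_sum.
    - move=> w _; rewrite patchE; case: ifPn => Gw; last first.
        by rewrite lee_fin; apply: sumr_ge0.
      have [e He] := cover w (set_mem Gw).
      rewrite /cst lee_fin (bigD1 e) //= indicE mem_set; last by split => //; exact: set_mem.
      by rewrite lerDl; apply: sumr_ge0.
  rewrite nnint_sum //.
  by apply: lee_sum => e _; rewrite integral_indic ?setIT //; exact: measurableI.
apply: (@le_trans _ _ (\int[P]_w (\sum_(e : degrees) g e w)%:E)%E).
  rewrite nnint_sum //.
  apply: (@le_trans _ _ (\sum_(e : degrees) low%:E * P (class e `&` Good))%E).
    rewrite -ge0_sume_distrr //.
    by apply: lee_wpmul2l PG; rewrite lee_fin.
  by apply: lee_sum => e _; have [] := Hg e.
apply: ge0_integral_minorant => w; rewrite lee_fin; first exact: sumr_ge0.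
have [[e He]|ne] := pselect (exists e, class e w).
  rewrite (bigD1 e) //= big1 ?addr0; last first.
    move=> e' /eqP ee'; apply/eqP; rewrite eq_le g0 andbT.
    have [_ _ H _] := Hg e'; apply: le_trans (H w) _.
    rewrite indicE memNset ?mul0r // => He'; apply: ee'; exact: class_uniq He' He.
  by have [_ _ H _] := Hg e; apply: le_trans (H w) _; rewrite indicE mem_set // mul1r.
rewrite big1 // => e _; apply/eqP; rewrite eq_le g0 andbT.
have [_ _ H _] := Hg e; apply: le_trans (H w) _.
by rewrite indicE memNset ?mul0r // => He; apply: ne; exists e.
Qed.

End AllDegreeClasses.

(** * Averages over all pairings for a fixed sample *)

Section PairingMean.
Variables (R : realType) (n : nat) (nn dd : 'I_n.+1 -> nat) (L : nat).
Hypotheses (nnL : (\sum_i nn i = L)%N) (ddL : (\sum_i dd i = L)%N) (L0 : (0 < L)%N).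
Variables (CC QQ : 'I_n.+1 -> R) (c : R).
Hypotheses (c0 : 0 < c) (c1 : c < 1).
Hypothesis Cc : forall r, `|CC r| * (dd r)%:R <= c.

Local Notation own := (owner dd (L := L)).

Lemma sum_owner (F : 'I_n.+1 -> R) : \sum_y F (own y) = \sum_v (dd v)%:R * F v.
Proof.
rewrite (partition_big own xpredT) //=; apply: eq_bigr => v _.
rewrite (eq_bigr (fun=> F v)); last by move=> y /eqP ->.
by rewrite -(stub_owner_count ddL v) natr_sum big_distrl /=; apply: eq_bigr => y _; rewrite mul1r.
Qed.

Lemma owner_deg_gt0 y : (0 < dd (own y))%N.
Proof. exact: leq_ltn_trans (stubP ddL y). Qed.

Lemma owner_weight_le1 y : `|CC (own y)| <= 1.
Proof.
apply: le_trans (ltW c1); apply: le_trans (Cc (own y)).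
by rewrite ler_peMr // ler1n owner_deg_gt0.
Qed.

Lemma mean_indegE : mean_indeg R own nn = L%:R^-1 * \sum_v (dd v)%:R * (nn v)%:R.
Proof. by rewrite /mean_indeg /avg (sum_owner (fun v => (nn v)%:R)). Qed.

(** The collision probability of one query when at most [m] nodes have been visited; it supplies the
    [eta] of [explore_ge]. *)
Lemma owner_mem_le (Dm : R) (V : seq 'I_n.+1) m : 0 <= Dm ->
  (forall r, (dd r)%:R <= Dm) -> (size V <= m)%N ->
  avg (fun y => (own y \in V)%:R) <= m%:R * Dm / L%:R.
Proof.
move=> Dm0 HD Vm; rewrite /avg mulrC ler_wpM2r ?invr_ge0 //.
rewrite (sum_owner (fun v => (v \in V)%:R)).
apply: (@le_trans _ _ (\sum_(v in V) Dm)).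
  rewrite [leRHS]big_mkcond /=; apply: ler_sum => v _.
  by case: ifP => _; rewrite ?mulr1 ?mulr0.
rewrite sumr_const -[leLHS]mulr_natl ler_wpM2r // ler_nat.
exact: leq_trans (card_size V) Vm.
Qed.

Lemma tree_cost_le (A : R) j : mean_indeg R own nn <= A ->
  tree_cost R own nn j <= iter j (fun x => 1 + A * x) 1.
Proof.
move=> HA; elim: j => //= j IH; rewrite lerD2l; apply: ler_pM => //.
  by rewrite /mean_indeg /avg mulr_ge0 ?invr_ge0 // sumr_ge0.
exact: tree_cost_ge0.
Qed.

Variables (h : R -> R) (B Lam : R).
Hypotheses (h0 : forall x, 0 <= h x) (hB : forall x, h x <= B) (hL : lip Lam h).

(** [tree_rank_mean_ge] is averaged over the starting node, where the in-degrees add up to [L].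
    Replacing the truncated rank by the full one also needs the sum over nodes, since the
    contraction concerns the [l1] norm. *)
Lemma pairing_mean_full_rank_ge k (Kq : nat) (Dm : R) : (0 < Kq)%N ->
  0 <= Dm -> (forall r, (dd r)%:R <= Dm) ->
  \sum_v n.+1%:R^-1 * conv_iter (Xi own nn CC QQ k) (nn v) (fun s => h (QQ v + s)) <=
  n.+1%:R^-1 * (\sum_v ((L`!)%:R^-1 * \sum_s h (full_rank nn dd L0 CC QQ s v)))
  + (B * (Kq%:R * (Kq.+1%:R * Dm / L%:R)
          + n.+1%:R^-1 * L%:R * tree_cost R own nn k.-1 / Kq%:R)
     + Lam * (c ^+ k.+1 * (1 - c)^-1 * (n.+1%:R^-1 * \sum_v `|QQ v|))).
Proof.
move=> Kq0 Dm0 HD; set eta := _ * Dm / _; set tc := tree_cost _ _ _ _.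
have B0 : 0 <= B := le_trans (h0 0) (hB 0).
have Lam0 := lip_ge0 hL.
have eta0 : 0 <= eta by rewrite /eta mulr_ge0 ?invr_ge0 // mulr_ge0.
have inj : forall u u' l l', (l < nn u)%N -> (l' < nn u')%N ->
    in_rank nn L0 u l = in_rank nn L0 u' l' -> u = u' /\ l = l'.
  by move=> u u' l l' lu lu' E; have := stub_rank_inj nnL lu lu' E.
have H1 v : conv_iter (Xi own nn CC QQ k) (nn v) (fun s => h (QQ v + s)) <=
   (L`!)%:R^-1 * \sum_(s : 'S_L) h (tree_rank own nn CC QQ (in_rank nn L0) s k.+1 v)
   + B * (Kq%:R * eta + (nn v)%:R * tc / Kq%:R).
  rewrite -lerBlDr; apply: (tree_rank_mean_ge CC QQ L0 inj h0 hB k v Kq0 eta0) => V HV.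
  exact: owner_mem_le.
have H2 s : \sum_v h (tree_rank own nn CC QQ (in_rank nn L0) s k.+1 v) <=
    \sum_v h (full_rank nn dd L0 CC QQ s v) +
    Lam * (c ^+ k.+1 * (1 - c)^-1 * \sum_v `|QQ v|).
  apply: (@le_trans _ _ (\sum_v (h (full_rank nn dd L0 CC QQ s v) + Lam *
     `|full_rank nn dd L0 CC QQ s v - tree_rank own nn CC QQ (in_rank nn L0) s k.+1 v|))).
    by apply: ler_sum => v _; rewrite distrC; exact: hL.
  rewrite big_split /= lerD2l -mulr_sumr ler_wpM2l //.
  exact: (full_rank_tail nnL ddL L0 QQ c0 c1 Cc s k.+1).
rewrite -mulr_sumr.
have F0 : (L`!)%:R != 0 :> R by rewrite pnatr_eq0 -lt0n fact_gt0.
have Fi : 0 <= (L`!)%:R^-1 :> R by rewrite invr_ge0.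
have Ni : 0 <= n.+1%:R^-1 :> R by rewrite invr_ge0.
have N0 : n.+1%:R != 0 :> R by rewrite pnatr_eq0.
have K0 : Kq%:R != 0 :> R by rewrite pnatr_eq0 -lt0n.
have H3 := ler_sum (index_enum 'I_n.+1) (fun v (_ : true) => H1 v).
have H4 := ler_sum (index_enum {perm 'I_L}) (fun s (_ : true) => H2 s).
rewrite big_split /= -!mulr_sumr big_split /= in H3.
rewrite big_split /= in H4.
have H5 := ler_wpM2l Ni H3.
rewrite exchange_big /= in H5.
have H6 := ler_wpM2l Ni (ler_wpM2l Fi H4).
rewrite -mulr_sumr [X in _ + (_ + Lam * X)](_ : _ = n.+1%:R^-1 *
   (c ^+ k.+1 * (1 - c)^-1 * \sum_v `|QQ v|)); last by ring.
apply: le_trans H5 _.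
have E1 : \sum_(v < n.+1) Kq%:R * eta = n.+1%:R * (Kq%:R * eta).
  by rewrite sumr_const card_ord -[LHS]mulr_natl.
have E2 : \sum_(v < n.+1) (nn v)%:R * tc / Kq%:R = L%:R * tc / Kq%:R.
  by rewrite -!mulr_suml -natr_sum nnL.
have E3 x : \sum_(s : {perm 'I_L}) x = (L`!)%:R * x :> R.
  by rewrite sumr_const [X in _ *+ X](card_Sn L) -[LHS]mulr_natl.
rewrite E1 E2; rewrite E3 in H6.
rewrite mulrDr; apply: le_trans (lerD H6 (lexx _)) _.
rewrite [X in _ <= _ * (_ * X) + _]exchange_big /=.
move: (c ^+ k.+1 / (1 - c)) (\sum_(v < n.+1) `|QQ v|) (\sum_i \sum_(v < n.+1) _) => x y z.
rewrite le_eqVlt; apply/orP; left; apply/eqP; field.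
by rewrite nat1r N0 K0 F0.
Qed.

End PairingMean.

Section SampleComparison.
Context d (T : measurableType d) (R : realType) (P : probability T R).
Variables (Nt : seq nat -> {RV P >-> nat}) (Qt : seq nat -> {RV P >-> R})
  (Ct : seq nat -> nat -> {RV P >-> R}) (N N0 : {RV P >-> nat})
  (Q Q0 C : {RV P >-> R}) (Cs Rs : nat -> {RV P >-> R}).
Hypotheses (Hbr : branching_family Nt Qt Ct N Q C)
  (Hb : branching_vector N0 Q0 Cs C) (HR : iid_copies Rs (endogenous Nt Qt Ct))
  (HbR : independent2 P (branching_sigma N0 Q0 Cs) (sigma_family Rs)).
Variables (eN eQ eC : R).
Hypotheses (HN : (\int[P]_w ((N w)%:R)%:E <= eN%:E)%E)
  (HQ : (\int[P]_w `|Q w|%:E <= eQ%:E)%E) (HC : (\int[P]_w `|C w|%:E <= eC%:E)%E)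
  (rho1 : eN * eC < 1).
Variables (h : R -> R) (B Lam : R).
Hypotheses (h0 : forall x, 0 <= h x) (hB : forall x, h x <= B) (hL : lip Lam h).
Variables (eta K tail A A0 c H : R) (k Kq : nat).
Hypotheses (K0 : 0 <= K) (HK : tail_le P N Q C (edge_bound eN eQ eC) K tail)
  (HK0 : tail_le P N0 Q0 (fun=> 1) (edge_bound eN eQ eC) K tail)
  (pA : 0 <= A) (eta0 : 0 <= eta) (tail0 : 0 <= tail) (c0 : 0 < c) (c1 : c < 1)
  (Kq0 : (0 < Kq)%N).

Definition exploration_error (xi : R) : R :=
  B * (Kq%:R * (Kq.+1%:R * xi) + A0 * iter k.-1 (fun x => 1 + A * x) 1 / Kq%:R)
     + Lam * (c ^+ k.+1 * (1 - c)^-1 * H).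

(** A deterministic statement about one sample: [root_comparison] goes from the limit to [Xi], and
    [pairing_mean_full_rank_ge] from [Xi] to the average over pairings and nodes. *)
Lemma sample_comparison n (nn dd : 'I_n.+1 -> nat) L (CC QQ : 'I_n.+1 -> R) (L0 : (0 < L)%N)
    (Dm xi : R) :
  (\sum_i nn i = L)%N -> (\sum_i dd i = L)%N ->
  (forall r, `|CC r| * (dd r)%:R <= c) ->
  close_laws eta (fun=> n.+1%:R^-1) nn QQ (fun=> 1) P N0 Q0 (fun=> 1) ->
  close_laws eta (fun i => (dd i)%:R / L%:R) nn QQ CC P N Q C ->
  \sum_v (dd v)%:R * (nn v)%:R <= A * L%:R ->
  L%:R <= A0 * n.+1%:R -> \sum_v `|QQ v| <= H * n.+1%:R ->
  0 <= Dm -> (forall r, (dd r)%:R <= Dm) -> Dm / L%:R <= xi ->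
  (\int[P]_w (h (limit_rank N0 Q0 Cs Rs w))%:E <=
    (n.+1%:R^-1 * (\sum_v ((L`!)%:R^-1 * \sum_s h (full_rank nn dd L0 CC QQ s v)))
     + (exploration_error xi + root_error eN eQ eC eta K tail A tail A0 k * Lam))%:E)%E.
Proof.
move=> nnL ddL Cc close0 close1 HA HA0 HH Dm0 HD Hxi.
have Lp : 0 < L%:R :> R by rewrite ltr0n.
have Np : 0 < n.+1%:R :> R by rewrite ltr0n.
have HmA : mean_indeg R (owner dd (L := L)) nn <= A.
  by rewrite (mean_indegE R nn ddL) mulrC ler_pdivrMr.
have closeS := close_stubs (own := owner dd (L := L)) (stub_owner_count ddL) close1.
have C1 y : `|CC (owner dd (L := L) y)| <= 1 by exact: owner_weight_le1 c1 Cc y.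
have HA0' : \sum_v n.+1%:R^-1 * (nn v)%:R <= A0.
  by rewrite -mulr_sumr -natr_sum nnL mulrC ler_pdivrMr.
have p0 (v : 'I_n.+1) : 0 <= n.+1%:R^-1 :> R by rewrite invr_ge0.
have := root_comparison Hbr HN HQ HC rho1 L0 C1 K0 HK closeS HmA pA eta0 tail0
  Hb HR HbR p0 HK0 close0 HA0' k h0 hL.
move=> H1; apply: le_trans H1 _; rewrite lee_fin addrA lerD2r.
have := pairing_mean_full_rank_ge nnL ddL L0 QQ c0 c1 Cc h0 hB hL k Kq0 Dm0 HD.
move=> H2; apply: le_trans H2 _; rewrite lerD2l /exploration_error.
have B0 : 0 <= B := le_trans (h0 0) (hB 0).
have Lam0 := lip_ge0 hL.
apply: lerD.
  apply: ler_wpM2l => //; apply: lerD.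
    apply: ler_wpM2l => //; rewrite -mulrA; exact: ler_wpM2l.
  rewrite ler_pM2r ?invr_gt0 ?ltr0n //; apply: ler_pM.
  - by rewrite mulr_ge0 // invr_ge0.
  - exact: tree_cost_ge0.
  - by rewrite mulrC ler_pdivrMr.
  - exact: tree_cost_le.
apply: ler_wpM2l => //; apply: ler_wpM2l.
  by rewrite mulr_ge0 ?exprn_ge0 ?invr_ge0 ?subr_ge0 // ltW.
by rewrite mulrC ler_pdivrMr.
Qed.

End SampleComparison.

(** * Regular samples and the lower bound *)

Section CloseMeans.
Context (R : realType) (eta : R) (J : finType) (p : J -> R) (mj : J -> nat) (qj cj : J -> R).
Context d (T : measurableType d) (P : probability T R).
Variables (N : T -> nat) (Q C : T -> R).
Hypothesis close : close_laws eta p mj qj cj P N Q C.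

(** The triangle inequality through the coupling makes the finite empirical means bound the first
    moments of the limit law. *)
Lemma close_means :
  [/\ (\int[P]_w ((N w)%:R)%:E <= (\sum_j p j * (mj j)%:R + eta)%:E)%E,
      (\int[P]_w `|Q w|%:E <= (\sum_j p j * `|qj j| + eta)%:E)%E &
      (\int[P]_w `|C w|%:E <= (\sum_j p j * `|cj j| + eta)%:E)%E].
Proof.
have [dZ [Z [pi [m1 [m2 [q1 [q2 [c1 [c2 [[mm1 mq1 mc1] [mm2 mq2 mc2] F1 F2 [Em Eq Ec]]]]]]]]]]] := close.
have mean (g g1 g2 : Z -> R) : measurable_fun setT g -> measurable_fun setT g1 ->
    measurable_fun setT g2 ->
    (forall z, 0 <= g z) -> (forall z, 0 <= g1 z) -> (forall z, 0 <= g2 z) ->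
    (forall z, g z <= g1 z + g2 z) -> forall S : R,
    (\int[pi]_z (g1 z)%:E = S%:E)%E -> (\int[pi]_z (g2 z)%:E <= eta%:E)%E ->
    (\int[pi]_z (g z)%:E <= (S + eta)%:E)%E.
  move=> mg mg1 mg2 g0 g10 g20 gg S E1 E2.
  apply: (@le_trans _ _ (\int[pi]_z (g1 z + g2 z)%:E)%E).
    by apply: nnint_le => //; exact: measurable_funD.
  by rewrite nnintD // E1 EFinD leeD2l.
have mn : measurable_fun setT (fun n : nat => n%:R : R) by [].
have mnR (m : Z -> nat) : measurable_fun setT m -> measurable_fun setT (fun z => (m z)%:R : R).
  by move=> mm; apply: (measurableT_comp mn).
have mnorm (u : Z -> R) : measurable_fun setT u -> measurable_fun setT (fun z => `|u z|).
  by move=> mu; apply: measurableT_comp.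
have mB (u v : Z -> R) : measurable_fun setT u -> measurable_fun setT v ->
  measurable_fun setT (fun z => `|u z - v z|) by move=> mu mv; apply/mnorm/measurable_funB.
pose P1 (x : nat * R * R) := ((x.1.1)%:R : R)%:E.
pose P2 (x : nat * R * R) := `|x.1.2|%:E.
pose P3 (x : nat * R * R) := `|x.2|%:E.
have mP1 : measurable_fun setT P1.
  apply/measurable_EFinP; apply: (measurableT_comp mn).
  exact: (measurableT_comp measurable_fst measurable_fst).
have mP2 : measurable_fun setT P2.
  apply/measurable_EFinP; apply: measurableT_comp => //.
  exact: (measurableT_comp measurable_snd measurable_fst).
have mP3 : measurable_fun setT P3.
  by apply/measurable_EFinP; apply: measurableT_comp.
have Pos1 x : (0 <= P1 x)%E by rewrite lee_fin.
have Pos2 x : (0 <= P2 x)%E by rewrite lee_fin.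
have Pos3 x : (0 <= P3 x)%E by rewrite lee_fin.
have A1 := F1 P1 mP1 Pos1; have A2 := F1 P2 mP2 Pos2; have A3 := F1 P3 mP3 Pos3.
have B1 := F2 P1 mP1 Pos1; have B2 := F2 P2 mP2 Pos2; have B3 := F2 P3 mP3 Pos3.
rewrite /P1 /P2 /P3 /= in A1 A2 A3 B1 B2 B3.
rewrite (eq_integral (fun w => ((N w)%:R)%:E)) in B1; last by move=> w _; exact: prob_int_cst.
rewrite (eq_integral (fun w => `|Q w|%:E)) in B2; last by move=> w _; exact: prob_int_cst.
rewrite prob_int_cst in B3.
rewrite -B1 -B2 -B3; split.
- apply: (mean _ (fun z => (m1 z)%:R) (fun z => `|(m1 z)%:R - (m2 z)%:R|)) => //.
  + exact: mnR.
  + exact: mnR.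
  + by apply: mB; exact: mnR.
  + move=> z; rewrite -lerBlDl; apply: le_trans (ler_norm _) _; by rewrite distrC.
  + by rewrite A1 -sumEFin.
- apply: (mean _ (fun z => `|q1 z|) (fun z => `|q1 z - q2 z|)) => //.
  + exact: mnorm.
  + exact: mnorm.
  + exact: mB.
  + by move=> z; rewrite -lerBlDl distrC; exact: lerB_dist.
  + by rewrite A2 -sumEFin.
- apply: (mean _ (fun z => `|c1 z|) (fun z => `|c1 z - c2 z|)) => //.
  + exact: mnorm.
  + exact: mnorm.
  + exact: mB.
  + by move=> z; rewrite -lerBlDl distrC; exact: lerB_dist.
  + by rewrite A3 -sumEFin.
Qed.

End CloseMeans.

Section TailSmall.
Context d (T : measurableType d) (R : realType) (P : probability T R).

(** Dominated convergence, with the integrable majorant [|Q| + M * N]; the factor [1 + |C|] is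
    integrated separately and contributes at most [1 + eC]. *)
Lemma tail_small (N : {RV P >-> nat}) (Q C : {RV P >-> R}) (eN eQ eC M t : R) :
  (\int[P]_w ((N w)%:R)%:E <= eN%:E)%E -> (\int[P]_w `|Q w|%:E <= eQ%:E)%E ->
  (\int[P]_w `|C w|%:E <= eC%:E)%E -> 0 <= M -> 0 < t ->
  \forall K \near \oo, tail_le P N Q C M K%:R t.
Proof.
move=> HN HQ HC M0 t0.
pose H w := `|Q w| + M * (N w)%:R.
have mN : measurable_fun setT (fun w => (N w)%:R : R).
  by apply: (@measurableT_comp _ _ _ _ _ _ (fun n : nat => n%:R : R)).
have mH : measurable_fun setT H.
  by apply: measurable_funD; [exact: measurableT_comp|exact: measurable_funM].
have H0 w : 0 <= H w by rewrite addr_ge0 // mulr_ge0.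
pose u (K : nat) w := Num.max (H w - K%:R) 0.
have mu K : measurable_fun setT (u K).
  by apply: measurable_maxr => //; exact: measurable_funB.
have u0 K w : 0 <= u K w by rewrite le_max lexx orbT.
have uH K w : u K w <= H w by rewrite ge_max H0 lerBlDr lerDl ler0n.
have iH : P.-integrable setT (EFin \o H).
  apply/integrableP; split; first exact/measurable_EFinP.
  rewrite (eq_integral (fun w => (H w)%:E)); last first.
    by move=> w _; rewrite /= ger0_norm.
  rewrite nnintD //; last 3 first.
  - exact: measurableT_comp.
  - exact: measurable_funM.
  - by move=> w; rewrite mulr_ge0.
  rewrite nnintZ //; apply: lte_add_pinfty.
    by apply: le_lt_trans HQ _; rewrite ltry.
  apply: lte_mul_pinfty => //.
  by apply: le_lt_trans HN _; rewrite ltry.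
have cvg0 : (\int[P]_w (u K w)%:E @[K --> \oo] --> \int[P]_w cst 0 w)%E.
  apply: (@dominated_cvg _ _ _ P setT measurableT (fun K w => (u K w)%:E) (cst 0%E)
    (EFin \o H)) => //.
  - by move=> K; apply/measurable_EFinP.
  - move=> w _; apply: cvg_near_cst; near=> K.
    rewrite /u /=; congr EFin; apply/max_idPr; rewrite subr_le0.
    near: K; exact: nbhs_infty_ger.
  - by move=> K w _ /=; rewrite lee_fin ger0_norm.
rewrite integral0 in cvg0.
have eC0 : 0 <= eC by have := eC_ge0 HC.
have t' : 0 < t / (1 + eC) by rewrite divr_gt0 // ltr_pwDl.
have /fine_cvgP[_ /cvgrPdist_le/(_ _ t')] := cvg0.
have ifin : \forall K \near \oo, (\int[P]_w (u K w)%:E)%E \is a fin_num.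
  by have /fine_cvgP[] := cvg0.
move=> H1; near=> K.
have fK : (\int[P]_w (u K w)%:E)%E \is a fin_num by near: K; exact: ifin.
have HK : `|0 - fine (\int[P]_w (u K w)%:E)%E| <= t / (1 + eC) by near: K.
rewrite /tail_le.
have mC : measurable_fun setT (fun w => 1 + `|C w|).
  by apply: measurable_funD => //; exact: measurableT_comp.
have IC : (\int[P]_w (1 + `|C w|)%:E <= (1 + eC)%:E)%E.
  rewrite nnintD //; last exact: measurableT_comp.
  by rewrite prob_int_cst EFinD leeD2l.
apply: (@le_trans _ _ (\int[P]_w ((1 + eC) * u K w)%:E)%E).
  apply: ge0_le_integral => //.
  - move=> w _; apply: integral_ge0 => w' _; rewrite lee_fin mulr_ge0 ?addr_ge0 //; exact: u0.
  - rewrite (_ : (fun x => _) = (fun w => (u K w)%:E * (\int[P]_w' (1 + `|C w'|)%:E))%E).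
      apply: emeasurable_funM => //; exact/measurable_EFinP.
    apply/funext => w; rewrite -nnintZ //.
    by apply: eq_integral => w' _; rewrite mulrC.
  - by apply/measurable_EFinP; exact: measurable_funM.
  - move=> w _; rewrite (eq_integral (fun w' => (u K w * (1 + `|C w'|))%:E)); last first.
      by move=> w' _; rewrite mulrC.
    rewrite nnintZ //.
    by rewrite [(_ * u _ _)%R]mulrC EFinM lee_wpmul2l // lee_fin.
rewrite nnintZ ?addr_ge0 //.
rewrite -(fineK fK) -EFinM lee_fin mulrC -ler_pdivlMr ?ltr_pwDl //.
by apply: le_trans HK; rewrite sub0r normrN ler_norm.
Unshelve. all: by end_near. Qed.

End TailSmall.

Lemma powRN_small (R : realType) (a e : R) : 0 < a -> 0 < e ->
  \forall k \near \oo, k.+1%:R `^ (- a) <= e.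
Proof.
move=> a0 e0; near=> k.
have H : (e^-1) `^ (a^-1) <= k.+1%:R :> R.
  by apply: (@le_trans _ _ k%:R); [near: k; exact: nbhs_infty_ger|rewrite ler_nat].
rewrite powRN -[leRHS]invrK lef_pV2 ?posrE ?powR_gt0 ?invr_gt0 //.
have := @ge0_ler_powR _ a (ltW a0) ((e^-1) `^ (a^-1)) k.+1%:R.
rewrite !nnegrE => /(_ (powR_ge0 _ _) (ler0n _ _) H).
by rewrite -powRrM mulVf ?gt_eqF // powRr1 // invr_ge0 ltW.
Unshelve. all: by end_near. Qed.

Section GoodEvent.
Context d (T : measurableType d) (R : realType) (P : probability T R) (n : nat).
Variable S : ext_bidegree P n.

Lemma measurable_le_set (f : T -> R) a :
  measurable_fun setT f -> measurable [set z | f z <= a].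
Proof.
move=> mf; rewrite (_ : [set z | _] = ~` [set z | a < f z]).
  by apply: measurableC; exact: measurable_gt_set.
by apply/seteqP; split => z /=; rewrite leNgt => /negP.
Qed.

Lemma measurable_good_event H nu1 nu2 nu3 nu4 nu5 kappa c gamma :
  measurable (good_event S H nu1 nu2 nu3 nu4 nu5 kappa c gamma).
Proof.
have mn : measurable_fun setT (fun n : nat => n%:R : R) by [].
have mD r : measurable_fun setT (fun w => (outdeg S r w)%:R : R).
  exact: (measurableT_comp mn).
have mN r : measurable_fun setT (fun w => (indeg S r w)%:R : R).
  exact: (measurableT_comp mn).
have mC r : measurable_fun setT (fun w => `|weight S r w| * (outdeg S r w)%:R).
  by apply: measurable_funM => //; exact: measurableT_comp.
have dist (f : 'I_n -> T -> R) a t : (forall r, measurable_fun setT (f r)) ->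
    measurable [set w | `|\sum_r f r w - a| <= t].
  move=> mf; apply: measurable_le_set; apply: measurableT_comp => //.
  by apply: measurable_funB => //; exact: measurable_sum.
rewrite /good_event; apply: measurableI; last first.
  apply: measurable_le_set; apply: measurable_sum => r; exact: measurableT_comp.
apply: measurableI; last first.
  rewrite (_ : [set w | _] =
      [set w | `|\sum_r `|weight S r w| * (outdeg S r w)%:R - n%:R * nu5| <=
                n%:R `^ (1 - gamma)] `&`
      \bigcap_(r in [set: 'I_n]) [set w | `|weight S r w| * (outdeg S r w)%:R <= c]).
    apply: measurableI; first by apply: (dist (fun r w => `|weight S r w| * (outdeg S r w)%:R)).
    apply: fin_bigcap_measurable => [|r _]; first exact: finite_finset.
    exact: measurable_le_set.
  apply/seteqP; split => w [H1 H2]; split => // r; first by move=> _; exact: H2.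
  exact: H2.
apply: measurableI; last first.
  apply: (dist (fun r w => (outdeg S r w)%:R `^ (2 + kappa))) => r.
  exact: measurableT_comp (measurable_powR _) (mD r).
apply: measurableI; last first.
  by apply: (dist (fun r w => (outdeg S r w)%:R ^+ 2)) => r; exact: measurable_funX.
apply: measurableI; first exact: (dist (fun r w => (outdeg S r w)%:R)).
by apply: (dist (fun r w => (outdeg S r w)%:R * (indeg S r w)%:R)) => r; exact: measurable_funM.
Qed.

End GoodEvent.

(** Convergence in probability is stated with the outer measure. A measurable cover of almost the
    same mass provides an exceptional set that can be removed. *)
Lemma mu_ext_cover d (T : measurableType d) (R : realType)
    (P : {measure set T -> \bar R}) (X : set T) (e : \bar R) :
  (mu_ext P X < e)%E -> exists2 Y, measurable Y /\ X `<=` Y & (P Y < e)%E.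
Proof.
move=> /ereal_inf_lt[_ [F [mF XF] <-] lt].
exists (\bigcup_k F k); first by split => //; exact: bigcup_measurable.
apply: le_lt_trans lt; apply: generalized_Boole_inequality => //.
exact: bigcup_measurable.
Qed.

Section GoodSets.
Context (R : realType) (d : nat -> measure_display)
  (T : forall k, measurableType (d k)) (P : forall k, probability (T k) R).

Lemma good_sets (X Y : forall k, T k -> \bar R) (E : forall k, set (T k)) (eps eta del : R) :
  (forall k, measurable (E k)) -> 0 < eps ->
  (fun k => fine (P k (~` E k))) =O_\oo (fun k => k.+1%:R `^ (- eps)) ->
  cvg0_in_probability P X -> cvg0_in_probability P Y -> 0 < eta -> 0 < del ->
  \forall k \near \oo, exists Gd : set (T k), [/\ measurable Gd,
    ((1 - del)%:E <= P k Gd)%E &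
    forall w, Gd w -> [/\ E k w, (X k w < eta%:E)%E & (Y k w < eta%:E)%E]].
Proof.
move=> mE eps0 /eqO_exP[K K0 HO] cX cY eta0 del0.
(* Three exceptional sets share [del]. Off them the distances are at most [eta / 2], hence strictly
   below [eta], as [d1_coupling] requires. *)
have d3 : 0 < del / 3 by rewrite divr_gt0.
have d3E : (0 < (del / 3)%:E :> \bar R)%E by rewrite lte_fin.
have e2 : 0 < eta / 2 by rewrite divr_gt0.
have small (Z : forall k, T k -> \bar R) : cvg0_in_probability P Z ->
    \forall k \near \oo,
      (mu_ext (P k) [set w | ((eta / 2)%:E < Z k w)%E] < (del / 3)%:E)%E.
  move=> /(_ _ e2) cZ; have H : nbhs (0%E : \bar R) [set y | (y < (del / 3)%:E)%E].
    by apply: open_nbhs_nbhs; split => //; exact: open_ereal_lt_ereal.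
  exact: (cZ _ H).
have H1 := small _ cX; have H2 := small _ cY.
have H3 : \forall k \near \oo, k.+1%:R `^ (- eps) <= del / 3 / K.
  by apply: powRN_small => //; rewrite divr_gt0.
near=> k.
have [A [mA XA] PA] : exists2 A, measurable A /\
    [set w | ((eta / 2)%:E < X k w)%E] `<=` A & (P k A < (del / 3)%:E)%E.
  by apply: mu_ext_cover; near: k.
have [A' [mA' XA'] PA'] : exists2 A, measurable A /\
    [set w | ((eta / 2)%:E < Y k w)%E] `<=` A & (P k A < (del / 3)%:E)%E.
  by apply: mu_ext_cover; near: k.
have PE : (P k (~` E k) <= (del / 3)%:E)%E.
  have fE : P k (~` E k) \is a fin_num.
    by rewrite fin_num_measure //; exact: measurableC.
  rewrite -(fineK fE) lee_fin; apply: le_trans (ler_norm _) _.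
  have := near HO k => H; apply: (le_trans (H _)) => //.
  rewrite ger0_norm ?powR_ge0 // mulrC -ler_pdivlMr //.
  by near: k.
exists (~` (~` E k `|` A `|` A')); split.
- apply: measurableC; apply: measurableU => //; apply: measurableU => //.
  exact: measurableC.
- rewrite probability_setC; last first.
    by apply: measurableU => //; apply: measurableU => //; exact: measurableC.
  rewrite EFinB; apply: leeB => //.
  rewrite (_ : del = del / 3 + del / 3 + del / 3); last by field.
  rewrite !EFinD.
  apply: (le_trans (measureU2 _ _ _)) => //.
    by apply: measurableU => //; exact: measurableC.
  apply: leeD; last exact: ltW.
  apply: (le_trans (measureU2 _ _ _)) => //; first exact: measurableC.
  by apply: leeD => //; exact: ltW.
- move=> w /not_orP[/not_orP[Ew Aw] Aw'].
  split; first exact: contrapT.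
  + apply: (@le_lt_trans _ _ (eta / 2)%:E); last by rewrite lte_fin ltr_pdivrMr // ltr_pMr // ltr1n.
    by rewrite leNgt; apply/negP => /XA.
  + apply: (@le_lt_trans _ _ (eta / 2)%:E); last by rewrite lte_fin ltr_pdivrMr // ltr_pMr // ltr1n.
    by rewrite leNgt; apply/negP => /XA'.
Unshelve. all: by end_near. Qed.

End GoodSets.

Lemma geometric_small (R : realType) (x a e : R) : 0 <= x < 1 -> 0 < e ->
  \forall k \near \oo, a * x ^+ k <= e.
Proof.
move=> /andP[x0 x1] e0.
have cx : (fun k => a * x ^+ k) @ \oo --> (a * 0 : R).
  by apply: cvgMr; apply: cvg_expr; rewrite ger0_norm.
rewrite mulr0 in cx.
have /cvgrPdist_le/(_ _ e0) H := cx; near=> k.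
apply: le_trans (ler_norm _) _; rewrite -normrN -sub0r.
by near: k.
Unshelve. all: by end_near. Qed.

Lemma small_factor (R : realType) (a e : R) : 0 <= a -> 0 < e ->
  exists2 x, 0 < x & a * x <= e.
Proof.
move=> a0 e0; exists (e / (a + 1)); first by rewrite divr_gt0 // ltr_wpDl.
by rewrite mulrA ler_pdivrMr ?ltr_wpDl // mulrC ler_pM2l // lerDl.
Qed.

(** In closed form the error is linear in [eta] and [tail], with coefficients depending on the depth
    and on [K]. *)
Lemma tree_errorE (R : realType) (eN eQ eC eta K tail A : R) k :
  tree_error eN eQ eC eta K tail A k =
    (\sum_(i < k) A ^+ i) * ((1 + edge_bound eN eQ eC + K) * eta + tail).
Proof.
elim: k => [|k IH] /=; first by rewrite big_ord0 mul0r.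
rewrite IH big_ord_recl /= expr0.
by under [in RHS]eq_bigr do rewrite exprS; rewrite -mulr_sumr; ring.
Qed.

(** * Regular samples and the choice of constants *)

Section LowerBound.
Context (R : realType) (d : nat -> measure_display)
  (T : forall k, measurableType (d k)) (P : forall k, probability (T k) R).
Variables (S : forall k, ext_bidegree (P k) k.+1) (G : forall k, dcm (S k)).
Context d' (T' : measurableType d') (P' : probability T' R).
Variables (N0 N : {RV P' >-> nat}) (Q0 Q C : {RV P' >-> R}).
Hypothesis HB : assumptionB S N0 Q0 N Q C.
Variables (H nu1 nu2 nu3 nu4 nu5 kappa c gamma eps : R).
Hypotheses (nu1_gt0 : 0 < nu1) (nu2_gt0 : 0 < nu2)
  (nu5_gt0 : 0 < nu5) (rho1 : nu5 * (nu2 / nu1) / nu1 < 1)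
  (c0 : 0 < c) (c1 : c < 1) (gamma_gt0 : 0 < gamma) (eps_gt0 : 0 < eps).
Hypothesis HO : (fun k => fine (P k (~` good_event (S k) H nu1 nu2 nu3 nu4 nu5
  kappa c gamma))) =O_\oo (fun k => k.+1%:R `^ (- eps)).

(** The tolerance [n^(1 - gamma)] of the good event is relaxed to [theta * n] with a [theta] fixed
    before [n], and the distances are replaced by the couplings they provide. *)
Definition regular_sample (theta eta : R) k (w : T k) : Prop :=
  let D i : R := (outdeg (S k) i w)%:R in
  let n : R := k.+1%:R in let L : R := (nb_stubs (S k) w)%:R in
  [/\ [/\ n * (nu1 - theta) <= L, L <= n * (nu1 + theta),
        \sum_i D i * (indeg (S k) i w)%:R <= n * (nu2 + theta),
        \sum_i D i ^+ 2 <= n * (nu3 + theta)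
      & \sum_i `|weight (S k) i w| * D i <= n * (nu5 + theta)],
    forall i, `|weight (S k) i w| * D i <= c,
    \sum_i `|perso (S k) i w| <= H * n,
    close_laws eta (fun=> k.+1%:R^-1) (indeg (S k) ^~ w) (perso (S k) ^~ w) (fun=> 1)
      P' N0 Q0 (fun=> 1)
  & close_laws eta (fun i => D i / L) (indeg (S k) ^~ w)
      (perso (S k) ^~ w) (weight (S k) ^~ w) P' N Q C].

Lemma regular_samples theta eta del : 0 < theta -> theta < nu1 -> 0 < eta -> 0 < del ->
  \forall k \near \oo, exists Gd : set (T k), [/\ measurable Gd,
    ((1 - del)%:E <= P k Gd)%E & forall w, Gd w -> regular_sample theta eta w].
Proof.
move=> th0 th1 eta0 del0; have [cX cY] := HB.
have H1 := good_sets (fun k => measurable_good_event (S k) H nu1 nu2 nu3 nu4 nu5 kappa c gamma)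
  eps_gt0 HO cX cY eta0 del0.
have H2 : \forall k \near \oo, k.+1%:R `^ (- gamma) <= theta by exact: powRN_small.
near=> k.
have [Gd [mGd PGd HGd]] : exists Gd : set (T k), [/\ measurable Gd,
    ((1 - del)%:E <= P k Gd)%E &
    forall w, Gd w -> [/\ good_event (S k) H nu1 nu2 nu3 nu4 nu5 kappa c gamma w,
      (d1 (emp_df (S k) w) (fun v : 2.-tuple R =>
         P' [set w | ((N0 w)%:R <= v`_0)%R /\ (Q0 w <= v`_1)%R]) < eta%:E)%E &
      (d1 (biased_df (S k) w) (fun v : 3.-tuple R =>
         (P' [set w | ((N w)%:R <= v`_0)%R /\ (Q w <= v`_1)%R]
           * P' [set w | (C w <= v`_2)%R])%E) < eta%:E)%E]] by near: k.
have tol : k.+1%:R `^ (1 - gamma) <= k.+1%:R * theta :> R.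
  rewrite powRD ?pnatr_eq0 ?implybT // powRr1 // ler_wpM2l //.
  by near: k.
exists Gd; split => // w /HGd[[[[[[A1 A2] A3] A4] [A5 A5'] A6] B1 B2]].
rewrite /= in A1 A2 A3 A4 A5 A5' A6.
have := le_trans A1 tol; have := le_trans A2 tol; have := le_trans A3 tol.
have := le_trans A5 tol; rewrite !ler_norml => /andP[_ U5] /andP[_ U3] /andP[_ U2] /andP[V1 U1].
have LE : (nb_stubs (S k) w)%:R = \sum_r (outdeg (S k) r w)%:R :> R.
  by rewrite /nb_stubs natr_sum.
have L1 : k.+1%:R * (nu1 - theta) <= (nb_stubs (S k) w)%:R :> R by rewrite LE; lra.
split => //.
- by split => //; rewrite ?LE; lra.
- exact: close_empirical B1.
- have L0 : (0 < \sum_i outdeg (S k) i w)%N.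
    by rewrite -(ltr0n R); apply: lt_le_trans L1; rewrite mulr_gt0 // subr_gt0.
  exact: (@close_biased _ _ _ _ P' (indeg (S k) ^~ w) (perso (S k) ^~ w)
    (weight (S k) ^~ w) (outdeg (S k) ^~ w) N Q C eta L0 B2).
Unshelve. all: by end_near. Qed.

Lemma regular_sample_means theta eta k (w : T k) : theta < nu1 -> 0 <= theta ->
  regular_sample theta eta w ->
  [/\ (\int[P']_w ((N w)%:R)%:E <= ((nu2 + theta) / (nu1 - theta) + eta)%:E)%E,
      (\int[P']_w `|C w|%:E <= ((nu5 + theta) / (nu1 - theta) + eta)%:E)%E,
      exists eQ, (\int[P']_w `|Q w|%:E <= eQ%:E)%E &
      (exists e0, (\int[P']_w ((N0 w)%:R)%:E <= e0%:E)%E) /\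
      exists e0, (\int[P']_w `|Q0 w|%:E <= e0%:E)%E].
Proof.
move=> th1 th0 [[L1 L2 DN D2 CD] Cc HQ cl0 cl1].
have [E1 E2 _] := close_means cl0; have [F1 F2 F3] := close_means cl1.
have n0 : 0 < k.+1%:R :> R by rewrite ltr0n.
have t0 : 0 < nu1 - theta by rewrite subr_gt0.
have L0 : 0 < (nb_stubs (S k) w)%:R :> R by apply: lt_le_trans L1; rewrite mulr_gt0.
have quot (x a : R) : 0 <= a -> x <= k.+1%:R * a ->
    x / (nb_stubs (S k) w)%:R <= a / (nu1 - theta).
  move=> a0 xa; rewrite ler_pdivrMr // mulrAC ler_pdivlMr //.
  apply: (@le_trans _ _ (k.+1%:R * a * (nu1 - theta))).
    by rewrite ler_pM2r.
  by rewrite mulrAC [leRHS]mulrC ler_wpM2r.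
split.
- apply: le_trans F1 _; rewrite lee_fin lerD2r.
  under eq_bigr do rewrite mulrAC.
  by rewrite -mulr_suml; apply: quot => //; rewrite addr_ge0 // ltW.
- apply: le_trans F3 _; rewrite lee_fin lerD2r.
  under eq_bigr do rewrite mulrAC [_%:R * `|_|]mulrC.
  by rewrite -mulr_suml; apply: quot => //; rewrite addr_ge0 // ltW.
- by exists (\sum_i (outdeg (S k) i w)%:R / (nb_stubs (S k) w)%:R * `|perso (S k) i w| + eta).
- split; first by exists (\sum_i k.+1%:R^-1 * (indeg (S k) i w)%:R + eta).
  by exists (\sum_i k.+1%:R^-1 * `|perso (S k) i w| + eta).
Qed.

(** At [theta = 0] the product is [rho], so continuity keeps it below 1. The two factors are the
    bounds of [regular_sample_means] for [N] and [C] when [eta = theta]. *)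
Lemma small_theta : exists2 theta, 0 < theta < nu1 &
  ((nu2 + theta) / (nu1 - theta) + theta) * ((nu5 + theta) / (nu1 - theta) + theta) < 1.
Proof.
pose f (t : R) := ((nu2 + t) / (nu1 - t) + t) * ((nu5 + t) / (nu1 - t) + t).
have cf : f x @[x --> 0] --> f 0.
  have c1' : (fun t : R => (nu1 - t)^-1) x @[x --> 0] --> (nu1 - 0)^-1.
    by apply: cvgV; [rewrite subr0 gt_eqF|apply: cvgB; [exact: cvg_cst|exact: cvg_id]].
  by apply: cvgM; apply: cvgD; (try exact: cvg_id); apply: cvgM => //;
    apply: cvgD; (try exact: cvg_id); exact: cvg_cst.
have f0 : f 0 < 1.
  rewrite /f !addr0 subr0 (_ : _ * _ = nu5 * (nu2 / nu1) / nu1) //.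
  by field; rewrite gt_eqF.
have H1 : \forall t \near (0 : R), f t < 1.
  exact: (cf [set y | y < 1] (lt_nbhsl f0)).
have H2 : \forall t \near (0 : R)^'+, 0 < t < nu1 /\ f t < 1.
  near=> t; split.
    by apply/andP; split; near: t; [exact: nbhs_right_gt|exact: nbhs_right_lt].
  by near: t; apply: cvg_within; exact: H1.
near (0 : R)^'+ => t; have [t1 t2] : 0 < t < nu1 /\ f t < 1 by near: t.
by exists t.
Unshelve. all: by end_near. Qed.

Lemma regular_sample_exists theta eta : 0 < theta -> theta < nu1 -> 0 < eta ->
  exists k (w : T k), regular_sample theta eta w.
Proof.
move=> th0 th1 eta0.
have half : 0 < 2^-1 :> R by [].
have H2 := regular_samples th0 th1 eta0 half.
near \oo => k; have [Gd [_ PG HG]] : exists Gd : set (T k), [/\ measurable Gd,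
    ((1 - 2^-1)%:E <= P k Gd)%E & forall w, Gd w -> regular_sample theta eta w] by near: k.
have /set0P[w Gw] : Gd != set0.
  apply/eqP => G0; move: PG; rewrite G0 measure0 lee_fin; lra.
by exists k, w; exact: HG.
Unshelve. all: by end_near. Qed.

Variables (Nt : seq nat -> {RV P' >-> nat}) (Qt : seq nat -> {RV P' >-> R})
  (Ct : seq nat -> nat -> {RV P' >-> R}) (Cs Rs : nat -> {RV P' >-> R}).
Hypotheses (Hbr : branching_family Nt Qt Ct N Q C)
  (Hb : branching_vector N0 Q0 Cs C) (HR : iid_copies Rs (endogenous Nt Qt Ct))
  (HbR : independent2 P' (branching_sigma N0 Q0 Cs) (sigma_family Rs)).

Lemma measurable_limit_rank : measurable_fun setT (limit_rank N0 Q0 Cs Rs).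
Proof.
apply: measurable_funD => //.
apply: (measurable_random_sum (F := fun l w => Cs l w * Rs l w)) => // l.
exact: measurable_funM.
Qed.

Lemma regular_sample_comparison (theta eN eQ eC K tail eta Lam B xi : R) (h : R -> R)
    (m Kq k : nat) (w : T k) :
  0 <= theta -> theta < nu1 ->
  (\int[P']_w ((N w)%:R)%:E <= eN%:E)%E -> (\int[P']_w `|Q w|%:E <= eQ%:E)%E ->
  (\int[P']_w `|C w|%:E <= eC%:E)%E -> eN * eC < 1 ->
  (forall x, 0 <= h x) -> (forall x, h x <= B) -> lip Lam h ->
  0 <= K -> tail_le P' N Q C (edge_bound eN eQ eC) K tail ->
  tail_le P' N0 Q0 (fun=> 1) (edge_bound eN eQ eC) K tail ->
  0 <= eta -> 0 <= tail -> (0 < Kq)%N -> 0 < xi ->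
  (nu3 + theta) / (xi * (nu1 - theta)) ^+ 2 <= k.+1%:R ->
  regular_sample theta eta w ->
  forall nn dd L (L0 : (0 < L)%N), (\sum_i nn i = L)%N -> (\sum_i dd i = L)%N ->
  degree_event (S k) nn dd w ->
  (\int[P']_w (h (limit_rank N0 Q0 Cs Rs w))%:E <=
   (k.+1%:R^-1 * (\sum_v ((L`!)%:R^-1 * \sum_s h (env_rank (S k) nn dd L0 s v w)))
     + (exploration_error B Lam ((nu2 + theta) / (nu1 - theta)) (nu1 + theta) c H m Kq xi
        + root_error eN eQ eC eta K tail ((nu2 + theta) / (nu1 - theta)) tail
            (nu1 + theta) m * Lam))%:E)%E.
Proof.
move=> th0 th1 HN HQ HC rho h0 hB hL K0 HK HK0 eta0 tail0 Kq0 xi0 Hk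
  [[L1 L2 DN D2 CD] Cc HQs cl0 cl1] nn dd L L0 nnL ddL [Enn Edd].
have LE : nb_stubs (S k) w = L.
  by rewrite -ddL; apply: eq_bigr => i _; rewrite Edd.
have fnn : indeg (S k) ^~ w = nn by apply/funext => i; exact: Enn.
have n0 : 0 < k.+1%:R :> R by rewrite ltr0n.
have t0 : 0 < nu1 - theta by rewrite subr_gt0.
rewrite LE in L1 L2 cl1; rewrite fnn in cl0 cl1.
have cl1' : close_laws eta (fun i => (dd i)%:R / L%:R) nn (perso (S k) ^~ w)
    (weight (S k) ^~ w) P' N Q C.
  have -> : (fun i => (dd i)%:R / L%:R) = (fun i => (outdeg (S k) i w)%:R / L%:R :> R).
    by apply/funext => i; rewrite Edd.
  exact: cl1.
have Dd i : dd i = outdeg (S k) i w by rewrite Edd.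
(* [D_i ^+ 2] is at most the sum of squares, at most [n * (nu3 + theta)], which [Hk] puts below
   [Dm ^+ 2]; and [L >= n * (nu1 - theta)] gives [Dm / L <= xi]. *)
set Dm := xi * (nu1 - theta) * k.+1%:R.
have Dm0 : 0 <= Dm by rewrite /Dm !mulr_ge0 // ltW.
apply: (sample_comparison Hbr Hb HR HbR HN HQ HC rho h0 hB hL m K0 HK HK0 _ eta0
  tail0 c0 c1 Kq0 L0 (Dm := Dm) nnL ddL _ cl0 cl1').
- apply: divr_ge0; last exact: ltW.
  by apply: addr_ge0 => //; exact: ltW.
- by move=> i; rewrite Dd.
- apply: (@le_trans _ _ (k.+1%:R * (nu2 + theta))).
    by apply: le_trans DN; apply: ler_sum => i _; rewrite Dd Enn.
  rewrite mulrAC ler_pdivlMr // mulrAC mulrC ler_wpM2l //.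
  by rewrite addr_ge0 // ltW.
- by rewrite mulrC.
- exact: HQs.
- exact: Dm0.
- move=> i; rewrite -(@ler_pXn2r _ 2) ?nnegrE //.
  apply: (@le_trans _ _ (k.+1%:R * (nu3 + theta))).
    apply: le_trans D2; rewrite (bigD1 i) //= Dd lerDl.
    by apply: sumr_ge0 => j _; exact: sqr_ge0.
  have x0 : 0 < xi * (nu1 - theta) by rewrite mulr_gt0.
  rewrite /Dm exprMn [k.+1%:R ^+ 2]expr2 mulrCA ler_wpM2l // mulrC.
  by move: Hk; rewrite ler_pdivrMr ?exprn_gt0.
- by rewrite ler_pdivrMr ?ltr0n // /Dm -mulrA (ler_wpM2l (ltW xi0)) // mulrC.
Qed.

Lemma node_rank_lower_bound (h : R -> R) (B Lam e : R) :
  (forall x, 0 <= h x) -> (forall x, h x <= B) -> lip Lam h -> 0 < e ->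
  \forall k \near \oo, (\int[P']_w (h (limit_rank N0 Q0 Cs Rs w))%:E - e%:E <=
     \int[P k]_w (h (node_rank (G k) w))%:E)%E.
Proof.
move=> h0 hB hL e0; have mh := lip_measurable hL.
have B0 : 0 <= B := le_trans (h0 0) (hB 0); have Lam0 := lip_ge0 hL.
have [theta /andP[th0 th1] rho] := small_theta.
(* One sample, with coupling distance [theta], bounds the moments of the limit laws once and for
   all. *)
have [k0 [w0 reg0]] := regular_sample_exists th0 th1 th0.
have [HN HC [eQ HQ] [[e0N HN0] [e0Q HQ0]]] :=
  regular_sample_means th1 (ltW th0) reg0.
set eN := (nu2 + theta) / _ + _ in HN; set eC := (nu5 + theta) / _ + _ in HC.
rewrite -/eN -/eC in rho.
have eb0 := edge_bound_ge0 HQ HC rho; set eb := edge_bound _ _ _ in eb0.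
have eN0 := eN_ge0 HN; have eC0 := eC_ge0 HC.
pose A := (nu2 + theta) / (nu1 - theta); pose A0 := nu1 + theta.
have pA : 0 <= A by rewrite /A divr_ge0 // ?subr_ge0 ?ltW // addr_gt0.
have pA0 : 0 <= A0 by rewrite addr_ge0 // ltW.
(* Six error terms and the mass missing from [Gd] receive [e / 7] each. *)
have e7 : 0 < e / 7 by rewrite divr_gt0.
have [m [Hm1 Hm2]] : exists m, Lam * A0 * eb * (eN * eC) ^+ m <= e / 7 /\
    Lam * (c ^+ m.+1 * (1 - c)^-1 * H) <= e / 7.
  have G1 : \forall m \near \oo, Lam * A0 * eb * (eN * eC) ^+ m <= e / 7.
    by apply: geometric_small => //; rewrite mulr_ge0.
  have G2 : \forall m \near \oo, Lam * c * (1 - c)^-1 * H * c ^+ m <= e / 7.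
    by apply: geometric_small => //; rewrite (ltW c0).
  near \oo => m; exists m; split; first by near: m.
  rewrite (_ : _ * _ = Lam * c * (1 - c)^-1 * H * c ^+ m); last by rewrite exprS; ring.
  by near: m.
(* The total coefficient of a one-generation error: [A0] times the geometric sum for the generations
   below the root, and 1 for the root. *)
pose W := A0 * (\sum_(i < m) A ^+ i) + 1.
have W0 : 0 <= W.
  by rewrite addr_ge0 // mulr_ge0 // sumr_ge0 // => i _; rewrite exprn_ge0.
have [t t0 Ht] := small_factor (mulr_ge0 Lam0 W0) e7.
have HC1 : (\int[P']_w `|cst (1 : R) w|%:E <= 1%:E)%E.
  by rewrite (eq_integral (fun=> 1%:E)) ?prob_int_cst // => w _; rewrite normr1.
have T1 := tail_small HN HQ HC eb0 t0.
have T2 := tail_small (C := cst 1) HN0 HQ0 HC1 eb0 t0.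
have [K [HK HK0]] : exists K : nat, tail_le P' N Q C eb K%:R t /\
    tail_le P' N0 Q0 (fun=> 1) eb K%:R t.
  by near \oo => K; exists K; split; near: K.
have WK0 : 0 <= Lam * W * (1 + eb + K%:R) by rewrite !mulr_ge0 // !addr_ge0.
have [eta eta0 Heta] := small_factor WK0 e7.
set cost := iter m.-1 (fun x : R => 1 + A * x) 1.
have [Kq Kq0 HKq] : exists2 Kq : nat, (0 < Kq)%N & B * (A0 * cost / Kq%:R) <= e / 7.
  near \oo => q; have q0 : (0 < q)%N by near: q; exact: nbhs_infty_gt.
  exists q => //; rewrite !mulrA ler_pdivrMr ?ltr0n // -ler_pdivrMl //.
  by near: q; exact: nbhs_infty_ger.
have [xi xi0 Hxi] := small_factor
  (mulr_ge0 B0 (mulr_ge0 (ler0n R Kq) (ler0n R Kq.+1))) e7.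
have [del del0 Hdel] := small_factor B0 e7.
have err : exploration_error B Lam A A0 c H m Kq xi +
    root_error eN eQ eC eta K%:R t A t A0 m * Lam <= e - e / 7.
  rewrite /exploration_error /root_error tree_errorE -/cost -/eb.
  rewrite [leLHS](_ : _ = B * (Kq%:R * Kq.+1%:R) * xi + B * (A0 * cost / Kq%:R)
    + Lam * (c ^+ m.+1 * (1 - c)^-1 * H)
    + (Lam * A0 * eb * (eN * eC) ^+ m + Lam * W * (1 + eb + K%:R) * eta + Lam * W * t)).
    lra.
  by rewrite /W; ring.
have RS := regular_samples th0 th1 eta0 del0.
near=> k.
have [Gd [mGd PGd HGd]] : exists Gd : set (T k), [/\ measurable Gd,
    ((1 - del)%:E <= P k Gd)%E &
    forall w, Gd w -> regular_sample theta eta w] by near: k.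
have Hk : (nu3 + theta) / (xi * (nu1 - theta)) ^+ 2 <= k.+1%:R.
  apply: (@le_trans _ _ k%:R); last by rewrite ler_nat.
  by near: k; exact: nbhs_infty_ger.
set I := (\int[P']_w _)%E.
have mI : measurable_fun setT (fun w => h (limit_rank N0 Q0 Cs Rs w)).
  by apply: measurableT_comp => //; exact: measurable_limit_rank.
have IB : (I <= B%:E)%E.
  by rewrite -[leRHS](prob_int_cst P'); apply: nnint_le.
have I0 : (0 <= I)%E by apply: integral_ge0 => w _; rewrite lee_fin.
have If : I \is a fin_num by rewrite ge0_fin_numE // (le_lt_trans IB) ?ltry.
have [x xI] : exists x, I = x%:E by exists (fine I); rewrite fineK.
rewrite xI !lee_fin in I0 IB *.
(* The positive part, because [node_rank_integral_ge] asks for a nonnegative bound; the pairing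
   average is nonnegative anyway. *)
pose low := Num.max (x - (e - e / 7)) 0.
have low0 : 0 <= low by rewrite le_max lexx orbT.
have lowB : low <= B by rewrite ge_max B0 andbT lerBlDr (le_trans IB) // lerDl; lra.
have [b Hb'] : exists b : nat, k.+1%:R * (nu1 + theta) <= b%:R.
  by near \oo => b; exists b; near: b; exact: nbhs_infty_ger.
have := @node_rank_integral_ge _ _ _ _ _ _ (G k) c h c0 c1 mh h0 Gd b low mGd low0.
move=> /(_ _ _ _ _) H1.
apply: (@le_trans _ _ (low%:E * P k Gd)%E); last first.
  apply: H1.
  - move=> w /HGd[[L1 _ _ _ _] _ _ _ _]; rewrite -(ltr0n R).
    by apply: lt_le_trans L1; rewrite mulr_gt0 // subr_gt0.
  - move=> w /HGd[[_ L2 _ _ _] _ _ _ _]; rewrite -(ler_nat R).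
    exact: le_trans L2 Hb'.
  - by move=> w /HGd[_ Hc _ _ _].
  - move=> nn dd L L0 w nnL ddL Gw Dw.
    have := @regular_sample_comparison _ _ _ _ _ _ _ _ _ _ _ m _ _ _ (ltW th0) th1 HN HQ HC rho h0 hB hL (ler0n _ K)
      HK HK0 (ltW eta0) (ltW t0) Kq0 xi0 Hk (HGd _ Gw) nn dd L L0 nnL ddL Dw.
    rewrite -/I xI lee_fin -/A -/A0 => H2.
    rewrite ge_max; apply/andP; split.
      by rewrite lerBlDr; apply: le_trans H2 _; rewrite lerD2l; exact: err.
    rewrite mulr_ge0 // sumr_ge0 // => v _; rewrite mulr_ge0 // sumr_ge0 //.
apply: (@le_trans _ _ (low%:E * (1 - del)%:E)%E).
  rewrite -EFinB -EFinM lee_fin.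
  have : x - (e - e / 7) <= low by rewrite le_max lexx.
  have : low * del <= B * del by rewrite ler_wpM2r // ltW.
  lra.
by apply: lee_wpmul2l PGd; rewrite lee_fin.
Unshelve. all: by end_near. Qed.

End LowerBound.

(** * From lower bounds to convergence in law *)

Section InfConvolution.
Context (R : realType) (g : R -> R) (B : R).
Hypotheses (cg : continuous g) (g0 : forall x, 0 <= g x) (gB : forall x, g x <= B).

(** The Pasch-Hausdorff envelope of [g]. *)
Definition inf_conv (m : nat) (x : R) : R := inf [set g y + m%:R * `|x - y| | y in setT].

Let inf_conv_lb m x : lbound [set g y + m%:R * `|x - y| | y in setT] 0.
Proof. by move=> _ [y _ <-]; rewrite addr_ge0 // mulr_ge0. Qed.

Let inf_conv_has m x : has_inf [set g y + m%:R * `|x - y| | y in setT].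
Proof. by split; [exists (g x + m%:R * `|x - x|), x|exists 0; exact: inf_conv_lb]. Qed.

Lemma inf_conv_le m x y : inf_conv m x <= g y + m%:R * `|x - y|.
Proof. by apply: ge_inf; [exists 0; exact: inf_conv_lb|exists y]. Qed.

Lemma inf_conv_le_self m x : inf_conv m x <= g x.
Proof. by apply: le_trans (inf_conv_le m x x) _; rewrite subrr normr0 mulr0 addr0. Qed.

Lemma le_inf_conv m x z : (forall y, z <= g y + m%:R * `|x - y|) -> z <= inf_conv m x.
Proof.
move=> H; apply: lb_le_inf; first by have [] := inf_conv_has m x.
by move=> _ [y _ <-].
Qed.

Lemma inf_conv_ge0 m x : 0 <= inf_conv m x.
Proof. by apply: le_inf_conv => y; rewrite addr_ge0 // mulr_ge0. Qed.

Lemma inf_conv_lip m : lip m%:R (inf_conv m).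
Proof.
move=> x x'; rewrite -lerBlDr; apply: le_inf_conv => y; rewrite lerBlDr.
apply: le_trans (inf_conv_le m x y) _; rewrite -addrA lerD2l -mulrDr ler_wpM2l //.
by rewrite (le_trans (ler_distD x' x y)) // addrC.
Qed.

(** Points near [x] have [g y >= g x - e] by continuity; for points at distance at least [del] the
    penalty reaches [m * del >= B >= g x] once [m] is large. *)
Lemma inf_conv_cvg x : inf_conv m x @[m --> \oo] --> g x.
Proof.
apply/cvgrPdist_le => e e0.
have /cvgrPdist_le/(_ _ e0)/nbhs_ballP[del /= del0 Hdel] := @cg x.
near=> m; rewrite ger0_norm ?subr_ge0 ?inf_conv_le_self // lerBlDr -lerBlDl.
apply: le_inf_conv => y; rewrite lerBlDl.
have [xy|xy] := ltP `|x - y| del.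
  have := Hdel y xy => H; have := le_trans (ler_norm _) H.
  have : 0 <= m%:R * `|x - y| by rewrite mulr_ge0.
  lra.
have : B <= m%:R * `|x - y|.
  apply: (@le_trans _ _ (m%:R * del)); last by rewrite ler_wpM2l.
  by rewrite -ler_pdivrMr //; near: m; exact: nbhs_infty_ger.
by have := gB x; have := g0 y; have := ltW e0; lra.
Unshelve. all: by end_near. Qed.

End InfConvolution.

Section LowerIntegralAdd.
Import HBNNSimple.

(** Any two simple minorants have integrals adding up to at most [B]. The two suprema are taken in
    turn, the other integral being moved across the inequality, which requires its finiteness. *)
Lemma lower_integral_add_le d (T : measurableType d) (R : realType) (P : probability T R)
    (u v : T -> R) (B : R) : (forall x, 0 <= u x) -> (forall x, 0 <= v x) ->
  (forall x, u x + v x <= B) ->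
  (\int[P]_x (u x)%:E + \int[P]_x (v x)%:E <= B%:E)%E.
Proof.
move=> u0 v0 uvB.
have u0' x : (0 <= (u x)%:E)%E by rewrite lee_fin.
have v0' x : (0 <= (v x)%:E)%E by rewrite lee_fin.
have simple (s t : {nnsfun T >-> R}) : (forall x, s x <= u x) -> (forall x, t x <= v x) ->
    (\int[P]_x (s x)%:E + \int[P]_x (t x)%:E <= B%:E)%E.
  move=> su tv; rewrite -nnintD //.
  rewrite -[leRHS](prob_int_cst P); apply: nnint_le => //.
    by apply: measurable_funD.
    by move=> x; apply: addr_ge0.
  by move=> x; apply: le_trans (uvB x); exact: lerD.
have finB (w : T -> R) : (forall x, 0 <= w x) -> (forall x, w x <= B) ->
    (\int[P]_x (w x)%:E)%E \is a fin_num.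
  move=> w0 wB; have w0' x : (0 <= (w x)%:E)%E by rewrite lee_fin.
  rewrite ge0_fin_numE ?integral_ge0 //; apply: (@le_lt_trans _ _ B%:E); last by rewrite ltry.
  rewrite ge0_integralTE //; apply: ge_ereal_sup => _ [s sw <-].
  rewrite -integralT_nnsfun -[leRHS](prob_int_cst P); apply: nnint_le => // x.
  by have := sw x; rewrite lee_fin => sx; apply: le_trans sx _.
have uB x : u x <= B by apply: le_trans (uvB x); rewrite lerDl.
have vB x : v x <= B by apply: le_trans (uvB x); rewrite lerDr.
rewrite -leeBrDr; last exact: finB.
rewrite [leLHS]ge0_integralTE //; apply: ge_ereal_sup => _ [s su <-].
rewrite -integralT_nnsfun leeBrDr; last exact: finB.
have su' x : s x <= u x by have := su x; rewrite lee_fin.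
rewrite addeC -leeBrDr; last by apply: finB => // x; exact: le_trans (su' x) _.
rewrite [leLHS]ge0_integralTE //; apply: ge_ereal_sup => _ [t tv <-].
have tv' x : t x <= v x by have := tv x; rewrite lee_fin.
rewrite -integralT_nnsfun leeBrDr; last by apply: finB => // x; exact: le_trans (su' x) _.
by rewrite addeC; exact: simple.
Qed.

End LowerIntegralAdd.

Section LawConvergence.
Context (R : realType) (d : nat -> measure_display)
  (T : forall k, measurableType (d k)) (P : forall k, probability (T k) R)
  (X : forall k, T k -> R).
Context d' (T' : measurableType d') (P' : probability T' R) (Y : T' -> R).
Hypothesis mY : measurable_fun setT Y.
Hypothesis lower : forall (h : R -> R) (B Lam e : R), (forall x, 0 <= h x) ->
  (forall x, h x <= B) -> lip Lam h -> 0 < e ->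
  \forall k \near \oo, (\int[P']_w (h (Y w))%:E - e%:E <= \int[P k]_w (h (X w))%:E)%E.

Let measurable_comp (g : R -> R) : continuous g -> measurable_fun setT (g \o Y).
Proof. by move=> cg; apply: measurableT_comp => //; exact: continuous_measurable_fun. Qed.

Let mean_fin (g : R -> R) B : continuous g -> (forall x, 0 <= g x) -> (forall x, g x <= B) ->
  (\int[P']_w (g (Y w))%:E)%E \is a fin_num.
Proof.
move=> cg g0 gB; rewrite ge0_fin_numE; last by apply: integral_ge0 => w _; rewrite lee_fin.
apply: (@le_lt_trans _ _ B%:E); last by rewrite ltry.
rewrite -[leRHS](prob_int_cst P'); apply: nnint_le => //; exact: measurable_comp.
Qed.

Let lower_continuous (g : R -> R) (B e : R) : continuous g -> (forall x, 0 <= g x) ->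
  (forall x, g x <= B) -> 0 < e ->
  \forall k \near \oo, (\int[P']_w (g (Y w))%:E - e%:E <= \int[P k]_w (g (X w))%:E)%E.
Proof.
move=> cg g0 gB e0.
have cm m : continuous (inf_conv g m) := lip_continuous (inf_conv_lip g0 m).
have gmB m x : inf_conv g m x <= B := le_trans (inf_conv_le_self g0 m x) (gB x).
(* On the limit side dominated convergence selects one [m]; on the sample side [inf_conv g m <= g]
   is enough, for every [k] at once. *)
have cvg : (\int[P']_w (inf_conv g m (Y w))%:E @[m --> \oo] --> \int[P']_w (g (Y w))%:E)%E.
  apply: (@dominated_cvg _ _ _ P' setT measurableT (fun m w => (inf_conv g m (Y w))%:E)
    (fun w => (g (Y w))%:E) (cst B%:E)) => //.
  - by move=> m; apply/measurable_EFinP; exact: measurable_comp.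
  - move=> w _; apply: cvg_EFin; first by near=> m.
    exact: (inf_conv_cvg cg g0 gB).
  - exact: finite_measure_integrable_cst.
  - by move=> m w _; rewrite lee_fin ger0_norm ?inf_conv_ge0.
have e2 : 0 < e / 2 by rewrite divr_gt0.
have fg := mean_fin cg g0 gB.
have [m Hm] : exists m, (\int[P']_w (g (Y w))%:E - (e / 2)%:E <=
    \int[P']_w (inf_conv g m (Y w))%:E)%E.
  have /fine_cvgP[H1 /cvgrPdist_le/(_ _ e2) H2] : (\int[P']_w (inf_conv g m (Y w))%:E
    @[m --> \oo] --> (fine (\int[P']_w (g (Y w))%:E))%:E)%E by rewrite fineK.
  near \oo => m; exists m.
  have F1 : (\int[P']_w (inf_conv g m (Y w))%:E)%E \is a fin_num by near: m; exact: H1.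
  have F2 : `|fine (\int[P']_w (g (Y w))%:E)%E -
     fine (\int[P']_w (inf_conv g m (Y w))%:E)%E| <= e / 2 by near: m; exact: H2.
  rewrite -(fineK fg) -(fineK F1) -EFinB lee_fin lerBlDl -lerBlDr.
  exact: le_trans (ler_norm _) F2.
have := lower (inf_conv_ge0 g0 m) (gmB m) (inf_conv_lip g0 m) e2.
move=> H; near=> k.
have Hk : (\int[P']_w (inf_conv g m (Y w))%:E - (e / 2)%:E <=
  \int[P k]_w (inf_conv g m (X w))%:E)%E by near: k.
apply: (@le_trans _ _ (\int[P k]_w (inf_conv g m (X w))%:E)%E); last first.
  apply: ge0_integral_minorant => w; rewrite lee_fin; first exact: inf_conv_ge0.
  exact: inf_conv_le_self.
apply: le_trans Hk; rewrite [e in (_ - e%:E)%E](splitr e) EFinD fin_num_oppeD // addeA.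
by apply: leeB.
Unshelve. all: by end_near. Qed.

Let cvg_nonneg (g : R -> R) (B : R) : continuous g -> (forall x, 0 <= g x) ->
  (forall x, g x <= B) ->
  (\int[P k]_w (g (X w))%:E @[k --> \oo] --> \int[P']_w (g (Y w))%:E)%E.
Proof.
move=> cg g0 gB; have fg := mean_fin cg g0 gB.
pose g' x := B - g x.
have cg' : continuous g' by move=> x; apply: cvgB; [exact: cvg_cst|exact: cg].
have g'0 x : 0 <= g' x by rewrite subr_ge0.
have g'B x : g' x <= B by rewrite lerBlDr lerDl.
have fg' := mean_fin cg' g'0 g'B.
have B0 : 0 <= B := le_trans (g0 0) (gB 0).
(* Equality holds for the measurable [Y]. For [X k] only [<=] holds, which is the direction that
   turns the lower bound for [B - g] into an upper bound for [g]. *)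
have sumY : (\int[P']_w (g (Y w))%:E + \int[P']_w (g' (Y w))%:E = B%:E)%E.
  rewrite -nnintD //; [|exact: measurable_comp..].
  by under eq_integral do rewrite /g' subrKC; rewrite prob_int_cst.
have sumX k : (\int[P k]_w (g (X w))%:E + \int[P k]_w (g' (X w))%:E <= B%:E)%E.
  by apply: lower_integral_add_le => // x; rewrite /g' subrKC.
have pX k (f : R -> R) : (forall x, 0 <= f x) -> (0 <= \int[P k]_w (f (X w))%:E)%E.
  by move=> f0; apply: integral_ge0 => w _; rewrite lee_fin.
have fX k : (\int[P k]_w (g (X w))%:E)%E \is a fin_num.
  rewrite ge0_fin_numE ?pX //; apply: (@le_lt_trans _ _ B%:E); last by rewrite ltry.
  by apply: le_trans (sumX k); rewrite leeDl // pX.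
have fX' k : (\int[P k]_w (g' (X w))%:E)%E \is a fin_num.
  rewrite ge0_fin_numE ?pX //; apply: (@le_lt_trans _ _ B%:E); last by rewrite ltry.
  by apply: le_trans (sumX k); rewrite leeDr // pX.
rewrite -(fineK fg); apply/fine_cvgP; split; first by near=> k.
apply/cvgrPdist_le => e e0; near=> k.
have H1 : (\int[P']_w (g (Y w))%:E - e%:E <= \int[P k]_w (g (X w))%:E)%E.
  by near: k; exact: lower_continuous cg g0 gB e0.
have H2 : (\int[P']_w (g' (Y w))%:E - e%:E <= \int[P k]_w (g' (X w))%:E)%E.
  by near: k; exact: lower_continuous cg' g'0 g'B e0.
move: H1 H2 (sumX k) sumY => /=.
rewrite -(fineK fg) -(fineK fg') -(fineK (fX k)) -(fineK (fX' k)) -!EFinB -!EFinD !lee_fin.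
move=> H1 H2 H3 [H4]; rewrite ler_norml /=; apply/andP; split; lra.
Unshelve. all: by end_near. Qed.

Lemma law_cvg_of_lower_bound : cvg_in_law P X P' Y.
Proof.
move=> f cf bf.
have [M [Mr HM]] := bf.
(* [bounded_fun] provides bounds only for numbers strictly above [M]. *)
pose B := M + 1.
have fB x : `|f x| <= B by apply: HM => //; rewrite ltrDl.
pose fp x := Num.max (f x) 0; pose fn x := Num.max (- f x) 0.
have cfp : continuous fp.
  by move=> x; apply: continuous_max; [exact: cf|exact: cst_continuous].
have cfn : continuous fn.
  move=> x; apply: (@continuous_max _ _ (fun x => - f x) (cst 0)); last exact: cst_continuous.
  by apply: cvgN; exact: cf.
have B0 : 0 <= B := le_trans (normr_ge0 _) (fB 0).
have fp0 x : 0 <= fp x by rewrite le_max lexx orbT.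
have fn0 x : 0 <= fn x by rewrite le_max lexx orbT.
have fpB x : fp x <= B by rewrite ge_max B0 andbT (le_trans (ler_norm _)).
have fnB x : fn x <= B by rewrite ge_max B0 andbT (le_trans (ler_norm _)) // normrN.
(* The integral is a difference of two nonnegative integrals by definition, so this splitting holds
   without measurability of [Z]. *)
have E d0 (U : measurableType d0) (mu : probability U R) (Z : U -> R) :
   ('E_mu[f \o Z] = \int[mu]_w (fp (Z w))%:E - \int[mu]_w (fn (Z w))%:E)%E.
  rewrite expectation.unlock integralE; congr (_ - _)%E; apply: eq_integral => w _.
    by rewrite funeposE -EFin_max.
  by rewrite funenegE -EFinN -EFin_max.
rewrite E; under eq_fun do rewrite E.
apply: cvgeB.
- by apply: fin_num_adde_defl; rewrite fin_numN; exact: (mean_fin cfn fn0 fnB).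
- exact: (cvg_nonneg cfp fp0 fpB).
- exact: (cvg_nonneg cfn fn0 fnB).
Qed.

End LawConvergence.

Theorem theorem6p4 (R : realType) (d : nat -> measure_display)
  (T : forall k, measurableType (d k)) (P : forall k, probability (T k) R)
  (S : forall k, ext_bidegree (P k) k.+1) (G : forall k, dcm (S k))
  (d' : measure_display) (T' : measurableType d') (P' : probability T' R)
  (N0 N : {RV P' >-> nat}) (Q0 Q C : {RV P' >-> R})
  (Nt : seq nat -> {RV P' >-> nat}) (Qt : seq nat -> {RV P' >-> R})
  (Ct : seq nat -> nat -> {RV P' >-> R}) (Cs Rs : nat -> {RV P' >-> R}) :
  assumptionA S ->
  assumptionB S N0 Q0 N Q C ->
  (0 < P' [set w | 0 < `|Q w|]%R)%E ->
  branching_family Nt Qt Ct N Q C ->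
  branching_vector N0 Q0 Cs C ->
  iid_copies Rs (endogenous Nt Qt Ct) ->
  independent2 P' (branching_sigma N0 Q0 Cs) (sigma_family Rs) ->
  cvg_in_law P (fun k => node_rank (G k)) P' (limit_rank N0 Q0 Cs Rs).
Proof.
move=> [H [nu1 [nu2 [nu3 [nu4 [nu5 [[_ nu1_gt0 nu2_gt0 _ _]
  [nu5_gt0 [rho1 [kappa [c [gamma [eps [[_ /andP[c0 c1] /andP[g0 _] /andP[e0 _]]
  HO]]]]]]]]]]]]]] HB _ Hbr Hb HR HbR.
apply: law_cvg_of_lower_bound; first exact: measurable_limit_rank.
move=> h B Lam e; exact: (node_rank_lower_bound G HB nu1_gt0 nu2_gt0
  nu5_gt0 rho1 c0 c1 g0 e0 HO Hbr Hb HR HbR).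
Qed.
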